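(* Let $\Gamma$ be a tropical curve and $D$ an effective divisor on $\Gamma$. Let $F=\{f_1,\ldots,f_n\}$ be a finite generating set of $R(D)$ as a $\boldsymbol{T}$-module such that $f_i\neq-\infty$ for all $i$, and let $\phi_F:\Gamma\setminus\Gamma_\infty\to\mathbb{R}^n$, $x\mapsto(f_1(x),\ldots,f_n(x))$, be the rational map induced by $F$. If $\phi_F$ is injective, then $\operatorname{Rat}(\Gamma)$ is isomorphic to $\overline{\boldsymbol{T}(X_1,\ldots,X_n)}/\boldsymbol{E}(\operatorname{Im}(\phi_F))$ as a $\boldsymbol{T}$-algebra. In particular, if $\deg(D)\ge 2g(\Gamma)+1$, then $\phi_F$ is injective.
   Context: Algebra. The tropical semifield is $\boldsymbol{T}=\mathbb{R}\cup\{-\infty\}$ with $a\oplus b=\max\{a,b\}$ and $a\odot b=a+b$; its zero is $-\infty$ and its one is $0$. A $\boldsymbol{T}$-algebra is a commutative semiring $S$ with a semiring homomorphism $\boldsymbol{T}\to S$; $\boldsymbol{T}$-algebra isomorphisms are bijective semiring homomorphisms compatible with these maps. $\overline{\boldsymbol{T}[X_1,\ldots,X_n]}$ is the quotient of the semiring of tropical polynomials identifying polynomials that define the same function on $\boldsymbol{T}^n$; it is cancellative, and its semifield of fractions is the tropical rational function semifield $\overline{\boldsymbol{T}(X_1,\ldots,X_n)}$, whose elements define functions on $\mathbb{R}^n$ ($f_1\odot f_2^{\odot(-1)}$ gives $x\mapsto f_1(x)-f_2(x)$ for $f_1,f_2\neq-\infty$; $-\infty$ gives the constant $-\infty$). For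 $V\subset\mathbb{R}^n$, $\boldsymbol{E}(V)=\{(f,g)\in\overline{\boldsymbol{T}(X_1,\ldots,X_n)}^2\mid f(x)=g(x)\ \forall x\in V\}$; this is a congruence (an equivalence relation closed under componentwise addition and multiplication), so the quotient semiring is defined. Tropical curves. A graph is a finite connected nonempty multigraph, possibly with loops. A leaf end is a vertex incident to only one edge, this edge not being a loop; a leaf edge is an edge incident to a leaf end. A tropical curve $\Gamma$ is the topological space obtained from a pair $(G,l)$ of a graph $G$ and a function $l:E(G)\to\mathbb{R}_{>0}\cup\{\infty\}$, taking the value $\infty$ only on leaf edges, by identifying each edge $e$ with the interval $[0,l(e)]$, where $[0,\infty]$ is the one-point compactification of $[0,\infty)$ regarded as an extended metric space ($\infty$ has infinite distance to every other point); if $l(e)=\infty$, the leaf end of $e$ is identified with $\infty$. The points identified with $\infty$ are the points at infinity of $\Gamma$ and form the set $\Gamma_\infty$; the others are finite points. The genus $g(\Gamma)$ is the first Betti number of $\Gamma$. A rational function on $\Gamma$ is either the constant function $-\infty$ or a continuous map $f:\Gamma\to\mathbb{R}\cup\{\pm\infty\}$ that is piecewise affine with integer slopes, has finitely many pieces, and takes the values $\pm\infty$ only at points at infinity. $\operatorname{Rat}(\Gamma)$ is the set of rational functions on $\Gamma$; with $(f\oplus g)(x)=\max\{f(x),g(x)\}$ and $(f\odot g)(x)=f(x)+g(x)$ at finite points, extended continuously to points at infinity, it is a semifield and a $\boldsymbol{T}$-algebra (via constants). Divisors. A divisor on $\Gamma$ is an element of the free abelian group generated by all points of $\Gamma$;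 its degree $\deg(D)$ is the sum of its coefficients; it is effective if all coefficients are $\ge0$. For $f\in\operatorname{Rat}(\Gamma)\setminus\{-\infty\}$ and $x\in\Gamma$, $\operatorname{ord}_x(f)$ is the sum of the outgoing slopes of $f$ at $x$ over all outgoing directions (at a point at infinity $x$, the outgoing slope is minus the slope of $f$ in the direction towards $x$ on the part of the leaf edge near $x$; if $\Gamma$ is a single point, $\operatorname{ord}_x(f)=0$), and $\operatorname{div}(f)=\sum_{x\in\Gamma}\operatorname{ord}_x(f)\cdot x$. $R(D)$ is the set of $f\in\operatorname{Rat}(\Gamma)\setminus\{-\infty\}$ with $D+\operatorname{div}(f)$ effective, together with $-\infty$; it is a $\boldsymbol{T}$-module under $\oplus$ and tropical scalar multiplication $(t,f)\mapsto t\odot f$, and it is finitely generated. $F$ generates $R(D)$ if every element of $R(D)$ is of the form $\bigoplus_i t_i\odot f_i$ with $t_i\in\boldsymbol{T}$. *)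

(* Defs.v *)
From HB Require Import structures.
From mathcomp Require Import all_boot all_order all_algebra.
From mathcomp Require Import finmap freeg.
From mathcomp Require Import all_classical all_reals.
From mathcomp Require Import generic_quotient.
From mathcomp Require Import ring lra.
From mathcomp Require Import ereal topology normedtype.

Set Implicit Arguments.
Unset Strict Implicit.
Unset Printing Implicit Defensive.

Import Order.TTheory GRing.Theory Num.Theory.
Import numFieldNormedType.Exports.

Local Open Scope classical_set_scope.
Local Open Scope ring_scope.
Local Open Scope quotient_scope.

(* [None] is -oo, so [0 : trop R] is -oo and [1 : trop R] is the real 0. *)
Definition trop (R : realType) : Type := option R.

Section Tropical.
Variable R : realType.
Implicit Types a b c : trop R.

HB.instance Definition _ := Choice.copy (trop R) (option R).

Definition trop_add a b : trop R :=
  match a, b with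
  | Some x, Some y => Some (Num.max x y)
  | None, _ => b
  | _, None => a
  end.

Definition trop_mul a b : trop R :=
  if a is Some x then if b is Some y then Some (x + y) else None else None.

(* The inverse in the semifield T; its value at -oo is irrelevant. *)
Definition trop_inv a : trop R := if a is Some x then Some (- x) else None.

Fact trop_addA : associative trop_add.
Proof. by move=> [x|] [y|] [z|] //=; rewrite maxA. Qed.

Fact trop_addC : commutative trop_add.
Proof. by move=> [x|] [y|] //=; rewrite maxC. Qed.

Fact trop_add0 : left_id None trop_add.
Proof. by case. Qed.

HB.instance Definition _ :=
  GRing.isNmodule.Build (trop R) trop_addA trop_addC trop_add0.

Fact trop_mulA : associative trop_mul.
Proof. by move=> [x|] [y|] [z|] //=; rewrite addrA. Qed.

Fact trop_mulC : commutative trop_mul.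
Proof. by move=> [x|] [y|] //=; rewrite addrC. Qed.

Fact trop_mul1 : left_id (Some 0) trop_mul.
Proof. by case=> //= x; rewrite add0r. Qed.

Fact trop_mulDl : left_distributive trop_mul trop_add.
Proof. by move=> [x|] [y|] [z|] //=; rewrite addr_maxl. Qed.

Fact trop_mul0 : left_zero None trop_mul.
Proof. by []. Qed.

Fact trop_oner_neq0 : (Some 0 : trop R) != None.
Proof. by []. Qed.

HB.instance Definition _ := GRing.Nmodule_isComNzSemiRing.Build (trop R)
  trop_mulA trop_mulC trop_mul1 trop_mulDl trop_mul0 trop_oner_neq0.

Lemma trop_addE a b : a + b = trop_add a b. Proof. by []. Qed.
Lemma trop_mulE a b : a * b = trop_mul a b. Proof. by []. Qed.
Lemma trop0E : (0 : trop R) = None. Proof. by []. Qed.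
Lemma trop1E : (1 : trop R) = Some 0. Proof. by []. Qed.

Lemma trop_mulVr a : a != 0 -> a * trop_inv a = 1.
Proof. by case: a => // x _; rewrite [LHS]/= /GRing.mul/= subrr. Qed.

End Tropical.

Record talgebra (R : realType) := TAlgebra {
  talg_sort :> comPzSemiRingType;
  talg_map : {rmorphism trop R -> talg_sort}
}.

Definition talg_isomorphic (R : realType) (A B : talgebra R) : Prop :=
  exists phi : {rmorphism A -> B},
    bijective phi /\ (forall a : trop R, phi (talg_map A a) = talg_map B a).

Record congruence (S : comPzSemiRingType) := Congruence {
  cong_rel :> S -> S -> Prop;
  cong_refl : forall x, cong_rel x x;
  cong_sym : forall x y, cong_rel x y -> cong_rel y x;
  cong_trans : forall y x z, cong_rel x y -> cong_rel y z -> cong_rel x z;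
  congD : forall x x' y y',
    cong_rel x x' -> cong_rel y y' -> cong_rel (x + y) (x' + y');
  congM : forall x x' y y',
    cong_rel x x' -> cong_rel y y' -> cong_rel (x * y) (x' * y')
}.

Section CongruenceQuotient.
Variables (S : comPzSemiRingType) (C : congruence S).

Definition cong_bool : rel S := fun x y => `[< C x y >].

Fact cong_bool_refl : reflexive cong_bool.
Proof. by move=> x; apply/asboolP/cong_refl. Qed.

Fact cong_bool_sym : symmetric cong_bool.
Proof. by move=> x y; apply/asboolP/asboolP; apply: cong_sym. Qed.

Fact cong_bool_trans : transitive cong_bool.
Proof.
by move=> y x z /asboolP xy /asboolP yz; apply/asboolP/(cong_trans xy yz).
Qed.

Canonical cong_equiv :=
  EquivRel cong_bool cong_bool_refl cong_bool_sym cong_bool_trans.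

Definition cong_quot := {eq_quot cong_equiv}.
HB.instance Definition _ := EqQuotient.on cong_quot.
HB.instance Definition _ := Choice.on cong_quot.

Lemma cong_piP x y : \pi_cong_quot x = \pi_cong_quot y <-> C x y.
Proof.
split=> [/eqquotP|h]; first by move=> /asboolP.
by apply/eqquotP/asboolP.
Qed.

Lemma cong_repr x : C (repr (\pi_cong_quot x)) x.
Proof. by apply/cong_piP; rewrite reprK. Qed.

Definition cong_add (x y : cong_quot) := \pi_cong_quot (repr x + repr y).
Definition cong_mul (x y : cong_quot) := \pi_cong_quot (repr x * repr y).

Lemma cong_piD x y :
  \pi_cong_quot (x + y) = cong_add (\pi_cong_quot x) (\pi_cong_quot y).
Proof. by apply/cong_piP/cong_sym/congD; exact: cong_repr. Qed.

Lemma cong_piM x y :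
  \pi_cong_quot (x * y) = cong_mul (\pi_cong_quot x) (\pi_cong_quot y).
Proof. by apply/cong_piP/cong_sym/congM; exact: cong_repr. Qed.

Fact cong_addA : associative cong_add.
Proof.
elim/quotW=> x; elim/quotW=> y; elim/quotW=> z.
by rewrite -(cong_piD y z) -(cong_piD x y) -!cong_piD addrA.
Qed.

Fact cong_addC : commutative cong_add.
Proof. by elim/quotW=> x; elim/quotW=> y; rewrite -!cong_piD addrC. Qed.

Fact cong_add0 : left_id (\pi_cong_quot 0) cong_add.
Proof. by elim/quotW=> x; rewrite -cong_piD add0r. Qed.

HB.instance Definition _ :=
  GRing.isNmodule.Build cong_quot cong_addA cong_addC cong_add0.

Fact cong_mulA : associative cong_mul.
Proof.
elim/quotW=> x; elim/quotW=> y; elim/quotW=> z.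
by rewrite -(cong_piM y z) -(cong_piM x y) -!cong_piM mulrA.
Qed.

Fact cong_mulC : commutative cong_mul.
Proof. by elim/quotW=> x; elim/quotW=> y; rewrite -!cong_piM mulrC. Qed.

Fact cong_mul1 : left_id (\pi_cong_quot 1) cong_mul.
Proof. by elim/quotW=> x; rewrite -cong_piM mul1r. Qed.

Fact cong_mulDl : left_distributive cong_mul cong_add.
Proof.
elim/quotW=> x; elim/quotW=> y; elim/quotW=> z.
by rewrite -(cong_piD x y) -(cong_piM x z) -(cong_piM y z) -cong_piM -cong_piD mulrDl.
Qed.

Fact cong_mul0 : left_zero (\pi_cong_quot 0) cong_mul.
Proof. by elim/quotW=> x; rewrite -cong_piM mul0r. Qed.

HB.instance Definition _ := GRing.Nmodule_isComPzSemiRing.Build cong_quot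
  cong_mulA cong_mulC cong_mul1 cong_mulDl cong_mul0.

Definition cong_proj (x : S) : cong_quot := \pi_cong_quot x.

HB.instance Definition _ := GRing.isNmodMorphism.Build S cong_quot cong_proj
  (conj erefl cong_piD).
HB.instance Definition _ := GRing.isMonoidMorphism.Build S cong_quot cong_proj
  (conj erefl cong_piM).

Lemma cong_projP x y : cong_proj x = cong_proj y <-> C x y.
Proof. exact: cong_piP. Qed.

Lemma cong_proj_surj (X : cong_quot) : exists x, X = cong_proj x.
Proof. by elim/quotW: X => x; exists x. Qed.

End CongruenceQuotient.

Definition cancellative (S : comNzSemiRingType) : Prop :=
  forall a b c : S, a != 0 -> a * b = a * c -> b = c.

Section Fractions.
Variables (S : comNzSemiRingType) (cancS : cancellative S).

Definition fpair : Type := {ab : S * S | ab.2 != 0}.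
HB.instance Definition _ := Choice.on fpair.

Definition fnum (f : fpair) : S := (val f).1.
Definition fden (f : fpair) : S := (val f).2.

Lemma den_neq0 f : fden f != 0. Proof. exact: (valP f). Qed.

Lemma canc_mulf_neq0 (a b : S) : a != 0 -> b != 0 -> a * b != 0.
Proof.
move=> a0 b0; apply: contraNneq b0 => ab0.
by apply/eqP/(cancS a0); rewrite mulr0.
Qed.

Definition frac_rel : rel fpair := fun f g => fnum f * fden g == fnum g * fden f.

Fact frac_rel_refl : reflexive frac_rel.
Proof. by move=> f; rewrite /frac_rel. Qed.

Fact frac_rel_sym : symmetric frac_rel.
Proof. by move=> f g; rewrite /frac_rel eq_sym. Qed.

Fact frac_rel_trans : transitive frac_rel.
Proof.
move=> g f h /eqP fg /eqP gh; apply/eqP/(cancS (den_neq0 g)).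
by rewrite mulrCA mulrA fg mulrAC gh [RHS]mulrCA mulrA.
Qed.

Canonical frac_equiv :=
  EquivRel frac_rel frac_rel_refl frac_rel_sym frac_rel_trans.

Definition frac := {eq_quot frac_equiv}.
HB.instance Definition _ := EqQuotient.on frac.
HB.instance Definition _ := Choice.on frac.

Definition mkfpair (a b : S) (b0 : b != 0) : fpair := exist _ (a, b) b0.

Definition fpair_add (f g : fpair) : fpair :=
  mkfpair (fnum f * fden g + fnum g * fden f)
          (canc_mulf_neq0 (den_neq0 f) (den_neq0 g)).

Definition fpair_mul (f g : fpair) : fpair :=
  mkfpair (fnum f * fnum g) (canc_mulf_neq0 (den_neq0 f) (den_neq0 g)).

Definition fpair_const (a : S) : fpair := mkfpair a (oner_neq0 S).

Lemma frac_piP f g :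
  \pi_frac f = \pi_frac g <-> fnum f * fden g = fnum g * fden f.
Proof. by split=> [/eqquotP/eqP//|h]; apply/eqquotP/eqP. Qed.

Lemma frac_surj (x : frac) : exists f, x = \pi_frac f.
Proof. by elim/quotW: x => f; exists f. Qed.

Lemma frac_repr f :
  fnum (repr (\pi_frac f)) * fden f = fnum f * fden (repr (\pi_frac f)).
Proof. by apply/frac_piP; rewrite reprK. Qed.

Definition frac_add (x y : frac) : frac := \pi_frac (fpair_add (repr x) (repr y)).
Definition frac_mul (x y : frac) : frac := \pi_frac (fpair_mul (repr x) (repr y)).

Lemma frac_piD f g :
  \pi_frac (fpair_add f g) = frac_add (\pi_frac f) (\pi_frac g).
Proof.
apply/frac_piP; rewrite /fpair_add /fnum /fden/= -/(fnum _) -/(fden _).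
have := frac_repr f; have := frac_repr g.
set f' := repr _; set g' := repr _ => eg ef.
rewrite -!/(fnum _) -!/(fden _) !mulrDl; congr (_ + _).
  by rewrite [LHS]mulrACA -ef [RHS]mulrACA; congr (_ * _); exact: mulrC.
by rewrite [fden g' * _]mulrC [LHS]mulrACA -eg [fden f * fden g]mulrC [RHS]mulrACA [fden g' * fden f]mulrC.
Qed.

Lemma frac_piM f g :
  \pi_frac (fpair_mul f g) = frac_mul (\pi_frac f) (\pi_frac g).
Proof.
apply/frac_piP; rewrite /fpair_mul /fnum /fden/=.
have := frac_repr f; have := frac_repr g.
set f' := repr _; set g' := repr _ => eg ef.
by rewrite -!/(fnum _) -!/(fden _) mulrACA -ef -eg mulrACA.
Qed.

Fact frac_addA : associative frac_add.
Proof.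
elim/quotW=> f; elim/quotW=> g; elim/quotW=> h.
rewrite -(frac_piD g h) -(frac_piD f g) -!frac_piD.
apply/frac_piP; rewrite /fpair_add /fnum /fden/= -!/(fnum _) -!/(fden _).
congr (_ * _); last by rewrite mulrA.
rewrite !mulrDl addrA; congr (_ + _ + _); rewrite -!mulrA //.
  by congr (_ * _); exact: mulrC.
by congr (_ * _); exact: mulrC.
Qed.

Fact frac_addC : commutative frac_add.
Proof.
elim/quotW=> f; elim/quotW=> g; rewrite -!frac_piD.
apply/frac_piP; rewrite /fpair_add /fnum /fden/= -!/(fnum _) -!/(fden _).
by rewrite addrC [fden f * _]mulrC.
Qed.

Fact frac_add0 : left_id (\pi_frac (fpair_const 0)) frac_add.
Proof.
elim/quotW=> f; rewrite -!frac_piD; apply/frac_piP.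
rewrite /fpair_add /fnum /fden/= -!/(fnum _) -!/(fden _).
by rewrite mul0r add0r mulr1 mul1r.
Qed.

HB.instance Definition _ :=
  GRing.isNmodule.Build frac frac_addA frac_addC frac_add0.

Fact frac_mulA : associative frac_mul.
Proof.
elim/quotW=> f; elim/quotW=> g; elim/quotW=> h.
rewrite -(frac_piM g h) -(frac_piM f g) -!frac_piM.
apply/frac_piP; rewrite /fpair_mul /fnum /fden/= -!/(fnum _) -!/(fden _).
by rewrite !mulrA.
Qed.

Fact frac_mulC : commutative frac_mul.
Proof.
elim/quotW=> f; elim/quotW=> g; rewrite -!frac_piM.
apply/frac_piP; rewrite /fpair_mul /fnum /fden/= -!/(fnum _) -!/(fden _).
by congr (_ * _); exact: mulrC.
Qed.

Fact frac_mul1 : left_id (\pi_frac (fpair_const 1)) frac_mul.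
Proof.
elim/quotW=> f; rewrite -!frac_piM; apply/frac_piP.
rewrite /fpair_mul /fnum /fden/= -!/(fnum _) -!/(fden _).
by rewrite !mul1r.
Qed.

Fact frac_mulDl : left_distributive frac_mul frac_add.
Proof.
elim/quotW=> f; elim/quotW=> g; elim/quotW=> h.
rewrite -(frac_piD f g) -(frac_piM f h) -(frac_piM g h) -frac_piM -frac_piD; apply/frac_piP.
rewrite /fpair_mul /fpair_add /fnum /fden/= -!/(fnum _) -!/(fden _).
by ring.
Qed.

Fact frac_mul0 : left_zero (\pi_frac (fpair_const 0)) frac_mul.
Proof.
elim/quotW=> f; rewrite -!frac_piM; apply/frac_piP.
by rewrite /fpair_mul /fnum /fden/= -!/(fnum _) -!/(fden _) !mul0r.
Qed.

HB.instance Definition _ := GRing.Nmodule_isComPzSemiRing.Build frac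
  frac_mulA frac_mulC frac_mul1 frac_mulDl frac_mul0.

Definition frac_const (a : S) : frac := \pi_frac (fpair_const a).

Fact frac_const_nmod : nmod_morphism frac_const.
Proof.
split=> // a b; rewrite -[RHS]frac_piD; apply/frac_piP.
by rewrite /fpair_add /fnum /fden/= !mulr1.
Qed.

Fact frac_const_monoid : monoid_morphism frac_const.
Proof.
split=> // a b; rewrite -[RHS]frac_piM; apply/frac_piP.
by rewrite /fpair_mul /fnum /fden/= !mulr1.
Qed.

HB.instance Definition _ :=
  GRing.isNmodMorphism.Build S frac frac_const frac_const_nmod.
HB.instance Definition _ :=
  GRing.isMonoidMorphism.Build S frac frac_const frac_const_monoid.

End Fractions.

(* T[X_1, .., X_n] as the iterated polynomial semiring T[X_1]..[X_n]: the
   outermost variable of [tpoly n.+1] is the last one. *)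
Fixpoint tpoly (R : realType) (n : nat) : comNzSemiRingType :=
  if n is m.+1 then {poly tpoly R m} else trop R.

Fixpoint tpoly_const (R : realType) (n : nat) : {rmorphism trop R -> tpoly R n} :=
  if n is m.+1 then (polyC \o tpoly_const R m : {rmorphism _ -> _}) else idfun.

Fixpoint tpoly_eval (R : realType) (n : nat) :
    ('I_n -> trop R) -> {rmorphism tpoly R n -> trop R} :=
  match n with
  | 0 => fun=> idfun
  | m.+1 => fun x =>
      (horner_eval (x ord_max)
       \o map_poly (tpoly_eval (fun i : 'I_m => x (widen_ord (leqnSn m) i))) :
        {rmorphism {poly tpoly R m} -> trop R})
  end.

Section TropicalPolynomials.
Variables (R : realType) (n : nat).

Definition same_function (p q : tpoly R n) : Prop :=
  forall x : 'I_n -> trop R, tpoly_eval x p = tpoly_eval x q.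

Fact same_function_refl p : same_function p p. Proof. by []. Qed.

Fact same_function_sym p q : same_function p q -> same_function q p.
Proof. by move=> h x. Qed.

Fact same_function_trans q p r :
  same_function p q -> same_function q r -> same_function p r.
Proof. by move=> pq qr x; rewrite pq. Qed.

Fact same_functionD p p' q q' : same_function p p' -> same_function q q' ->
  same_function (p + q) (p' + q').
Proof. by move=> pp qq x; rewrite !rmorphD pp qq. Qed.

Fact same_functionM p p' q q' : same_function p p' -> same_function q q' ->
  same_function (p * q) (p' * q').
Proof. by move=> pp qq x; rewrite !rmorphM pp qq. Qed.

Definition same_function_cong : congruence (tpoly R n) :=
  Congruence same_function_refl same_function_sym same_function_trans
    same_functionD same_functionM.

(* Tropical polynomials up to equality of functions on T^n. *)
Definition tpolyfun : Type := cong_quot same_function_cong.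
HB.instance Definition _ := GRing.ComPzSemiRing.on tpolyfun.

Definition tpolyfun_proj : {rmorphism tpoly R n -> tpolyfun} :=
  @cong_proj _ same_function_cong.

Lemma tpolyfun_projP p q :
  tpolyfun_proj p = tpolyfun_proj q <-> same_function p q.
Proof. exact: cong_projP. Qed.

Fact tpolyfun_oner_neq0 : (1 : tpolyfun) != 0.
Proof.
apply/eqP; rewrite -(rmorph1 tpolyfun_proj) -(rmorph0 tpolyfun_proj).
by move=> /tpolyfun_projP /(_ (fun=> 0)); rewrite rmorph1 rmorph0.
Qed.

HB.instance Definition _ :=
  GRing.PzSemiRing_isNonZero.Build tpolyfun tpolyfun_oner_neq0.

Definition tpolyfun_eval (x : 'I_n -> trop R) (p : tpolyfun) : trop R :=
  tpoly_eval x (repr p).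

Lemma tpolyfun_evalE x p : tpolyfun_eval x (tpolyfun_proj p) = tpoly_eval x p.
Proof. by move: x; apply: (@cong_repr _ same_function_cong). Qed.

Lemma tpolyfun_projK (f : tpolyfun) : exists p, f = tpolyfun_proj p.
Proof. exact: cong_proj_surj. Qed.

Fact tpolyfun_eval_nmod x : nmod_morphism (tpolyfun_eval x).
Proof.
split=> [|f g]; first by rewrite -(rmorph0 tpolyfun_proj) tpolyfun_evalE rmorph0.
have [p ->] := tpolyfun_projK f; have [q ->] := tpolyfun_projK g.
by rewrite -rmorphD !tpolyfun_evalE rmorphD.
Qed.

Fact tpolyfun_eval_monoid x : monoid_morphism (tpolyfun_eval x).
Proof.
split=> [|f g]; first by rewrite -(rmorph1 tpolyfun_proj) tpolyfun_evalE rmorph1.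
have [p ->] := tpolyfun_projK f; have [q ->] := tpolyfun_projK g.
by rewrite -rmorphM !tpolyfun_evalE rmorphM.
Qed.

HB.instance Definition _ x := GRing.isNmodMorphism.Build tpolyfun (trop R)
  (tpolyfun_eval x) (tpolyfun_eval_nmod x).
HB.instance Definition _ x := GRing.isMonoidMorphism.Build tpolyfun (trop R)
  (tpolyfun_eval x) (tpolyfun_eval_monoid x).

Lemma tpolyfunP (f g : tpolyfun) :
  (forall x, tpolyfun_eval x f = tpolyfun_eval x g) -> f = g.
Proof.
have [p ->] := tpolyfun_projK f; have [q ->] := tpolyfun_projK g => fg.
by apply/tpolyfun_projP => x; rewrite -!tpolyfun_evalE.
Qed.

End TropicalPolynomials.

Definition real_pt (R : realType) (n : nat) (b : 'I_n -> R) : 'I_n -> trop R :=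
  fun i => Some (b i).

Section Cancellativity.
Variable R : realType.

Lemma tpoly_eval_real_eq0 n (p : tpoly R n) (b : 'I_n -> R) :
  tpoly_eval (real_pt b) p = 0 -> p = 0.
Proof.
elim: n p b => [|n IHn] //= p b.
rewrite /horner_eval; elim/poly_ind: p => [//|p c IHp].
rewrite rmorphD rmorphM/= map_polyX map_polyC/= hornerMXaddC.
move=> h.
have [hp hc] : (map_poly (tpoly_eval
     (fun i => real_pt b (widen_ord (leqnSn n) i))) p).[real_pt b ord_max] = 0 /\
   tpoly_eval (fun i => real_pt b (widen_ord (leqnSn n) i)) c = 0.
  by move: h; rewrite trop_addE trop_mulE; case: (_.[_]) => [x|]; case: (tpoly_eval _ _).
by rewrite (IHp hp) mul0r add0r (IHn c _ hc).
Qed.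

(* [u] tends to [l] in a strong sense, as [s] tends to +oo. *)
Let tends (u : R -> trop R) (l : trop R) : Prop :=
  if l is Some c then exists M, forall s, M <= s -> u s = Some c
  else forall c, exists M, forall s, M <= s ->
         if u s is Some y then y < c else true.

Let tends_cst l : tends (fun=> l) l.
Proof. by case: l => [c|c]; exists 0. Qed.

Let tendsD u v l m : tends u l -> tends v m -> tends (fun s => u s + v s) (l + m).
Proof.
rewrite trop_addE; case: l => [a|]; case: m => [b|] /= hu hv.
- have [M hM] := hu; have [N hN] := hv; exists (Num.max M N) => s.
  by rewrite ge_max => /andP[/hM -> /hN ->].
- have [M hM] := hu; have [N hN] := hv a; exists (Num.max M N) => s.
  rewrite ge_max => /andP[/hM -> /hN]; case: (v s) => [y /ltW ya|] //.
  by rewrite trop_addE /= max_l.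
- have [M hM] := hu b; have [N hN] := hv; exists (Num.max M N) => s.
  rewrite ge_max => /andP[/hM + /hN ->]; case: (u s) => [y /ltW ya|] //.
  by rewrite trop_addE /= max_r.
- move=> c; have [M hM] := hu c; have [N hN] := hv c; exists (Num.max M N) => s.
  rewrite ge_max => /andP[/hM + /hN]; rewrite trop_addE.
  by case: (u s) => [y|]; case: (v s) => [z|] //=; rewrite gt_max => -> ->.
Qed.

Let tendsM u v l m : tends u l -> tends v m -> tends (fun s => u s * v s) (l * m).
Proof.
rewrite trop_mulE; case: l => [a|]; case: m => [b|] /= hu hv.
- have [M hM] := hu; have [N hN] := hv; exists (Num.max M N) => s.
  by rewrite ge_max => /andP[/hM -> /hN ->].
- move=> c; have [M hM] := hu; have [N hN] := hv (c - a).
  exists (Num.max M N) => s.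
  rewrite ge_max => /andP[/hM -> /hN]; rewrite trop_mulE.
  by case: (v s) => [y|] //=; rewrite ltrBrDl.
- move=> c; have [M hM] := hu (c - b); have [N hN] := hv.
  exists (Num.max M N) => s.
  rewrite ge_max => /andP[/hM + /hN ->]; rewrite trop_mulE.
  by case: (u s) => [y|] //=; rewrite ltrBrDr.
- move=> c; have [M hM] := hu 0; have [N hN] := hv c; exists (Num.max M N) => s.
  rewrite ge_max => /andP[/hM + /hN]; rewrite trop_mulE.
  case: (u s) => [y|]; case: (v s) => [z|] //= y0 zc.
  by rewrite -[c]add0r ltrD.
Qed.

Let tends_unique u l m : tends u l -> tends u m -> l = m.
Proof.
have lem (M N : R) : M <= Num.max M N /\ N <= Num.max M N.
  by rewrite !le_max !lexx orbT.
case: l => [a|]; case: m => [b|] //= hu hv.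
- have [M hM] := hu; have [N hN] := hv; have [MM NN] := lem M N.
  by rewrite -(hM _ MM) (hN _ NN).
- have [M hM] := hu; have [N hN] := hv a; have [MM NN] := lem M N.
  by have := hN _ NN; rewrite (hM _ MM) ltxx.
- have [M hM] := hu b; have [N hN] := hv; have [MM NN] := lem M N.
  by have := hM _ MM; rewrite (hN _ NN) ltxx.
Qed.

Let approx n (a : 'I_n -> trop R) (s : R) : 'I_n -> R :=
  fun i => if a i is Some c then c else - s.

Let tends_eval n (p : tpoly R n) (a : 'I_n -> trop R) :
  tends (fun s => tpoly_eval (real_pt (approx a s)) p) (tpoly_eval a p).
Proof.
elim: n p a => [|n IHn] p a /=; first exact: tends_cst.
rewrite /horner_eval; elim/poly_ind: p => [|p c IHp].
  rewrite rmorph0 horner0 (_ : (fun=> _) = fun=> 0); first exact: tends_cst.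
  by apply/funext => s; rewrite rmorph0 horner0.
rewrite rmorphD rmorphM/= map_polyX map_polyC/= hornerMXaddC.
under eq_fun do
  rewrite rmorphD rmorphM/= map_polyX map_polyC/= hornerMXaddC.
apply: tendsD; last exact: IHn.
apply: tendsM; first exact: IHp.
rewrite /real_pt /approx; case: (a ord_max) => [x|] /=; first by exists 0.
by move=> x; exists (1 - x) => s; lra.
Qed.

Lemma tpoly_eval_realP n (p q : tpoly R n) :
  (forall b, tpoly_eval (real_pt b) p = tpoly_eval (real_pt b) q) ->
  forall a, tpoly_eval a p = tpoly_eval a q.
Proof.
move=> pq a; apply: tends_unique (tends_eval p a) _.
by under eq_fun do rewrite pq; exact: tends_eval.
Qed.

Lemma tpolyfun_eval_real_eq0 n (f : tpolyfun R n) (b : 'I_n -> R) :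
  tpolyfun_eval (real_pt b) f = 0 -> f = 0.
Proof.
have [p ->] := tpolyfun_projK f.
by rewrite tpolyfun_evalE => /tpoly_eval_real_eq0 ->; rewrite rmorph0.
Qed.

Lemma tpolyfun_real_inj n (f g : tpolyfun R n) :
  (forall b, tpolyfun_eval (real_pt b) f = tpolyfun_eval (real_pt b) g) -> f = g.
Proof.
have [p ->] := tpolyfun_projK f; have [q ->] := tpolyfun_projK g => fg.
apply/tpolyfun_projP; apply: tpoly_eval_realP => b.
by rewrite -!tpolyfun_evalE.
Qed.

Lemma tpolyfun_cancellative n : cancellative (tpolyfun R n).
Proof.
move=> f g h f0 fgh; apply: tpolyfun_real_inj => b.
have : tpolyfun_eval (real_pt b) f != 0.
  by apply: contraNneq f0 => /tpolyfun_eval_real_eq0 ->.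
move: (congr1 (tpolyfun_eval (real_pt b)) fgh); rewrite !rmorphM/=.
set u := tpolyfun_eval _ f => e u0.
by rewrite -[LHS]mul1r -[RHS]mul1r -(trop_mulVr u0) ![u * _]mulrC -!mulrA e.
Qed.

End Cancellativity.

(* The tropical rational function semifield. *)
Definition trat (R : realType) (n : nat) : comPzSemiRingType :=
  frac (@tpolyfun_cancellative R n).

Section TropicalRationalFunctions.
Variables (R : realType) (n : nat).

Definition fpair_eval (x : 'I_n -> R) (f : fpair (tpolyfun R n)) : trop R :=
  tpolyfun_eval (real_pt x) (fnum f)
  * trop_inv (tpolyfun_eval (real_pt x) (fden f)).

Definition trat_eval (x : 'I_n -> R) (f : trat R n) : trop R :=
  fpair_eval x (repr f).

Lemma tpolyfun_eval_den x (f : fpair (tpolyfun R n)) :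
  tpolyfun_eval (real_pt x) (fden f) != 0.
Proof.
by apply: contraNneq (den_neq0 f) => /tpolyfun_eval_real_eq0 ->.
Qed.

Let frac_eqP (a b c d : trop R) : b != 0 -> d != 0 ->
  a * d = c * b -> a * trop_inv b = c * trop_inv d.
Proof.
move=> b0 d0 e.
rewrite -[LHS]mulr1 -(trop_mulVr d0) mulrACA e.
by rewrite -mulrA [b * _]mulrA (trop_mulVr b0) mul1r.
Qed.

Lemma trat_evalE x f :
  trat_eval x (\pi_(frac (@tpolyfun_cancellative R n)) f) = fpair_eval x f.
Proof.
rewrite /trat_eval /fpair_eval; apply: frac_eqP; rewrite ?tpolyfun_eval_den//.
by rewrite -!rmorphM; congr (tpolyfun_eval _ _); exact: frac_repr.
Qed.

Let invM (a b : trop R) : trop_inv (a * b) = trop_inv a * trop_inv b.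
Proof.
by case: a => [a|]; case: b => [b|] //=; congr Some; rewrite opprD.
Qed.

Fact trat_eval_nmod x : nmod_morphism (trat_eval x).
Proof.
split=> [|f g].
  by rewrite -[0 in LHS]/(frac_const _ 0) /frac_const trat_evalE /fpair_eval rmorph0 mul0r.
have [f' ->] := frac_surj f; have [g' ->] := frac_surj g.
move: f' g' => {}f {}g.
have -> : (\pi_(frac (@tpolyfun_cancellative R n)) f : trat R n)
  + \pi_(frac (@tpolyfun_cancellative R n)) g
  = \pi_(frac (@tpolyfun_cancellative R n))
      (fpair_add (@tpolyfun_cancellative R n) f g) :> trat R n.
  by rewrite frac_piD.
rewrite !trat_evalE /fpair_eval/=.
rewrite [fnum (fpair_add _ _ _)]/(fnum f * fden g + fnum g * fden f).
rewrite [fden (fpair_add _ _ _)]/(fden f * fden g).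
rewrite rmorphD !rmorphM invM mulrDl.
have := tpolyfun_eval_den x f; have := tpolyfun_eval_den x g.
set u := tpolyfun_eval _ _; set v := tpolyfun_eval _ _ => u0 v0.
rewrite -/u -/v; congr (_ + _).
  by rewrite mulrACA trop_mulVr// mulr1.
by rewrite [trop_inv v * _]mulrC mulrACA trop_mulVr// mulr1.
Qed.

Fact trat_eval_monoid x : monoid_morphism (trat_eval x).
Proof.
split=> [|f g].
  rewrite -[1 in LHS]/(frac_const _ 1) /frac_const trat_evalE /fpair_eval.
  have -> : fnum (fpair_const (1 : tpolyfun R n)) = 1 by [].
  have -> : fden (fpair_const (1 : tpolyfun R n)) = 1 by [].
  by rewrite rmorph1 mul1r trop1E /= oppr0.
have [f' ->] := frac_surj f; have [g' ->] := frac_surj g.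
move: f' g' => {}f {}g.
have -> : (\pi_(frac (@tpolyfun_cancellative R n)) f : trat R n)
  * \pi_(frac (@tpolyfun_cancellative R n)) g
  = \pi_(frac (@tpolyfun_cancellative R n))
      (fpair_mul (@tpolyfun_cancellative R n) f g) :> trat R n.
  by rewrite frac_piM.
rewrite !trat_evalE /fpair_eval/=.
rewrite [fnum (fpair_mul _ _ _)]/(fnum f * fnum g).
rewrite [fden (fpair_mul _ _ _)]/(fden f * fden g).
by rewrite !rmorphM invM mulrACA.
Qed.

HB.instance Definition _ x := GRing.isNmodMorphism.Build (trat R n) (trop R)
  (trat_eval x) (trat_eval_nmod x).
HB.instance Definition _ x := GRing.isMonoidMorphism.Build (trat R n) (trop R)
  (trat_eval x) (trat_eval_monoid x).

Definition trat_const : {rmorphism trop R -> trat R n} :=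
  @frac_const _ (@tpolyfun_cancellative R n)
  \o (@tpolyfun_proj R n \o tpoly_const R n).

Variable V : set ('I_n -> R).

Definition Econg_rel (f g : trat R n) : Prop :=
  forall x, V x -> trat_eval x f = trat_eval x g.

Fact Econg_refl f : Econg_rel f f. Proof. by []. Qed.

Fact Econg_sym f g : Econg_rel f g -> Econg_rel g f.
Proof. by move=> h x Vx; rewrite h. Qed.

Fact Econg_trans g f h : Econg_rel f g -> Econg_rel g h -> Econg_rel f h.
Proof. by move=> fg gh x Vx; rewrite fg// gh. Qed.

Fact EcongD f f' g g' : Econg_rel f f' -> Econg_rel g g' ->
  Econg_rel (f + g) (f' + g').
Proof. by move=> ff gg x Vx; rewrite !rmorphD/= ff// gg. Qed.

Fact EcongM f f' g g' : Econg_rel f f' -> Econg_rel g g' ->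
  Econg_rel (f * g) (f' * g').
Proof. by move=> ff gg x Vx; rewrite !rmorphM/= ff// gg. Qed.

(* E(V). *)
Definition Econg : congruence (trat R n) :=
  Congruence Econg_refl Econg_sym Econg_trans EcongD EcongM.

Definition trat_quot : talgebra R :=
  TAlgebra (@cong_proj _ Econg \o trat_const : {rmorphism _ -> _}).

End TropicalRationalFunctions.

Record graph := Graph {
  vertex : finType;
  edge : finType;
  src : edge -> vertex;
  tgt : edge -> vertex;
  graph_nonempty : (0 < #|vertex|)%N;
  graph_connected : forall u v : vertex,
    connect (fun a b => [exists e, (src e == a) && (tgt e == b)
                                || (src e == b) && (tgt e == a)]) u v
}.
Arguments src {g} e.
Arguments tgt {g} e.

Definition incident (G : graph) (e : edge G) (v : vertex G) : bool :=
  (src e == v) || (tgt e == v).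

Definition leaf_end (G : graph) (v : vertex G) : Prop :=
  exists e : edge G, src e != tgt e /\ forall e', incident e' v = (e' == e).

(* The orientation records the identification of an edge e with [0, len e]:
   [src e] is at 0 and [tgt e] at [len e]. *)
Record tropical_curve (R : realType) := TropicalCurve {
  curve_graph :> graph;
  len : edge curve_graph -> \bar R;
  len_gt0 : forall e, (0 < len e)%E;
  len_infty : forall e, len e = +oo%E -> leaf_end (tgt e)
}.
Arguments len {R t} e.

(* dim H_1(G; Q): there are no 2-cells, so H_1 is the space of 1-cycles. *)
Definition boundary (G : graph) : 'M[rat]_(#|edge G|, #|vertex G|) :=
  \matrix_(i, j) ((tgt (enum_val i) == enum_val j)%:R
                  - (src (enum_val i) == enum_val j)%:R).

Definition genus (G : graph) : nat := \rank (kermx (boundary G)).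

(* (e, t) is the point of the interior of e at distance t from [src e]. *)
Definition inner_point (R : realType) (Gamma : tropical_curve R) : Type :=
  {et : edge Gamma * R | (0 < et.2) && (et.2%:E < len et.1)%E}.

Definition curve_point (R : realType) (Gamma : tropical_curve R) : Type :=
  (vertex Gamma + inner_point Gamma)%type.

Section Points.
Variables (R : realType) (Gamma : tropical_curve R).
Implicit Types (e : edge Gamma) (x : curve_point Gamma).

HB.instance Definition _ := SubChoice.on (inner_point Gamma).
HB.instance Definition _ := Choice.on (curve_point Gamma).

(* The gluing map [0, len e] -> Gamma; its values outside of [0, len e] are
   irrelevant. *)
Definition edge_pt e (t : \bar R) : curve_point Gamma :=
  if (t <= 0)%E then inl (src e)
  else if (insub (e, fine t) : option (inner_point Gamma)) is Some p then inr p
  else inl (tgt e).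

Definition edge_itv e : set (\bar R) := [set t | (0 <= t <= len e)%E].

(* The quotient topology of the disjoint union of the [0, len e]. *)
Definition point_open : set_system (curve_point Gamma) :=
  [set U | forall e, open (edge_pt e @^-1` U : set (subspace (edge_itv e)))].

Fact point_openT : point_open setT.
Proof. by move=> e; rewrite preimage_setT; exact: openT. Qed.

Fact point_openI : setI_closed point_open.
Proof. by move=> U V hU hV e; rewrite preimage_setI; exact: openI. Qed.

Fact point_open_bigU (I : Type) (f : I -> set (curve_point Gamma)) :
  (forall i, point_open (f i)) -> point_open (\bigcup_i f i).
Proof.
by move=> h e; rewrite preimage_bigcup; apply: bigcup_open => i _; exact: h.
Qed.

HB.instance Definition _ := isOpenTopological.Build (curve_point Gamma)
  point_openT point_openI point_open_bigU.

Lemma point_openE (U : set (curve_point Gamma)) : open U = point_open U.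
Proof. by []. Qed.

Definition at_infinity x : bool :=
  [exists e : edge Gamma, (len e == +oo%E) && (x == inl (tgt e))].

Definition finite_pt x : bool := ~~ at_infinity x.

Lemma continuous_pointP (T : topologicalType) (f : curve_point Gamma -> T) :
  continuous f <-> forall e, {within edge_itv e, continuous (f \o edge_pt e)}.
Proof.
split=> [/continuousP cf e|cf].
  by apply/continuousP => U oU; have := cf U oU; rewrite point_openE; apply.
apply/continuousP => U oU; rewrite point_openE => e.
by have /continuousP := cf e; apply.
Qed.

Lemma leaf_unique e e' : len e = +oo%E -> incident e' (tgt e) -> e' = e.
Proof.
move=> /len_infty[e0 [_ h]]; rewrite h => /eqP ->.
by apply/esym/eqP; rewrite -h /incident eqxx orbT.
Qed.

Lemma src_finite e : finite_pt (inl (src e)).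
Proof.
apply/existsPn => e'; apply/negP => /andP[/eqP le' /eqP[es]].
have ee' : e = e' by apply: leaf_unique => //; rewrite /incident es eqxx.
have [e0 [ne h]] := len_infty le'.
have : incident e' (tgt e') by rewrite /incident eqxx orbT.
by rewrite h => /eqP e0e; move: ne; rewrite -e0e -{1}ee' es eqxx.
Qed.

Lemma tgt_finite e : len e != +oo%E -> finite_pt (inl (tgt e)).
Proof.
move=> le; apply/existsPn => e'; apply/negP => /andP[/eqP le' /eqP[es]].
have ee' : e = e' by apply: leaf_unique => //; rewrite /incident es eqxx orbT.
by move: le; rewrite ee' le' eqxx.
Qed.

Lemma inner_finite p : finite_pt (inr p).
Proof. by apply/existsPn => e'; rewrite andbC. Qed.

Lemma edge_pt_finite e (t : R) : finite_pt (edge_pt e t%:E).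
Proof.
rewrite /edge_pt; case: ifPn => [_|t0]; first exact: src_finite.
case: insubP => [p _ _|/=]; first exact: inner_finite.
rewrite lee_fin -ltNge in t0; rewrite t0/= -leNgt => le.
by apply: tgt_finite; apply: contraTneq le => ->.
Qed.

Lemma edge_ptoo e : edge_pt e +oo%E = inl (tgt e).
Proof.
by rewrite /edge_pt leye_eq/=; case: insubP => // p /=; rewrite ltxx.
Qed.

Lemma edge_pt_inner e (t : R)
    (h : (0 < (e, t).2) && ((e, t).2%:E < len (e, t).1)%E) :
  edge_pt e t%:E = inr (exist _ (e, t) h).
Proof.
have /andP[t0 _] := h; rewrite /edge_pt lee_fin leNgt t0/=.
by rewrite insubT.
Qed.

End Points.

Definition affine_on (R : realType) (a : R) (b : \bar R) (f : R -> \bar R) :=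
  exists (k : int) (c : R),
    forall t : R, a < t -> (t%:E < b)%E -> f t = (k%:~R * t + c)%:E.

(* f is affine on every open subinterval of ]a, b[ that contains none of the
   break points s; affine functions have integer slopes. *)
Definition piecewise_affine (R : realType) (a : R) (b : \bar R)
    (f : R -> \bar R) :=
  exists s : seq R, forall (c : R) (d : \bar R),
    a <= c -> (c%:E < d)%E -> (d <= b)%E ->
    (forall x, x \in s -> ~ (c < x /\ (x%:E < d)%E)) -> affine_on c d f.

Definition rational_function (R : realType) (Gamma : tropical_curve R)
    (f : curve_point Gamma -> \bar R) : Prop :=
  f = cst -oo%E \/
  [/\ continuous f,
      forall x, finite_pt x -> f x \is a fin_num
    & forall e, piecewise_affine 0 (len e) (fun t => f (edge_pt e t%:E))].

Section PiecewiseAffine.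
Variable R : realType.
Implicit Types (a c : R) (b d : \bar R) (f g : R -> R).

Let PA a b f (s : seq R) := forall c d, a <= c -> (c%:E < d)%E -> (d <= b)%E ->
    (forall x, x \in s -> ~ (c < x /\ (x%:E < d)%E)) ->
    affine_on c d (EFin \o f).

Let PA_cat a b f s s' : PA a b f s -> PA a b f (s ++ s') * PA a b f (s' ++ s).
Proof.
by move=> h; split=> c d ac cd db H; apply: h => // x xs; apply: H;
  rewrite mem_cat xs ?orbT.
Qed.

Let maxf f g : R -> R := fun t => Num.max (f t) (g t).

Let PA_max_base a b f g : affine_on a b (EFin \o f) ->
  affine_on a b (EFin \o g) -> exists s, PA a b (maxf f g) s.
Proof.
move=> [k [u hf]] [l [v hg]].
have [kl|kl] := eqVneq k l.
  exists [::] => c d ac cd db _; exists k; exists (Num.max u v) => t ct td.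
  have [at_ tb] : a < t /\ (t%:E < b)%E.
    by split; [exact: le_lt_trans ct|exact: lt_le_trans db].
  have [ft] := hf t at_ tb; have [gt] := hg t at_ tb.
  by rewrite /= /maxf ft gt -kl addr_maxr.
set t0 := (v - u) / (k%:~R - l%:~R).
have kl0 : (k%:~R - l%:~R : R) != 0 by rewrite subr_eq0 eqr_int.
exists [:: t0] => c d ac cd db /(_ t0); rewrite mem_head => /(_ isT) ht0.
have key t : k%:~R * t + u - (l%:~R * t + v) = (k%:~R - l%:~R) * (t - t0).
  have e : (k%:~R - l%:~R) * t0 = v - u by rewrite /t0 mulrCA divff// mulr1.
  by rewrite [RHS]mulrBr e; ring.
have bnd t : c < t -> (t%:E < d)%E -> a < t /\ (t%:E < b)%E.
  by move=> ct td; split; [exact: le_lt_trans ct|exact: lt_le_trans db].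
have [ct0|t0c] := ltP c t0.
  have dt0 : (d <= t0%:E)%E by rewrite leNgt; apply/negP => ?; apply: ht0.
  have lt0 t : (t%:E < d)%E -> t - t0 < 0.
    by move=> td; rewrite subr_lt0 -lte_fin (lt_le_trans td).
  have [klp|klp] := ltP 0 (k%:~R - l%:~R : R).
    exists l; exists v => t ct td; have [at_ tb] := bnd t ct td.
    have [ft] := hf t at_ tb; have [gt] := hg t at_ tb.
    rewrite /= /maxf ft gt max_r// -subr_le0 key ltW//.
    by rewrite pmulr_rlt0// lt0.
  exists k; exists u => t ct td; have [at_ tb] := bnd t ct td.
  have [ft] := hf t at_ tb; have [gt] := hg t at_ tb.
  rewrite /= /maxf ft gt max_l// -subr_ge0 key.
  by rewrite mulr_le0// ltW// lt0.
have lt0 t : c < t -> 0 < t - t0.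
  by move=> ct; rewrite subr_gt0 (le_lt_trans t0c).
have [klp|klp] := ltP 0 (k%:~R - l%:~R : R).
  exists k; exists u => t ct td; have [at_ tb] := bnd t ct td.
  have [ft] := hf t at_ tb; have [gt] := hg t at_ tb.
  rewrite /= /maxf ft gt max_l// -subr_ge0 key.
  by rewrite mulr_ge0// ltW// lt0.
exists l; exists v => t ct td; have [at_ tb] := bnd t ct td.
have [ft] := hf t at_ tb; have [gt] := hg t at_ tb.
rewrite /= /maxf ft gt max_r// -subr_le0 key.
by rewrite mulr_le0_ge0// ltW// lt0.
Qed.

Let PA_max_ind s a b f g : (a%:E < b)%E -> PA a b f s -> PA a b g s ->
  exists s', PA a b (maxf f g) s'.
Proof.
elim: s a b => [|x s IHs] a b ab hf hg.
  by apply: PA_max_base; [apply: hf|apply: hg].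
have [/andP[ax xb]|nx] := boolP ((a < x) && (x%:E < b)%E); last first.
  have drop h : PA a b h (x :: s) -> PA a b h s.
    move=> hh c d ac cd db H; apply: hh => // y.
    rewrite inE => /orP[/eqP -> [cx xd]|]; last exact: H.
    by move/negP: nx; apply; rewrite (le_lt_trans ac)//= (lt_le_trans xd).
  by apply: IHs => //; exact: drop.
have dropl h : PA a b h (x :: s) -> PA a x%:E h s.
  move=> hh c d ac cd db H; apply: hh => //; first exact: le_trans db (ltW xb).
  move=> y; rewrite inE => /orP[/eqP -> [cx xd]|]; last exact: H.
  by move: (lt_le_trans xd db); rewrite ltxx.
have dropr h : PA a b h (x :: s) -> PA x b h s.
  move=> hh c d ac cd db H; apply: hh => //; first exact: le_trans (ltW ax) ac.
  move=> y; rewrite inE => /orP[/eqP -> [cx xd]|]; last exact: H.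
  by move: (le_lt_trans ac cx); rewrite ltxx.
have [s1 h1] : exists s', PA a x%:E (maxf f g) s'.
  by apply: IHs; rewrite ?lte_fin//; exact: dropl.
have [s2 h2] : exists s', PA x b (maxf f g) s'.
  by apply: IHs => //; exact: dropr.
exists (x :: s1 ++ s2) => c d ac cd db H.
have [cx|xc] := ltP c x.
  have dx : (d <= x%:E)%E.
    rewrite leNgt; apply/negP => xd; apply: (H x); first by rewrite mem_head.
    by [].
  by apply: h1 => // y ys; apply: H; rewrite inE mem_cat ys orbT.
by apply: h2 => // y ys; apply: H; rewrite inE mem_cat ys !orbT.
Qed.

Lemma piecewise_affine_max a b f g : (a%:E < b)%E ->
  piecewise_affine a b (EFin \o f) -> piecewise_affine a b (EFin \o g) ->
  piecewise_affine a b (fun t => (Num.max (f t) (g t))%:E).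
Proof.
move=> ab [s hs] [s' hs'].
have [u hu] := @PA_max_ind (s ++ s') a b f g ab
  (PA_cat s' hs).1 (PA_cat s hs').2.
by exists u.
Qed.

Lemma piecewise_affine_add a b f g :
  piecewise_affine a b (EFin \o f) -> piecewise_affine a b (EFin \o g) ->
  piecewise_affine a b (fun t => (f t + g t)%:E).
Proof.
move=> [s hs] [s' hs']; exists (s ++ s') => c d ac cd db H.
have [k [u hf]] := (PA_cat s' hs).1 c d ac cd db H.
have [l [v hg]] := (PA_cat s hs').2 c d ac cd db H.
exists (k + l); exists (u + v) => t ct td.
have [ft] := hf t ct td; have [gt] := hg t ct td.
by rewrite ft gt intrD; congr EFin; ring.
Qed.

Lemma piecewise_affine_cst a b (c : R) : piecewise_affine a b (fun=> c%:E).
Proof.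
exists [::] => *; exists 0; exists c => t _ _.
by rewrite mul0r add0r.
Qed.

End PiecewiseAffine.

Section RationalFunctions.
Variables (R : realType) (Gamma : tropical_curve R).
Implicit Types (e : edge Gamma) (x : curve_point Gamma) (h : curve_point Gamma -> R).

Let dom e : set R := [set t | 0 <= t /\ (t%:E <= len e)%E].

(* The restriction of a rational function other than -oo to finite points. *)
Let fin_rational h : Prop :=
  (forall e t, dom e t ->
     (h \o edge_pt e \o EFin) @ within (dom e) (nbhs t) --> h (edge_pt e t%:E))
  /\ forall e, piecewise_affine 0 (len e) (fun t => (h (edge_pt e t%:E))%:E).

Let domE e t : dom e t = edge_itv e t%:E.
Proof.
by rewrite /edge_itv/dom/= lee_fin; apply/propext; split=> [[-> ->]|/andP[]].
Qed.

Let rational_restr (f : curve_point Gamma -> \bar R) :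
  rational_function f -> f <> cst -oo%E ->
  fin_rational (fine \o f) /\ forall x, finite_pt x -> f x = (fine (f x))%:E.
Proof.
move=> [//|[cf ff pf]] _.
have fE x : finite_pt x -> f x = (fine (f x))%:E by move=> /ff /fineK.
split=> //; split=> [e t|e]; last first.
  by under eq_fun do rewrite -fE ?edge_pt_finite//; exact: pf.
rewrite domE => te.
have /continuous_pointP/(_ e)/subspace_continuousP/(_ _ te) := cf => H.
apply: fine_cvg; rewrite -fE ?edge_pt_finite//.
move=> P hP.
have {}H : nbhs t (fun s : R => edge_itv e s%:E -> P (f (edge_pt e s%:E))) :=
  H P hP.
change (nbhs t (fun s : R => dom e s -> P (f (edge_pt e s%:E)))).
by apply: filterS H => s; rewrite domE.
Qed.

Let affine_lim (u : R -> R) (a : R) : affine_on a +oo%E (EFin \o u) ->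
  exists y : \bar R, (u t)%:E @[t --> +oo] --> y.
Proof.
move=> [k [c hu]].
have {}hu t : a < t -> u t = k%:~R * t + c.
  by move=> at_; have [] := hu t at_ (ltry _).
have [k0|k0|k0] := ltgtP k 0.
- exists -oo%E => P [A [_ hA]].
  exists (Num.max a ((A - c) / k%:~R)); split; first exact: num_real.
  move=> t /=; rewrite gt_max => /andP[at_ tA]; apply: hA.
  rewrite hu// lte_fin -ltrBrDr mulrC -ltr_ndivrMr// ?ltrz0//.
- exists +oo%E => P [A [_ hA]].
  exists (Num.max a ((A - c) / k%:~R)); split; first exact: num_real.
  move=> t /=; rewrite gt_max => /andP[at_ tA]; apply: hA.
  rewrite hu// lte_fin -ltrBlDr mulrC -ltr_pdivrMr// ?ltr0z//.
- exists c%:E => P cP; exists a; split; first exact: num_real.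
  by move=> t /hu /= ->; rewrite k0 mul0r add0r; exact: nbhs_singleton cP.
Qed.

Let piecewise_affine_end (u : R -> R) : piecewise_affine 0 +oo%E (EFin \o u) ->
  exists a, affine_on a +oo%E (EFin \o u).
Proof.
move=> [s hs].
have [M M0 hM] : exists2 M : R, 0 <= M & forall x : R, x \in s -> x <= M.
  elim: s {hs} => [|x s [M M0 hM]]; first by exists 0.
  exists (Num.max x M); first by rewrite le_max M0 orbT.
  move=> y; rewrite inE => /orP[/eqP ->|/hM yM]; first by rewrite le_max lexx.
  by rewrite le_max yM orbT.
by exists M; apply: hs => // [|x /hM xM [+ _]]; rewrite ?ltry// ltNge xM.
Qed.

Let rational_ext h : fin_rational h -> exists2 f : curve_point Gamma -> \bar R,
  rational_function f & forall x, finite_pt x -> f x = (h x)%:E.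
Proof.
move=> [ch ph].
have /choice[f hf] x : exists y : \bar R, (finite_pt x -> y = (h x)%:E) /\
  forall e, len e = +oo%E -> x = inl (tgt e) ->
    (h (edge_pt e t%:E))%:E @[t --> +oo] --> y.
  have [fx|] := boolP (finite_pt x).
    exists (h x)%:E; split=> // e le xe.
    move: fx; rewrite xe => /existsPn/(_ e); by rewrite le !eqxx.
  rewrite negbK => /existsP[e /andP[/eqP le /eqP xe]].
  have := ph e; rewrite le => /(@piecewise_affine_end (fun t => h (edge_pt e t%:E)))[a ha].
  have [y hy] := affine_lim ha.
  exists y; split=> // e' le'; rewrite xe => -[tt].
  suff -> : e' = e by [].
  by apply: leaf_unique => //; rewrite /incident tt eqxx orbT.
have fE x : finite_pt x -> f x = (h x)%:E by move=> /(hf x).1.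
exists f => //; right; split=> [|x /fE ->//|e]; last first.
  rewrite (_ : (fun t : R => _) = (fun t => (h (edge_pt e t%:E))%:E)) //.
  by apply/funext => t; rewrite fE ?edge_pt_finite.
apply/continuous_pointP => e; apply/subspace_continuousP => -[t||].
- rewrite -domE => te P hP.
  have {}hP : nbhs (h (edge_pt e t%:E))%:E P.
    by rewrite -fE ?edge_pt_finite.
  have H : nbhs t (fun s : R => dom e s -> P (h (edge_pt e s%:E))%:E) :=
    ch e t te [set z | P z%:E] hP.
  change (nbhs t (fun s : R => edge_itv e s%:E -> P (f (edge_pt e s%:E)))).
  by apply: filterS H => s; rewrite domE fE ?edge_pt_finite.
- move=> /= /andP[_]; rewrite leye_eq => /eqP le P hP.
  have {}hP : nbhs (f (inl (tgt e))) P by rewrite -edge_ptoo.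
  have [A [_ hA]] := (hf _).2 e le erefl P hP.
  exists A; split; first exact: num_real.
  move=> [s||] As _.
  + change (P (f (edge_pt e s%:E))); rewrite fE ?edge_pt_finite//.
    by apply: hA; rewrite -lte_fin.
  + change (P (f (edge_pt e +oo%E))); rewrite edge_ptoo.
    exact: nbhs_singleton hP.
  + by [].
- by move=> /= /andP[]; rewrite leeNy_eq.
Qed.

Let rational_lim (f : curve_point Gamma -> \bar R) e : rational_function f ->
  len e = +oo%E -> f (edge_pt e t%:E) @[t --> +oo] --> f (inl (tgt e)).
Proof.
move=> [-> _|[cf _ _] le]; first exact: cvg_cst.
have te : edge_itv e +oo%E by rewrite /edge_itv/= le leey.
have /continuous_pointP/(_ e)/subspace_continuousP/(_ _ te) := cf.
rewrite -edge_ptoo => H P /H [A [Ar hA]].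
exists (Num.max 0 A); split; first exact: num_real.
move=> t; rewrite gt_max => /andP[t0 At]; apply: hA => //=.
by rewrite /edge_itv/= lee_fin ltW// le leey.
Qed.

Definition Rat_of : Type :=
  {f : curve_point Gamma -> \bar R | `[< rational_function f >]}.

HB.instance Definition _ := SubChoice.on Rat_of.

Definition Rat_fun (f : Rat_of) : curve_point Gamma -> \bar R := val f.
Coercion Rat_fun : Rat_of >-> Funclass.

Lemma RatP (f : Rat_of) : rational_function f.
Proof. exact/asboolP/(valP f). Qed.

Definition mkRat (f : curve_point Gamma -> \bar R) (hf : rational_function f) : Rat_of :=
  exist _ f (asboolT hf).

Lemma Rat_eqP (f g : Rat_of) : (forall x, finite_pt x -> f x = g x) -> f = g.
Proof.
move=> fg; apply/val_inj/funext => x.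
have [/fg//|] := boolP (finite_pt x).
rewrite negbK => /existsP[e /andP[/eqP le /eqP ->]].
have := rational_lim (RatP g) le.
rewrite (_ : (fun t => Rat_fun g _) = (fun t => f (edge_pt e t%:E))).
  by apply: cvg_unique (rational_lim (RatP f) le); exact: ereal_hausdorff.
by apply/funext => t; rewrite fg// edge_pt_finite.
Qed.

Let maxrC (u v : R) : Num.max u v = (u + v + `|u - v|) / 2.
Proof. by rewrite maxr_absE. Qed.

Let fin_rational_max f g : fin_rational f -> fin_rational g ->
  fin_rational (fun x => Num.max (f x) (g x)).
Proof.
move=> [cf pf] [cg pg]; split=> [e t te|e].
  under [X in X @ _ --> _]eq_fun do rewrite /= maxrC.
  rewrite maxrC; apply: cvgM; last exact: cvg_cst.
  apply: cvgD; first by apply: cvgD; [exact: cf|exact: cg].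
  by apply: cvg_norm; apply: cvgB; [exact: cf|exact: cg].
by apply: piecewise_affine_max; [exact: len_gt0|exact: pf|exact: pg].
Qed.

Let fin_rational_add f g : fin_rational f -> fin_rational g ->
  fin_rational (fun x => f x + g x).
Proof.
move=> [cf pf] [cg pg]; split=> [e t te|e].
  by apply: cvgD; [exact: cf|exact: cg].
by apply: piecewise_affine_add; [exact: pf|exact: pg].
Qed.

Let rational_cst (c : R) : rational_function (cst c%:E : curve_point Gamma -> \bar R).
Proof.
right; split=> // [|e]; first exact: cst_continuous.
exact: piecewise_affine_cst.
Qed.

Let rational_ninfty : rational_function (cst -oo%E : curve_point Gamma -> \bar R).
Proof. by left. Qed.

Definition Rat_ninfty : Rat_of := mkRat rational_ninfty.

Definition Rat_cst (a : trop R) : Rat_of :=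
  if a is Some c then mkRat (rational_cst c) else Rat_ninfty.

Lemma Rat_add_ex (f g : Rat_of) : exists h : Rat_of,
  forall x, finite_pt x -> h x = maxe (f x) (g x).
Proof.
have [f0|/(rational_restr (RatP f))[hf fE]] := pselect (Rat_fun f = cst -oo%E).
  by exists g => x _; rewrite f0 maxNye.
have [g0|/(rational_restr (RatP g))[hg gE]] := pselect (Rat_fun g = cst -oo%E).
  by exists f => x _; rewrite g0 maxeNy.
have [h hh hE] := rational_ext (fin_rational_max hf hg).
exists (mkRat hh) => x xf; rewrite [LHS]hE// fE// gE//=.
by rewrite EFin_max.
Qed.

Lemma Rat_mul_ex (f g : Rat_of) : exists h : Rat_of,
  forall x, finite_pt x -> h x = (f x + g x)%E.
Proof.
have [f0|/(rational_restr (RatP f))[hf fE]] := pselect (Rat_fun f = cst -oo%E).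
  by exists f => x _; rewrite f0.
have [g0|/(rational_restr (RatP g))[hg gE]] := pselect (Rat_fun g = cst -oo%E).
  by exists g => x _; rewrite g0 addeNy.
have [h hh hE] := rational_ext (fin_rational_add hf hg).
by exists (mkRat hh) => x xf; rewrite [LHS]hE// fE// gE.
Qed.

(* The values at the points at infinity are determined by continuity, see
   [Rat_eqP]. *)
Definition Rat_add (f g : Rat_of) : Rat_of := projT1 (cid (Rat_add_ex f g)).
Definition Rat_mul (f g : Rat_of) : Rat_of := projT1 (cid (Rat_mul_ex f g)).

Lemma Rat_addE (f g : Rat_of) x :
  finite_pt x -> Rat_add f g x = maxe (f x) (g x).
Proof. exact: (projT2 (cid (Rat_add_ex f g))). Qed.

Lemma Rat_mulE (f g : Rat_of) x : finite_pt x -> Rat_mul f g x = (f x + g x)%E.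
Proof. exact: (projT2 (cid (Rat_mul_ex f g))). Qed.

Fact Rat_addA : associative Rat_add.
Proof. by move=> f g h; apply: Rat_eqP => x xf; rewrite !Rat_addE// maxA. Qed.

Fact Rat_addC : commutative Rat_add.
Proof. by move=> f g; apply: Rat_eqP => x xf; rewrite !Rat_addE// maxC. Qed.

Fact Rat_add0 : left_id Rat_ninfty Rat_add.
Proof. by move=> f; apply: Rat_eqP => x xf; rewrite Rat_addE// maxNye. Qed.

HB.instance Definition _ :=
  GRing.isNmodule.Build Rat_of Rat_addA Rat_addC Rat_add0.

Fact Rat_mulA : associative Rat_mul.
Proof. by move=> f g h; apply: Rat_eqP => x xf; rewrite !Rat_mulE// addeA. Qed.

Fact Rat_mulC : commutative Rat_mul.
Proof. by move=> f g; apply: Rat_eqP => x xf; rewrite !Rat_mulE// addeC. Qed.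

Fact Rat_mul1 : left_id (Rat_cst 1) Rat_mul.
Proof. by move=> f; apply: Rat_eqP => x xf; rewrite Rat_mulE//= add0e. Qed.

Fact Rat_mulDl : left_distributive Rat_mul Rat_add.
Proof.
move=> f g h; apply: Rat_eqP => x xf; rewrite Rat_mulE// !Rat_addE// !Rat_mulE//.
by rewrite adde_maxl.
Qed.

Fact Rat_mul0 : left_zero Rat_ninfty Rat_mul.
Proof. by move=> f; apply: Rat_eqP => x xf; rewrite Rat_mulE. Qed.

HB.instance Definition _ := GRing.Nmodule_isComPzSemiRing.Build Rat_of
  Rat_mulA Rat_mulC Rat_mul1 Rat_mulDl Rat_mul0.

Lemma Rat0E : (0 : Rat_of) = Rat_ninfty. Proof. by []. Qed.

Lemma Rat_addP (f g : Rat_of) x : finite_pt x -> (f + g : Rat_of) x = maxe (f x) (g x).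
Proof. exact: Rat_addE. Qed.

Lemma Rat_mulP (f g : Rat_of) x : finite_pt x -> (f * g : Rat_of) x = (f x + g x)%E.
Proof. exact: Rat_mulE. Qed.

Fact Rat_cst_nmod : nmod_morphism Rat_cst.
Proof.
split=> // a b; apply: Rat_eqP => x xf; rewrite Rat_addP//.
rewrite trop_addE.
case: a => [a|]; case: b => [b|].
- exact: EFin_max.
- exact/esym/maxeNy.
- exact/esym/maxNye.
- exact/esym/maxNye.
Qed.

Fact Rat_cst_monoid : monoid_morphism Rat_cst.
Proof.
split=> // a b; apply: Rat_eqP => x xf; rewrite Rat_mulP//.
rewrite trop_mulE.
by case: a => [a|]; case: b => [b|].
Qed.

HB.instance Definition _ :=
  GRing.isNmodMorphism.Build (trop R) Rat_of Rat_cst Rat_cst_nmod.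
HB.instance Definition _ :=
  GRing.isMonoidMorphism.Build (trop R) Rat_of Rat_cst Rat_cst_monoid.

Definition Rat_talg : talgebra R := TAlgebra (Rat_cst : {rmorphism _ -> _}).

End RationalFunctions.

(* The slope at 0 of g in the direction of increasing arguments. *)
Definition germ_slope (R : realType) (g : R -> R) : int :=
  xget 0 [set k : int | \forall h \near 0^'+, g h = g 0 + k%:~R * h].

Lemma germ_slopeE (R : realType) (g : R -> R) (k : int) :
  (\forall h \near 0^'+, g h = g 0 + k%:~R * h) -> germ_slope g = k.
Proof.
move=> gk; rewrite /germ_slope.
set P := [set l : int | _]; have : P (xget 0 P) by apply: xgetPex; exists k.
move: (xget 0 P) => l gl.
near (0 : R)^'+ => h.
have h0 : 0 < h by near: h; exact: nbhs_right_gt.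
have e1 : g h = g 0 + k%:~R * h by near: h.
have e2 : g h = g 0 + l%:~R * h by near: h.
have : l%:~R * h = k%:~R * h by apply: (addrI (g 0)); rewrite -e1 -e2.
by move/(mulIf (lt0r_neq0 h0))/eqP; rewrite eqr_int => /eqP.
Unshelve. all: by end_near. Qed.

Section Divisors.
Variables (R : realType) (Gamma : tropical_curve R).
Implicit Types (e : edge Gamma) (x : curve_point Gamma) (f : Rat_of Gamma).

Definition on_edge f e (t : R) : R := fine (f (edge_pt e t%:E)).

(* The outgoing slopes of f at the point t of e, towards [tgt e] and towards
   [src e]. *)
Definition slope_fwd f e (t : R) : int :=
  germ_slope (fun h => on_edge f e (t + h)).
Definition slope_bwd f e (t : R) : int :=
  germ_slope (fun h => on_edge f e (t - h)).

(* The slope of f on e near infinity, in the direction of [tgt e]. *)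
Definition slope_at_infinity f e : int :=
  xget 0 [set k : int | exists c : R,
    \forall t \near +oo, on_edge f e t = k%:~R * t + c].

Definition slope_out_tgt f e : int :=
  if len e == +oo%E then - slope_at_infinity f e
  else slope_bwd f e (fine (len e)).

Definition ord f x : int :=
  match x with
  | inl v => \sum_(e | src e == v) slope_fwd f e 0
             + \sum_(e | tgt e == v) slope_out_tgt f e
  | inr p => slope_fwd f (val p).1 (val p).2 + slope_bwd f (val p).1 (val p).2
  end.

Definition divisor : Type := {freeg (curve_point Gamma) / int}.
HB.instance Definition _ := GRing.Zmodule.on divisor.

Definition effective (D : divisor) : Prop := forall x, 0 <= coeff x D.

Definition div f : divisor :=
  \sum_(x \in [set: curve_point Gamma]) << ord f x *g x >>.

Let sep (s : seq R) (t : R) :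
  exists2 d : R, 0 < d & forall u, u \in s -> u != t -> d <= `|u - t|.
Proof.
elim: s => [|u s [d d0 hd]]; first by exists 1.
have [ut|ut] := eqVneq u t.
  exists d => // v; rewrite inE => /orP[/eqP ->|/hd//].
  by rewrite ut eqxx.
exists (Num.min d `|u - t|); first by rewrite lt_min d0 normr_gt0 subr_eq0.
move=> v; rewrite inE ge_min => /orP[/eqP -> _|/hd h /h ->//].
by rewrite lexx orbT.
Qed.

Lemma ord_finite_support f : finite_set [set x | ord f x != 0].
Proof.
have [f0|hf] := RatP f.
  suff -> : [set x | ord f x != 0] = set0 by exact: finite_set0.
  have fe e t : on_edge f e t = 0 by rewrite /on_edge f0.
  have g0 g : (forall h : R, g h = 0) -> germ_slope g = 0.
    by move=> g0; apply: germ_slopeE; apply: nearW => h; rewrite !g0 mul0r addr0.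
  have i0 e : slope_at_infinity f e = 0.
    rewrite /slope_at_infinity.
    case: xgetP => // k _ [c [A [Ar hA]]].
    pose B := Num.max A 0.
    have AB : A < B + 1 by rewrite ltr_pwDr// le_max lexx.
    have AB2 : A < B + 2 by rewrite ltr_pwDr// le_max lexx.
    have := hA _ AB; have := hA _ AB2; rewrite /= !fe => -> /eqP.
    rewrite -subr_eq0 (_ : _ - _ = k%:~R); last by ring.
    by rewrite intr_eq0 => /eqP.
  apply/seteqP; split=> // -[v|p] /=; rewrite /slope_fwd /slope_bwd.
    rewrite !big1 ?addr0 ?eqxx// => e _.
      rewrite /slope_out_tgt i0 oppr0 /slope_bwd g0 ?if_same//.
    by rewrite /slope_fwd g0.
  by rewrite !g0 ?addr0 ?eqxx.
have [_ ff /choice[s hs]] := hf.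
pose cand : set (curve_point Gamma) :=
  [set inl v | v in [set: vertex Gamma]] `|`
  \bigcup_(e in [set: edge Gamma]) [set edge_pt e t%:E | t in [set` s e]].
apply: (@sub_finite_set _ _ cand); last first.
  rewrite finite_setU; split; first exact/finite_image/finite_finset.
  apply: bigcup_finite; first exact: finite_finset.
  by move=> e _; apply: finite_image; exact: finite_seq.
move=> [v _|[[e t] ip] /=]; first by left; exists v.
have /= /andP[t0 tl] := ip.
move=> on0; apply: contrapT => np; move/negP: on0; apply; apply/eqP.
have ts : t \notin s e.
  apply/negP => ts; apply: np; right; exists e => //; exists t => //.
  by rewrite (edge_pt_inner ip).
have [d d0 hd] := sep (s e) t.
have [r r0 [rd rt rl]] : exists2 r : R, 0 < r &
    [/\ r <= d, r <= t & ((t + r)%:E <= len e)%E].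
  case: (len e) tl (len_gt0 e) => [l||] //=; rewrite ?lte_fin => tl _.
    exists (Num.min d (Num.min t (l - t))).
      by rewrite !lt_min d0 t0 subr_gt0.
    have h : Num.min d (Num.min t (l - t)) <= l - t by rewrite !ge_min lexx !orbT.
    by split; rewrite ?ge_min ?lexx ?orbT// lee_fin; lra.
  exists (Num.min d t); first by rewrite lt_min d0.
  by rewrite !ge_min !lexx !orbT leey.
have [||||k [c hk]] := hs e (t - r) (t + r)%:E.
- by rewrite subr_ge0.
- by rewrite lte_fin; lra.
- by [].
- move=> u us [ur ru].
  have := hd u us; have ut : u != t by apply: contraNneq ts => <-.
  move=> /(_ ut); rewrite leNgt => /negP; apply.
  apply: lt_le_trans rd; rewrite ltr_norml; rewrite lte_fin in ru.
  by apply/andP; split; lra.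
have H u : t - r < u -> u < t + r -> on_edge f e u = k%:~R * u + c.
  by move=> u1 u2; rewrite /on_edge hk.
have -> : slope_fwd f e t = k.
  apply: germ_slopeE; near=> h.
  have h0 : 0 < h by near: h; exact: nbhs_right_gt.
  have hr : h < r by near: h; exact: nbhs_right_lt.
  by rewrite !H; [ring|lra..].
have -> : slope_bwd f e t = - k.
  apply: germ_slopeE; near=> h.
  have h0 : 0 < h by near: h; exact: nbhs_right_gt.
  have hr : h < r by near: h; exact: nbhs_right_lt.
  by rewrite !H; [rewrite intrN; ring|lra..].
by rewrite subrr.
Unshelve. all: by end_near. Qed.

Lemma coeff_div f x : coeff x (div f) = ord f x.
Proof.
have fin := ord_finite_support f.
pose A := fset_set [set y | ord f y != 0].
rewrite /div (fsbigTE A); last first.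
  move=> y; rewrite in_fset_set// notin_setE/= => /negP; rewrite negbK => /eqP ->.
  exact: freegU0.
rewrite raddf_sum/=; under eq_bigr do rewrite coeffU.
have [xA|xA] := boolP (x \in A).
  rewrite (bigD1_seq x xA (fset_uniq A))/= eqxx mulr1 big1 ?addr0// => y /negbTE ->.
  by rewrite mulr0.
rewrite big_seq big1 => [|y yA].
  by apply/esym/eqP; move: xA; rewrite in_fset_set// notin_setE/= => /negP;
    rewrite negbK.
by rewrite [y == x](_ : _ = false) ?mulr0//; apply: contraNF xA => /eqP <-.
Qed.


Definition RD (D : divisor) : set (Rat_of Gamma) :=
  [set f | f = Rat_ninfty Gamma \/ effective (D + div f)].

Definition generates (D : divisor) (n : nat) (F : 'I_n -> Rat_of Gamma) : Prop :=
  (forall i, RD D (F i)) /\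
  forall f, RD D f ->
    exists t : 'I_n -> trop R, f = \sum_i Rat_cst Gamma (t i) * F i.

Definition finite_points : Type := {x : curve_point Gamma | finite_pt x}.

Definition phi (n : nat) (F : 'I_n -> Rat_of Gamma) (x : finite_points) :
    'I_n -> R :=
  fun i => fine (F i (val x)).

End Divisors.

(* Main.v *)
Require Import Defs.
From mathcomp Require Import all_boot all_order all_algebra.
From mathcomp Require Import freeg.
From mathcomp Require Import all_classical all_reals.
From HB Require Import structures.
From mathcomp Require Import finmap generic_quotient.
From mathcomp Require Import zify ring lra.
From mathcomp Require Import ereal topology normedtype.

(** Write phi for the map x |-> (F_1(x), ..., F_n(x)).

The isomorphism. Substituting the F_i for the variables sends a tropical
rational function p to the function x |-> p(phi(x)) on the finite points, and
two tropical rational functions give the same function exactly when they are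
congruent modulo E(Im phi).  So the first claim amounts to: every rational
function on the curve, other than -oo, is a tropical rational expression in the
F_i ([Rat_tropical_expr], used through [Rat_isomorphic]).  The set S of such
expressions contains the constants and is closed under sums, opposites, maxima
and minima, hence a Stone-Weierstrass argument applies: by compactness
([curve_ideal]), used once with minima and once with maxima, it is enough to
find, for two one-sided germs of the curve, an element of S equal to the given
function f on the first and at most f on the second ([germ_pair]).  This takes
two ingredients.

- Realisation ([germ_realize]): on a germ the F_i are affine with integer slopes
  v_i, and some combination of the v_i is 1 ([unimodular]).  For a point z of the
  germ let G be the maximum of the F_i - F_i(z).  It lies in R(D), its slopes on
  the two sides of z are M = max v_i and m = min v_i, and D + div G has
  coefficient at least M - m at z.  If M - m >= 2, chips can be fired from z in
  both directions by a small amount, which gives an element of R(D) of slope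
  M - 1; as slopes of elements of R(D) are slopes of the F_i, both M and M - 1
  are among the v_i.  If M - m = 1 this is clear, and M = m would make all v_i
  equal to 0, the slope of a constant, against the injectivity of phi.

- Separation: a nonpositive element of S that vanishes on the first germ and is
  as negative as needed on the second.  For germs at distinct points it comes
  from a coordinate of phi.  For two germs at the same point, injectivity says
  that their slope vectors lie on distinct rays, and an integer linear form
  separates these ([integer_separation]).  Near infinity phi may have the
  same slopes on two edges, and there one shows that the ramp max(0, t - M),
  supported near a single point at infinity, is itself in S ([ramp_expr]).

Injectivity. Suppose phi(x) = phi(y) with x <> y, so that every element of R(D)
takes the same value at x and y.  With G the maximum of the F_i - F_i(x) and
E = D + div G, every h in R(E) attains its maximum at x ([peak_ex]).  The key is
Dhar's burning argument ([firing_fraction]): if the coefficients of an effective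
E away from a point q have sum greater than the genus, and E vanishes at
infinity, then chips can be fired towards q: some h in R(E) satisfies h >= 0,
h(q) = 0 and h > 0 somewhere.  For q = x this is excluded,
hence E(x) >= deg D - g >= g + 1.  Then it applies to q = y, and the resulting h
has h(x) > 0 = h(y): G + h is in R(D) and separates x from y. *)

Set Implicit Arguments.
Unset Strict Implicit.
Unset Printing Implicit Defensive.

Import Order.TTheory GRing.Theory Num.Theory.
Import numFieldNormedType.Exports.

Local Open Scope classical_set_scope.
Local Open Scope ring_scope.
Local Open Scope quotient_scope.

(** * Germs on the real line *)

Section RealGerms.
Variable R : realType.
Implicit Types (g : R -> R) (s t : R) (b : \bar R).

(** A germ is a one-sided end of an interval: to the right or to the left of a real
number, or towards +oo.  Neighbourhoods of [Fwd t] and [Bwd t] contain [t], so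
that an affine formula on a germ also gives the value at its base point. *)
Inductive germ : Type := Fwd of R | Bwd of R | Inf.

Definition germ_nbhs (d : germ) : set_system R :=
  match d with
  | Fwd t => within [set s | t <= s] (nbhs t)
  | Bwd t => within [set s | s <= t] (nbhs t)
  | Inf => pinfty_nbhs R
  end.

Global Instance germ_nbhs_filter d : ProperFilter (germ_nbhs d).
Proof.
case: d => [t|t|] /=; last exact: proper_pinfty_nbhs.
- apply: Build_ProperFilter_ex => P /= hP.
  have := nbhs_singleton hP => /(_ (lexx t)) Pt.
  by exists t.
- apply: Build_ProperFilter_ex => P /= hP.
  have := nbhs_singleton hP => /(_ (lexx t)) Pt.
  by exists t.
Qed.

Lemma germ_nbhs_Fwd t (P : set R) :
  germ_nbhs (Fwd t) P <-> exists2 r : R, 0 < r & forall s, t <= s -> s < t + r -> P s.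
Proof.
split=> [/nbhs_ballP[r /= r0 hr]|[r r0 hr]].
  exists r => // s ts str; apply: hr => //.
  by rewrite /ball/= ltr_norml; apply/andP; split; lra.
apply/nbhs_ballP; exists r => // s /=.
by rewrite /ball/= ltr_norml => /andP[h1 h2] ts; apply: hr => //; lra.
Qed.

Lemma germ_nbhs_Bwd t (P : set R) :
  germ_nbhs (Bwd t) P <-> exists2 r : R, 0 < r & forall s, t - r < s -> s <= t -> P s.
Proof.
split=> [/nbhs_ballP[r /= r0 hr]|[r r0 hr]].
  exists r => // s ts str; apply: hr => //.
  by rewrite /ball/= ltr_norml; apply/andP; split; lra.
apply/nbhs_ballP; exists r => // s /=.
by rewrite /ball/= ltr_norml => /andP[h1 h2] ts; apply: hr => //; lra.
Qed.

Lemma germ_nbhs_Inf (P : set R) :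
  germ_nbhs Inf P <-> exists M : R, forall s, M < s -> P s.
Proof.
split=> [[M [_ hM]]|[M hM]]; first by exists M.
by exists M; split; first exact: num_real.
Qed.

(** This is what makes the slope of a function along a germ unique, without a case
distinction on the kind of germ. *)
Lemma germ_nbhs_itv d (P : set R) : germ_nbhs d P ->
  exists a c : R, a < c /\ forall s, a < s < c -> P s.
Proof.
case: d => [t|t|].
- move=> /germ_nbhs_Fwd[r r0 hr]; exists t, (t + r); split; first by lra.
  by move=> s /andP[h1 h2]; apply: hr; lra.
- move=> /germ_nbhs_Bwd[r r0 hr]; exists (t - r), t; split; first by lra.
  by move=> s /andP[h1 h2]; apply: hr; lra.
- move=> /germ_nbhs_Inf[M hM]; exists M, (M + 1); split; first by lra.
  by move=> s /andP[h1 h2]; apply: hM; lra.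
Qed.

Lemma affine_unique d (k l : int) (c c' : R) :
  (\forall s \near germ_nbhs d, k%:~R * s + c = l%:~R * s + c') ->
  k = l /\ c = c'.
Proof.
move=> /germ_nbhs_itv[a [b [ab h]]].
have h1 := h ((2 * a + b) / 3) ltac:(apply/andP; split; lra).
have h2 := h ((a + 2 * b) / 3) ltac:(apply/andP; split; lra).
have : (k%:~R - l%:~R) * (b - a) = 0 :> R by lra.
move/eqP; rewrite mulf_eq0 !subr_eq0 eqr_int => /orP[/eqP kl|/eqP ba]; last by lra.
by split=> //; move: h1; rewrite kl; lra.
Qed.

(** Finitely many break points leave a gap on either side of [t]. *)
Lemma fin_sep (s : seq R) (t : R) :
  exists2 d : R, 0 < d & forall u, u \in s -> u != t -> d <= `|u - t|.
Proof.
elim: s => [|u s [d d0 hd]]; first by exists 1.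
have [ut|ut] := eqVneq u t.
  exists d => // v; rewrite inE => /orP[/eqP ->|/hd//].
  by rewrite ut eqxx.
exists (Num.min d `|u - t|); first by rewrite lt_min d0 normr_gt0 subr_eq0.
move=> v; rewrite inE ge_min => /orP[/eqP -> _|/hd h /h ->//].
by rewrite lexx orbT.
Qed.

Lemma fin_bounded (s : seq R) : exists M : R, 0 <= M /\ forall u, u \in s -> u <= M.
Proof.
elim: s => [|x s [M [M0 hM]]]; first by exists 0.
exists (Num.max x M); split; first by rewrite le_max M0 orbT.
move=> y; rewrite inE => /orP[/eqP ->|/hM yM]; first by rewrite le_max lexx.
by rewrite le_max yM orbT.
Qed.

Lemma piecewise_affine_right g a b t : piecewise_affine a b (EFin \o g) ->
  a <= t -> (t%:E < b)%E -> exists2 r : R, 0 < r &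
  exists (k : int) c, forall s, t < s -> s < t + r -> g s = k%:~R * s + c.
Proof.
move=> [u hu] at_ tb; have [d d0 hd] := fin_sep u t.
have [r r0 [rd rb]] : exists2 r : R, 0 < r & r <= d /\ ((t + r)%:E <= b)%E.
  case: b tb {hu} => [b||] //=; rewrite ?lte_fin => tb; last by exists d => //; rewrite leey.
  exists (Num.min d (b - t)); first by rewrite lt_min d0 subr_gt0.
  by rewrite ge_min lexx; split => //; rewrite lee_fin -lerBrDl ge_min lexx orbT.
exists r => //.
have [||||k [c hk]] := hu t (t + r)%:E; rewrite ?lte_fin//; first by lra.
  move=> x xu [tx xtr].
  have := hd x xu ltac:(by rewrite gt_eqF); rewrite lte_fin in xtr.
  by rewrite gtr0_norm; lra.
exists k, c => s ts str.
by have [] := hk s ts ltac:(by rewrite lte_fin).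
Qed.

Lemma piecewise_affine_left g a b t : piecewise_affine a b (EFin \o g) ->
  a < t -> (t%:E <= b)%E -> exists2 r : R, 0 < r &
  exists (k : int) c, forall s, t - r < s -> s < t -> g s = k%:~R * s + c.
Proof.
move=> [u hu] at_ tb; have [d d0 hd] := fin_sep u t.
pose r := Num.min d (t - a).
have r0 : 0 < r by rewrite lt_min d0 subr_gt0.
have rd : r <= d by rewrite ge_min lexx.
have ra : r <= t - a by rewrite ge_min lexx orbT.
exists r => //.
have [||||k [c hk]] := hu (t - r) t%:E; rewrite ?lte_fin//; [lra|lra| |].
  move=> x xu [tx xtr]; rewrite lte_fin in xtr.
  have := hd x xu ltac:(by rewrite lt_eqF).
  by rewrite ltr0_norm; lra.
exists k, c => s ts str.
by have [] := hk s ts ltac:(by rewrite lte_fin).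
Qed.

Lemma piecewise_affine_infty g : piecewise_affine 0 +oo%E (EFin \o g) ->
  exists (k : int) c, \forall s \near germ_nbhs Inf, g s = k%:~R * s + c.
Proof.
move=> [u hu]; have [M [M0 hM]] := fin_bounded u.
have [||||k [c hk]] := hu M +oo%E; rewrite ?ltry//.
  by move=> x xu [Mx _]; have := hM x xu; rewrite leNgt Mx.
exists k, c; apply/germ_nbhs_Inf; exists M => s Ms.
by have [] := hk s Ms (ltry s).
Qed.

End RealGerms.
Arguments Inf {R}.

(** * Germs of rational functions, and gluing along edges *)

Section CurveGerms.
Variables (R : realType) (Gamma : tropical_curve R).
Implicit Types (e : edge Gamma) (x : curve_point Gamma) (f h : Rat_of Gamma).
Implicit Types (s t : R) (d : germ R).

Definition edge_dom e : set R := [set t | 0 <= t /\ (t%:E <= len e)%E].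

Lemma edge_pt_src e t : t <= 0 -> edge_pt e t%:E = inl (src e).
Proof. by move=> t0; rewrite /edge_pt lee_fin t0. Qed.

Lemma edge_pt_tgt e t : (len e <= t%:E)%E -> edge_pt e t%:E = inl (tgt e).
Proof.
move=> le; have := lt_le_trans (len_gt0 e) le; rewrite lte_fin => t0.
rewrite /edge_pt lee_fin leNgt t0/=; case: insubP => //= p.
by rewrite t0/= ltNge le.
Qed.

Lemma edge_pt_inr e t : 0 < t -> (t%:E < len e)%E ->
  exists p : inner_point Gamma, val p = (e, t) /\ edge_pt e t%:E = inr p.
Proof.
move=> t0 tl; have h : (0 < (e, t).2) && ((e, t).2%:E < len (e, t).1)%E by rewrite t0.
by exists (exist _ (e, t) h); rewrite (edge_pt_inner h).
Qed.

Lemma inr_edge_pt (p : inner_point Gamma) :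
  inr p = edge_pt (val p).1 (val p).2%:E.
Proof. by case: p => -[e t] h /=; rewrite (edge_pt_inner h). Qed.

Lemma Rat_finite f x : f <> Rat_ninfty Gamma -> finite_pt x ->
  f x = (fine (f x))%:E.
Proof.
move=> fN xf; have [f0|[_ ff _]] := RatP f; last by rewrite fineK ?ff.
by case: fN; apply/val_inj; rewrite /= -f0.
Qed.

Lemma on_edgeE f e t : f <> Rat_ninfty Gamma ->
  f (edge_pt e t%:E) = (on_edge f e t)%:E.
Proof. by move=> fN; rewrite /on_edge -Rat_finite ?edge_pt_finite. Qed.

Lemma on_edge_cvg f e t : f <> Rat_ninfty Gamma -> edge_dom e t ->
  on_edge f e @ within (edge_dom e) (nbhs t) --> on_edge f e t.
Proof.
move=> fN te; have [f0|[cf _ _]] := RatP f.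
  by case: fN; apply/val_inj; rewrite /= -f0.
have domE s : edge_dom e s = edge_itv e s%:E.
  by rewrite /edge_itv/edge_dom/= lee_fin; apply/propext; split=> [[-> ->]|/andP[]].
have te' : edge_itv e t%:E by rewrite -domE.
have /continuous_pointP/(_ e)/subspace_continuousP/(_ _ te') := cf => H.
apply: fine_cvg; rewrite -on_edgeE//.
move=> P hP.
have {}H : nbhs t (fun s : R => edge_itv e s%:E -> P (f (edge_pt e s%:E))) :=
  H P hP.
change (nbhs t (fun s : R => edge_dom e s -> P (f (edge_pt e s%:E)))).
by apply: filterS H => s; rewrite domE.
Qed.

Lemma on_edge_piecewise f e : f <> Rat_ninfty Gamma ->
  piecewise_affine 0 (len e) (EFin \o on_edge f e).
Proof.
move=> fN; have [f0|[_ _ pf]] := RatP f.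
  by case: fN; apply/val_inj; rewrite /= -f0.
have -> : EFin \o on_edge f e = fun t => f (edge_pt e t%:E).
  by apply/funext => t /=; rewrite -on_edgeE.
exact: pf.
Qed.

Definition valid_germ e d : Prop :=
  match d with
  | Fwd t => 0 <= t /\ (t%:E < len e)%E
  | Bwd t => 0 < t /\ (t%:E <= len e)%E
  | Inf => len e = +oo%E
  end.

Lemma valid_germ_dom e d : valid_germ e d ->
  \forall s \near germ_nbhs d, edge_dom e s.
Proof.
case: d => [t|t|] /=.
- move=> [t0 tl]; apply/germ_nbhs_Fwd.
  rewrite /edge_dom; case: (len e) (len_gt0 e) tl => [l||] //=; rewrite ?lte_fin => _ tl.
    exists (l - t); first by lra.
    by move=> s ts sl; rewrite lee_fin; split; lra.
  by exists 1 => // s ts _; rewrite leey; split=> //; lra.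
- move=> [t0 tl]; apply/germ_nbhs_Bwd; exists t => // s s0 st.
  split; first by lra.
  by rewrite (le_trans _ tl)// lee_fin.
- by move=> le; apply/germ_nbhs_Inf; exists 0 => s s0; rewrite /edge_dom/= le leey; split=> //; lra.
Qed.

Definition germ_affine f e d (k : int) (c : R) : Prop :=
  \forall s \near germ_nbhs d, on_edge f e s = k%:~R * s + c.

Let cvg_affine (k : int) (c t : R) (D : set R) :
  (fun s => k%:~R * s + c) @ within D (nbhs t) --> k%:~R * t + c.
Proof.
apply: cvg_within_filter; apply: cvgD; last exact: cvg_cst.
by apply: cvgM; [exact: cvg_cst|exact: cvg_id].
Qed.

(** Continuity extends an affine formula from a punctured one-sided neighbourhood to
the base point. *)
Let cvg_eq_base (g : R -> R) (D : set R) (k : int) (c t : R) (F : set_system R) :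
  ProperFilter F -> (forall P, within D (nbhs t) P -> F P) ->
  g @ within D (nbhs t) --> g t ->
  (\forall s \near F, g s = k%:~R * s + c) -> g t = k%:~R * t + c.
Proof.
move=> FF FD cg ge.
have h1 : g @ F --> g t by move=> P hP; apply: FD; exact: cg.
have h2 : g @ F --> k%:~R * t + c.
  have h3 : (fun s => k%:~R * s + c) @ F --> k%:~R * t + c.
    by move=> P hP; apply: FD; exact: (@cvg_affine k c t D P hP).
  apply: cvg_trans h3.
  by apply: near_eq_cvg; apply: filterS ge => s ->.
by apply: (@cvg_unique _ _ (g @ F)) => //; exact: norm_hausdorff.
Qed.

(** Finitely many pieces leave, on each side of a point, an interval without break
points; continuity includes its end. *)
Lemma rat_germ f e d : f <> Rat_ninfty Gamma -> valid_germ e d ->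
  exists (k : int) c, germ_affine f e d k c.
Proof.
move=> fN ve; have pf := on_edge_piecewise e fN.
have domf := valid_germ_dom ve.
case: d ve domf => [t|t|] /= ve domf.
- have [t0 tl] := ve.
  have [r r0 [k [c hk]]] := piecewise_affine_right pf t0 tl.
  exists k, c; apply/germ_nbhs_Fwd; exists r => // s.
  rewrite le_eqVlt => /predU1P[<-{s} _|ts str]; last exact: hk.
  apply: (@cvg_eq_base _ (edge_dom e) _ _ _ (t^'+)).
  + move=> P; move: domf; rewrite /at_right /at_left /within /= => domf hP.
    apply: filterS (filterI hP domf) => s [h1 h2] ts.
    by apply/h1/h2/ltW.
  + by apply: on_edge_cvg => //; split=> //; exact: ltW.
  + near=> s; apply: hk; near: s; first exact: nbhs_right_gt.
    by apply: nbhs_right_lt; lra.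
- have [t0 tl] := ve.
  have [r r0 [k [c hk]]] := piecewise_affine_left pf t0 tl.
  exists k, c; apply/germ_nbhs_Bwd; exists r => // s rs.
  rewrite le_eqVlt => /predU1P[->{s rs}|st]; last exact: hk.
  apply: (@cvg_eq_base _ (edge_dom e) _ _ _ (t^'-)).
  + move=> P; move: domf; rewrite /at_right /at_left /within /= => domf hP.
    apply: filterS (filterI hP domf) => s [h1 h2] ts.
    by apply/h1/h2/ltW.
  + by apply: on_edge_cvg => //; split=> //; exact: ltW.
  + near=> s; apply: hk; near: s; last exact: nbhs_left_lt.
    by apply: nbhs_left_gt; lra.
- rewrite /= in ve; rewrite ve in pf.
  exact: piecewise_affine_infty pf.
Unshelve. all: by end_near. Qed.

Lemma germ_affine_unique f e d k l c c' :
  germ_affine f e d k c -> germ_affine f e d l c' -> k = l /\ c = c'.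
Proof.
move=> h1 h2; apply: (@affine_unique _ d); near=> s.
have <- := near h1 s; last by [].
by apply: (near h2 s).
Unshelve. all: by end_near. Qed.

Lemma finite_pt_ex : exists x : curve_point Gamma, finite_pt x.
Proof.
have /card_gt0P[v _] := graph_nonempty Gamma.
have [fv|] := boolP (finite_pt (inl v : curve_point Gamma)); first by exists (inl v).
by rewrite negbK => /existsP[e _]; exists (inl (src e)); exact: src_finite.
Qed.

Lemma edge_dom_cases e t : edge_dom e t ->
  t = 0 \/ (exists p : inner_point Gamma, val p = (e, t) /\ edge_pt e t%:E = inr p)
  \/ len e = t%:E.
Proof.
move=> [t0 tl]; have [->|tn0] := eqVneq t 0; first by left.
have {tn0}t0 : 0 < t by rewrite lt_neqAle eq_sym tn0.
right; have [lt|/eqP tl'] := boolP (len e == t%:E); first by right; apply/eqP.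
by left; apply: edge_pt_inr => //; rewrite lt_neqAle tl andbT eq_sym; apply/eqP.
Qed.

Section Gluing.
Variables (w : vertex Gamma -> R) (g : edge Gamma -> R -> R).
Hypothesis g_cvg : forall e t, edge_dom e t ->
  g e @ within (edge_dom e) (nbhs t) --> g e t.
Hypothesis g_pl : forall e, piecewise_affine 0 (len e) (EFin \o g e).
Hypothesis g_src : forall e, g e 0 = w (src e).
Hypothesis g_tgt : forall e l, len e = l%:E -> g e l = w (tgt e).

Let affine_lim (u : R -> R) (k : int) (c : R) :
  (\forall s \near germ_nbhs (@Inf R), u s = k%:~R * s + c) ->
  exists y : \bar R, (u t)%:E @[t --> +oo] --> y.
Proof.
move=> /germ_nbhs_Inf[a hu].
have [k0|k0|k0] := ltgtP k 0.
- exists -oo%E => P [A [_ hA]].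
  exists (Num.max a ((A - c) / k%:~R)); split; first exact: num_real.
  move=> t /=; rewrite gt_max => /andP[at_ tA]; apply: hA.
  rewrite hu// lte_fin -ltrBrDr mulrC -ltr_ndivrMr// ?ltrz0//.
- exists +oo%E => P [A [_ hA]].
  exists (Num.max a ((A - c) / k%:~R)); split; first exact: num_real.
  move=> t /=; rewrite gt_max => /andP[at_ tA]; apply: hA.
  rewrite hu// lte_fin -ltrBlDr mulrC -ltr_pdivrMr// ?ltr0z//.
- exists c%:E => P cP; exists a; split; first exact: num_real.
  by move=> t /hu /= ->; rewrite k0 mul0r add0r; exact: nbhs_singleton cP.
Qed.

Let h x : R := match x with inl v => w v | inr p => g (val p).1 (val p).2 end.

Let hE e t : edge_dom e t -> h (edge_pt e t%:E) = g e t.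
Proof.
move=> te; have [->|[[p [pE ->]]|le]] := edge_dom_cases te.
- by rewrite edge_pt_src//= g_src.
- by rewrite /= pE.
- by rewrite edge_pt_tgt ?le//= (g_tgt le).
Qed.

(** A rational function is prescribed by functions on the edges that agree at the
vertices.  At a point at infinity the value is forced: it is the limit of a
function that is eventually affine. *)
Lemma rat_of_edges : exists f : Rat_of Gamma, [/\ f <> Rat_ninfty Gamma,
  forall e t, edge_dom e t -> on_edge f e t = g e t &
  forall v, finite_pt (inl v : curve_point Gamma) -> f (inl v) = (w v)%:E].
Proof.
have /choice[f hf] x : exists y : \bar R, (finite_pt x -> y = (h x)%:E) /\
  forall e, len e = +oo%E -> x = inl (tgt e) ->
    (g e t)%:E @[t --> +oo] --> y.
  have [fx|] := boolP (finite_pt x).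
    exists (h x)%:E; split=> // e le xe.
    move: fx; rewrite xe => /existsPn/(_ e); by rewrite le !eqxx.
  rewrite negbK => /existsP[e /andP[/eqP le /eqP xe]].
  have := g_pl e; rewrite le => /piecewise_affine_infty[k [c hc]].
  have [y hy] := affine_lim hc.
  exists y; split=> // e' le'; rewrite xe => -[tt].
  suff -> : e' = e by [].
  by apply: leaf_unique => //; rewrite /incident tt eqxx orbT.
have fE x : finite_pt x -> f x = (h x)%:E by move=> /(hf x).1.
have fgE e t : edge_dom e t -> f (edge_pt e t%:E) = (g e t)%:E.
  by move=> te; rewrite fE ?edge_pt_finite// hE.
have rf : rational_function f.
  right; split=> [|x /fE ->//|e]; last first.
    have [u hu] := g_pl e; exists u => a b ha ab bl hx.
    have [k [c hk]] := hu a b ha ab bl hx; exists k, c => t at_ tb.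
    rewrite -hk//= fgE//; split; first exact: le_trans (ltW at_).
    exact: le_trans (ltW tb) bl.
  apply/continuous_pointP => e; apply/subspace_continuousP => -[t||].
  - move=> te P hP.
    have te' : edge_dom e t by move: te; rewrite /edge_itv/edge_dom/= lee_fin => /andP[].
    have {}hP : nbhs (g e t)%:E P by rewrite -fgE.
    have H : nbhs t (fun s : R => edge_dom e s -> P (g e s)%:E) :=
      g_cvg te' (hP : nbhs (g e t) [set z | P z%:E]).
    change (nbhs t (fun s : R => edge_itv e s%:E -> P (f (edge_pt e s%:E)))).
    apply: filterS H => s hs si.
    have se : edge_dom e s by move: si; rewrite /edge_itv/edge_dom/= lee_fin => /andP[].
    by rewrite fgE//; exact: hs.
  - move=> /= /andP[_]; rewrite leye_eq => /eqP le P hP.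
    have {}hP : nbhs (f (inl (tgt e))) P by rewrite -edge_ptoo.
    have [A [_ hA]] := (hf _).2 e le erefl P hP.
    exists (Num.max 0 A); split; first exact: num_real.
    move=> [s||] As _.
    + change (P (f (edge_pt e s%:E))); move: As; rewrite lte_fin gt_max => /andP[s0 As].
      rewrite fgE; first exact: hA.
      by split; [exact: ltW|rewrite le leey].
    + change (P (f (edge_pt e +oo%E))); rewrite edge_ptoo.
      exact: nbhs_singleton hP.
    + by [].
  - by move=> /= /andP[]; rewrite leeNy_eq.
exists (mkRat rf); split=> [fN|e t te|v vf].
- have [x xf] := finite_pt_ex; have := fE x xf.
  have fx : mkRat rf x = -oo%E by rewrite fN.
  by rewrite [f x]fx.
- by rewrite /on_edge [mkRat rf _]fgE.
- exact: fE.
Qed.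

End Gluing.

End CurveGerms.

(** * Slopes, orders and linear systems *)

Section SlopeCalculus.
Variables (R : realType) (Gamma : tropical_curve R).
Implicit Types (e : edge Gamma) (x : curve_point Gamma) (f g h : Rat_of Gamma).
Implicit Types (s t : R) (d : germ R) (k l : int).
Local Notation ninfty := (Rat_ninfty Gamma).

(** The slope is taken in the direction of increasing parameters for the three kinds
of germs, so that it is additive; the outgoing slope along [Bwd t] or [Inf] is its
opposite. *)
Definition germ_slope_on f e d : int :=
  xget 0 [set k | exists c, germ_affine f e d k c].

Lemma germ_slope_onE f e d k c : germ_affine f e d k c -> germ_slope_on f e d = k.
Proof.
move=> h; rewrite /germ_slope_on; case: xgetP => [l _ [c' h']|/(_ k)[]].
  by have [] := germ_affine_unique h' h.
by exists c.
Qed.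

Lemma germ_slope_on_affine f e d : f <> ninfty -> valid_germ e d ->
  exists c, germ_affine f e d (germ_slope_on f e d) c.
Proof.
by move=> fN ve; have [k [c h]] := rat_germ fN ve; exists c; rewrite (germ_slope_onE h).
Qed.

Lemma germ_affine_Fwd f e t k c : germ_affine f e (Fwd t) k c ->
  on_edge f e t = k%:~R * t + c.
Proof. by move=> /germ_nbhs_Fwd[r r0]; apply=> //; lra. Qed.

Lemma germ_affine_Bwd f e t k c : germ_affine f e (Bwd t) k c ->
  on_edge f e t = k%:~R * t + c.
Proof. by move=> /germ_nbhs_Bwd[r r0]; apply=> //; lra. Qed.

Lemma slope_fwdE f e t : f <> ninfty -> valid_germ e (Fwd t) ->
  slope_fwd f e t = germ_slope_on f e (Fwd t).
Proof.
move=> fN ve; have [c hc] := germ_slope_on_affine fN ve.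
apply: germ_slopeE; move: hc (germ_affine_Fwd hc) => /germ_nbhs_Fwd[r r0 hr] bt.
near=> h; have h0 : 0 < h by near: h; exact: nbhs_right_gt.
have hr' : h < r by near: h; exact: nbhs_right_lt.
by rewrite addr0 bt hr; lra.
Unshelve. all: by end_near. Qed.

Lemma slope_bwdE f e t : f <> ninfty -> valid_germ e (Bwd t) ->
  slope_bwd f e t = - germ_slope_on f e (Bwd t).
Proof.
move=> fN ve; have [c hc] := germ_slope_on_affine fN ve.
apply: germ_slopeE; move: hc (germ_affine_Bwd hc) => /germ_nbhs_Bwd[r r0 hr] bt.
near=> h; have h0 : 0 < h by near: h; exact: nbhs_right_gt.
have hr' : h < r by near: h; exact: nbhs_right_lt.
by rewrite subr0 bt hr ?intrN; lra.
Unshelve. all: by end_near. Qed.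

(** The germ at the end of [e] glued to [tgt e]. *)
Definition end_germ e : germ R := if len e is l%:E then Bwd l else Inf.

Lemma end_germ_valid e : valid_germ e (end_germ e).
Proof.
rewrite /end_germ; case le: (len e) (len_gt0 e) => [l||] //=.
by rewrite le lte_fin lexx.
Qed.

Lemma slope_out_tgtE f e : f <> ninfty ->
  slope_out_tgt f e = - germ_slope_on f e (end_germ e).
Proof.
move=> fN; have := end_germ_valid e; rewrite /slope_out_tgt /end_germ.
case le: (len e) (len_gt0 e) => [l||] //= _ ve.
by rewrite slope_bwdE.
Qed.

Lemma ord_inl f (v : vertex Gamma) : f <> ninfty -> ord f (inl v) =
  \sum_(e | src e == v) germ_slope_on f e (Fwd 0)
  - \sum_(e | tgt e == v) germ_slope_on f e (end_germ e).
Proof.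
move=> fN /=; rewrite -sumrN; congr (_ + _); apply: eq_bigr => e _.
  by apply: slope_fwdE => //=; rewrite len_gt0.
exact: slope_out_tgtE.
Qed.

Lemma ord_inr f (p : inner_point Gamma) : f <> ninfty -> ord f (inr p) =
  germ_slope_on f (val p).1 (Fwd (val p).2) - germ_slope_on f (val p).1 (Bwd (val p).2).
Proof.
move=> fN /=; have /andP[p0 pl] := valP p.
by rewrite slope_fwdE ?slope_bwdE//=; split=> //; exact: ltW.
Qed.

Lemma ord_infinity f e : f <> ninfty -> len e = +oo%E ->
  ord f (inl (tgt e)) = - germ_slope_on f e Inf.
Proof.
move=> fN le; rewrite ord_inl// big1 ?sub0r => [|e' /eqP e's]; last first.
  have ee' : e' = e by apply: leaf_unique => //; rewrite /incident e's eqxx.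
  have := src_finite e; rewrite -{1}ee' e's => /existsPn/(_ e).
  by rewrite le !eqxx.
rewrite (big_pred1 e) ?/end_germ ?le// => e'; apply/eqP/eqP => [e't|->//].
by apply: leaf_unique => //; rewrite /incident e't eqxx orbT.
Qed.

Lemma Rat_neq_ninfty f x : f x != -oo%E -> f <> ninfty.
Proof. by move=> /eqP + f0; rewrite f0. Qed.

Lemma Rat_mul_neq f g : f <> ninfty -> g <> ninfty -> f * g <> ninfty.
Proof.
move=> fN gN; have [x xf] := finite_pt_ex Gamma.
apply: (Rat_neq_ninfty (x := x)); rewrite Rat_mulP// (Rat_finite fN xf) (Rat_finite gN xf).
by [].
Qed.

Lemma Rat_add_neq f g : f <> ninfty -> f + g <> ninfty.
Proof.
move=> fN; have [x xf] := finite_pt_ex Gamma.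
apply: (Rat_neq_ninfty (x := x)); rewrite Rat_addP// (Rat_finite fN xf).
by rewrite gt_eqF// lt_max ltNyr.
Qed.

Lemma Rat_cst_neq (c : R) : Rat_cst Gamma (Some c) <> ninfty.
Proof. by have [x xf] := finite_pt_ex Gamma; apply: (Rat_neq_ninfty (x := x)). Qed.

Lemma on_edgeM f g e t : f <> ninfty -> g <> ninfty ->
  on_edge (f * g) e t = on_edge f e t + on_edge g e t.
Proof.
by move=> fN gN; rewrite {1}/on_edge Rat_mulP ?edge_pt_finite// !on_edgeE.
Qed.

Lemma on_edgeD f g e t : f <> ninfty -> g <> ninfty ->
  on_edge (f + g) e t = Num.max (on_edge f e t) (on_edge g e t).
Proof.
by move=> fN gN; rewrite {1}/on_edge Rat_addP ?edge_pt_finite// !on_edgeE// -EFin_max.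
Qed.

Lemma on_edge_cst (c : R) e t : on_edge (Rat_cst Gamma (Some c)) e t = c.
Proof. by []. Qed.

Lemma germ_slope_onM f g e d : f <> ninfty -> g <> ninfty -> valid_germ e d ->
  germ_slope_on (f * g) e d = germ_slope_on f e d + germ_slope_on g e d.
Proof.
move=> fN gN ve; have [c hc] := germ_slope_on_affine fN ve.
have [c' hc'] := germ_slope_on_affine gN ve.
apply: (@germ_slope_onE _ _ _ _ (c + c')).
apply: filterS2 hc hc' => s; rewrite on_edgeM// => -> ->.
by rewrite intrD; lra.
Qed.

Lemma germ_slope_on_cst (c : R) e d : germ_slope_on (Rat_cst Gamma (Some c)) e d = 0.
Proof.
by apply: (@germ_slope_onE _ _ _ _ c); apply: nearW => s; rewrite on_edge_cst; lra.
Qed.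

Lemma ordM f g x : f <> ninfty -> g <> ninfty -> ord (f * g) x = ord f x + ord g x.
Proof.
move=> fN gN; have fgN := Rat_mul_neq fN gN; case: x => [v|p].
  rewrite !ord_inl// addrACA -opprD -!big_split/=; congr (_ - _).
    by apply: eq_bigr => e _; rewrite germ_slope_onM//=; rewrite len_gt0.
  by apply: eq_bigr => e _; rewrite germ_slope_onM//; exact: end_germ_valid.
have /andP[p0 pl] := valP p.
rewrite !ord_inr// !germ_slope_onM//=; first by rewrite opprD addrACA.
  by split=> //; exact: ltW.
by split=> //; exact: ltW.
Qed.

Lemma ord_cst (c : R) x : ord (Rat_cst Gamma (Some c)) x = 0.
Proof.
have cN := @Rat_cst_neq c; case: x => [v|p].
  by rewrite ord_inl// !big1 ?subr0// => e _; rewrite germ_slope_on_cst.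
by rewrite ord_inr// !germ_slope_on_cst subr0.
Qed.

(** An affine minorant that touches the function at the base point bounds the
outgoing slope from below; with [germ_slope_Bwd_le], this is how all lower bounds
for orders are obtained. *)
Lemma germ_slope_Fwd_ge f e t k : f <> ninfty -> valid_germ e (Fwd t) ->
  (\forall s \near germ_nbhs (Fwd t), on_edge f e t + k%:~R * (s - t) <= on_edge f e s) ->
  k <= germ_slope_on f e (Fwd t).
Proof.
move=> fN ve; have [c hc] := germ_slope_on_affine fN ve.
move: (germ_affine_Fwd hc) => bt /(filterI hc)/germ_nbhs_Fwd[r r0 /(_ (t + r / 2))].
move=> []; [lra|lra|]; rewrite bt => -> h.
rewrite -(ler_int R) -(ler_pM2r (x := r / 2)); lra.
Qed.

Lemma germ_slope_Bwd_le f e t k : f <> ninfty -> valid_germ e (Bwd t) ->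
  (\forall s \near germ_nbhs (Bwd t), on_edge f e t + k%:~R * (s - t) <= on_edge f e s) ->
  germ_slope_on f e (Bwd t) <= k.
Proof.
move=> fN ve; have [c hc] := germ_slope_on_affine fN ve.
move: (germ_affine_Bwd hc) => bt /(filterI hc)/germ_nbhs_Bwd[r r0 /(_ (t - r / 2))].
move=> []; [lra|lra|]; rewrite bt => -> h.
rewrite -(ler_int R) -(ler_pM2r (x := r / 2)); lra.
Qed.

Lemma germ_slope_Fwd_mono f g e t : f <> ninfty -> g <> ninfty -> valid_germ e (Fwd t) ->
  on_edge f e t = on_edge g e t ->
  (forall s, on_edge f e s <= on_edge g e s) ->
  germ_slope_on f e (Fwd t) <= germ_slope_on g e (Fwd t).
Proof.
move=> fN gN ve fg le; apply: germ_slope_Fwd_ge => //.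
have [c hc] := germ_slope_on_affine fN ve; have bt := germ_affine_Fwd hc.
apply: filterS hc => s hs; apply: le_trans (le s).
by rewrite -fg bt hs; lra.
Qed.

Lemma germ_slope_Bwd_mono f g e t : f <> ninfty -> g <> ninfty -> valid_germ e (Bwd t) ->
  on_edge f e t = on_edge g e t ->
  (forall s, on_edge f e s <= on_edge g e s) ->
  germ_slope_on g e (Bwd t) <= germ_slope_on f e (Bwd t).
Proof.
move=> fN gN ve fg le; apply: germ_slope_Bwd_le => //.
have [c hc] := germ_slope_on_affine fN ve; have bt := germ_affine_Bwd hc.
apply: filterS hc => s hs; apply: le_trans (le s).
by rewrite -fg bt hs; lra.
Qed.

Lemma tgt_len e : finite_pt (inl (tgt e) : curve_point Gamma) -> exists l : R, len e = l%:E.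
Proof.
move=> /existsPn/(_ e); case: (len e) (len_gt0 e) => [l||]; rewrite ?eqxx//.
by exists l.
Qed.

(** All outgoing slopes at [x] can only increase. *)
Lemma ord_mono f g x : f <> ninfty -> g <> ninfty -> finite_pt x -> f x = g x ->
  (forall y, finite_pt y -> (f y <= g y)%E) -> ord f x <= ord g x.
Proof.
move=> fN gN xf fgx le.
have le' e s : on_edge f e s <= on_edge g e s.
  by rewrite -lee_fin -!on_edgeE//; apply: le; exact: edge_pt_finite.
have eqE e s : edge_pt e s%:E = x -> on_edge f e s = on_edge g e s.
  by move=> ex; rewrite /on_edge ex fgx.
case: x xf fgx eqE => [v|p] xf fgx eqE.
  rewrite !ord_inl// lerB//; apply: ler_sum => e /eqP ev.
    apply: germ_slope_Fwd_mono => //=; first by rewrite len_gt0.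
    by apply: eqE; rewrite edge_pt_src// ev.
  have [l el] : exists l : R, len e = l%:E by apply: tgt_len; rewrite ev.
  have := end_germ_valid e; rewrite /end_germ el => ve.
  apply: germ_slope_Bwd_mono => //; apply: eqE.
  by rewrite edge_pt_tgt ?el// ev.
have /andP[p0 pl] := valP p.
rewrite !ord_inr// lerB//.
  apply: germ_slope_Fwd_mono => //=; first by split=> //; exact: ltW.
  by apply: eqE; rewrite inr_edge_pt.
apply: germ_slope_Bwd_mono => //=; first by split=> //; exact: ltW.
by apply: eqE; rewrite inr_edge_pt.
Qed.

(** The maximum of two affine functions coincides with one of them near the germ. *)
Lemma germ_slope_on_max f g e d : f <> ninfty -> g <> ninfty -> valid_germ e d ->
  germ_slope_on (f + g) e d = germ_slope_on f e d \/
  germ_slope_on (f + g) e d = germ_slope_on g e d.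
Proof.
move=> fN gN ve; have [c hc] := germ_slope_on_affine fN ve.
have [c' hc'] := germ_slope_on_affine gN ve.
have fgN : f + g <> ninfty by exact: Rat_add_neq.
have [c'' hc''] := germ_slope_on_affine fgN ve.
have [a [b [ab H]]] := germ_nbhs_itv (filterI (filterI hc hc') hc'').
set k := germ_slope_on f e d in hc H *; set l := germ_slope_on g e d in hc' H *.
set m := germ_slope_on _ e d in hc'' H *.
pose P s := a < s < b.
have fam s : P s -> m%:~R * s + c'' = k%:~R * s + c \/ m%:~R * s + c'' = l%:~R * s + c'.
  move=> /H[[h1 h2]] h3; rewrite -h3 -h2 -h1 on_edgeD//.
  by case: (leP (on_edge f e s) (on_edge g e s)) => _; [right|left].
have two (j : int) (u s1 s2 : R) : s1 < s2 -> m%:~R * s1 + c'' = j%:~R * s1 + u ->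
    m%:~R * s2 + c'' = j%:~R * s2 + u -> m = j.
  move=> s12 e1 e2; apply/eqP; rewrite -(eqr_int R) -subr_eq0.
  have : (m%:~R - j%:~R) * (s2 - s1) = 0 :> R by lra.
  move/eqP; rewrite mulf_eq0 => /orP[//|/eqP]; lra.
(* At three points of the interval, two see the same one of the two functions. *)
have [] := fam ((3 * a + b) / 4) ltac:(rewrite /P; apply/andP; split; lra);
have [] := fam ((2 * a + 2 * b) / 4) ltac:(rewrite /P; apply/andP; split; lra);
have [] := fam ((a + 3 * b) / 4) ltac:(rewrite /P; apply/andP; split; lra) => e1 e2 e3.
- by left; apply: two e2 e1; lra.
- by left; apply: two e3 e2; lra.
- by left; apply: two e3 e1; lra.
- by right; apply: two e2 e1; lra.
- by left; apply: two e2 e1; lra.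
- by right; apply: two e3 e1; lra.
- by right; apply: two e3 e2; lra.
- by right; apply: two e2 e1; lra.
Qed.

Section RD.
Variable D : divisor Gamma.

Lemma RDP f : f <> ninfty -> RD D f <-> forall x, 0 <= coeff x D + ord f x.
Proof.
move=> fN; split=> [[//|ef] x|H]; first by have := ef x; rewrite coeffD coeff_div.
by right=> x; rewrite coeffD coeff_div.
Qed.

(** At a finite point the maximum has an order at least that of the larger function.
At a point at infinity it coincides with one of the two functions. *)
Lemma RD_max f g : RD D f -> RD D g -> RD D (f + g).
Proof.
have [->|fN] := pselect (f = ninfty); first by rewrite -Rat0E add0r.
have [->|gN] := pselect (g = ninfty); first by rewrite -Rat0E addr0.
have fgN : f + g <> ninfty by exact: Rat_add_neq.
move=> /(RDP fN) hf /(RDP gN) hg; apply/(RDP fgN) => x.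
have [xf|] := boolP (finite_pt x).
  have fx := Rat_finite fN xf; have gx := Rat_finite gN xf.
  have [le|/ltW le] := leP (f x) (g x).
    apply: le_trans (hg x) _; rewrite lerD2l; apply: ord_mono => //.
      by rewrite Rat_addP// max_r.
    by move=> y yf; rewrite Rat_addP// le_max lexx orbT.
  apply: le_trans (hf x) _; rewrite lerD2l; apply: ord_mono => //.
    by rewrite Rat_addP// max_l.
  by move=> y yf; rewrite Rat_addP// le_max lexx.
rewrite negbK => /existsP[e /andP[/eqP le /eqP xe]].
have := hf x; have := hg x; rewrite xe !ord_infinity//.
by have [->|->] := @germ_slope_on_max f g e Inf fN gN le.
Qed.

Lemma RD_ninfty : RD D ninfty. Proof. by left. Qed.

Lemma RD_scale (a : trop R) f : RD D f -> RD D (Rat_cst Gamma a * f).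
Proof.
have [->|fN] := pselect (f = ninfty); first by rewrite -Rat0E mulr0 => _; left.
case: a => [c|] hf; last by rewrite [Rat_cst _ _](_ : _ = 0)// mul0r; left.
have cN := @Rat_cst_neq c.
apply/RDP => [|x]; first exact: Rat_mul_neq.
by move/(RDP fN): hf => /(_ x); rewrite ordM// ord_cst add0r.
Qed.

Lemma RD_sum (I : finType) (F : I -> Rat_of Gamma) :
  (forall i, RD D (F i)) -> RD D (\sum_i F i).
Proof.
move=> hF; elim/big_ind : _ => //; [exact: RD_ninfty|exact: RD_max].
Qed.

Lemma RD_cst (a : trop R) : effective D -> RD D (Rat_cst Gamma a).
Proof.
move=> eD; case: a => [c|]; last exact: RD_ninfty.
by apply/RDP => [|x]; [exact: Rat_cst_neq|rewrite ord_cst addr0].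
Qed.

End RD.
End SlopeCalculus.

(** * Elementary rational functions *)

Section PL.
Variable R : realType.
Implicit Types (g : R -> R) (b : \bar R).

Definition pl_on b g : Prop := continuous g /\ piecewise_affine 0 b (EFin \o g).

Lemma pl_cst b (c : R) : pl_on b (fun=> c).
Proof. by split; [exact: cst_continuous|exact: piecewise_affine_cst]. Qed.

Lemma pl_id b : pl_on b id.
Proof.
split; first by move=> t; exact: cvg_id.
by exists [::] => *; exists 1, 0 => t _ _; rewrite /= mul1r addr0.
Qed.

Lemma pl_opp_id b : pl_on b (fun s => - s).
Proof.
split; first by move=> t; apply: cvgN; exact: cvg_id.
by exists [::] => *; exists (-1), 0 => t _ _; rewrite /= mulN1r addr0.
Qed.

Lemma pl_add b f g : pl_on b f -> pl_on b g -> pl_on b (fun s => f s + g s).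
Proof.
move=> [cf pf] [cg pg]; split; first by move=> t; apply: cvgD; [exact: cf|exact: cg].
exact: piecewise_affine_add.
Qed.

Lemma pl_max b f g : (0 < b)%E -> pl_on b f -> pl_on b g ->
  pl_on b (fun s => Num.max (f s) (g s)).
Proof.
move=> b0 [cf pf] [cg pg]; split; last exact: piecewise_affine_max.
have -> : (fun s => Num.max (f s) (g s)) = fun s => (f s + g s + `|f s - g s|) / 2.
  by apply/funext => s; rewrite maxr_absE.
move=> t; apply: cvgM; last exact: cvg_cst.
apply: cvgD; first by apply: cvgD; [exact: cf|exact: cg].
by apply: cvg_norm; apply: cvgB; [exact: cf|exact: cg].
Qed.

Lemma pl_bigmax b (I : Type) (r : seq I) (F : I -> R -> R) (c : R) : (0 < b)%E ->
  (forall i, pl_on b (F i)) -> pl_on b (fun s => \big[Num.max/c]_(i <- r) F i s).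
Proof.
move=> b0 hF; elim: r => [|i r IHr].
  rewrite (_ : (fun s => _) = fun=> c); first exact: pl_cst.
  by apply/funext => s; rewrite big_nil.
rewrite (_ : (fun s => _) = fun s => Num.max (F i s) (\big[Num.max/c]_(j <- r) F j s)).
  exact: pl_max.
by apply/funext => s; rewrite big_cons.
Qed.

Lemma piecewise_affine_opp b g : piecewise_affine 0 b (EFin \o g) ->
  piecewise_affine 0 b (EFin \o (fun s => - g s)).
Proof.
move=> [u hu]; exists u => c d h0 cd db hx.
have [k [a hk]] := hu c d h0 cd db hx; exists (- k), (- a) => t ct td.
by have [/= ->] := hk t ct td; rewrite intrN mulNr opprD.
Qed.

Lemma pl_opp b g : pl_on b g -> pl_on b (fun s => - g s).
Proof.
move=> [cg pg]; split; last exact: piecewise_affine_opp.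
by move=> t; apply: cvgN; exact: cg.
Qed.

End PL.

Section ElementaryFunctions.
Variables (R : realType) (Gamma : tropical_curve R).
Implicit Types (e : edge Gamma) (x : curve_point Gamma) (f g h : Rat_of Gamma).
Implicit Types (s t : R) (d : germ R) (k l : int).
Local Notation ninfty := (Rat_ninfty Gamma).

Lemma rat_of_pl (w : vertex Gamma -> R) (g : edge Gamma -> R -> R) :
  (forall e, pl_on (len e) (g e)) ->
  (forall e, g e 0 = w (src e)) -> (forall e (l : R), len e = l%:E -> g e l = w (tgt e)) ->
  exists f : Rat_of Gamma, [/\ f <> ninfty,
  forall e t, edge_dom e t -> on_edge f e t = g e t &
  forall v, finite_pt (inl v : curve_point Gamma) -> f (inl v) = (w v)%:E].
Proof.
move=> gpl g0 gl; apply: rat_of_edges => // [e t _|e].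
  by apply: cvg_within_filter; apply: (gpl e).1.
exact: (gpl e).2.
Qed.

Lemma Rat_opp_ex f : f <> ninfty -> exists g : Rat_of Gamma,
  g <> ninfty /\ forall x, finite_pt x -> g x = (- fine (f x))%:E.
Proof.
move=> fN.
have [||||g [gN gE gv]] := @rat_of_edges _ _ (fun v => - fine (f (inl v)))
  (fun e s => - on_edge f e s).
- by move=> e t te; apply: cvgN; exact: on_edge_cvg.
- by move=> e; apply: piecewise_affine_opp; exact: on_edge_piecewise.
- by move=> e; rewrite /on_edge edge_pt_src.
- by move=> e l el; rewrite /on_edge edge_pt_tgt ?el.
exists g; split=> // -[v|p] xf; first exact: gv.
have /andP[p0 pl] := valP p.
rewrite inr_edge_pt on_edgeE// gE//; split; exact: ltW.
Qed.

Lemma ord_ge0_of_zero f x : f <> ninfty -> finite_pt x -> f x = 0%E ->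
  (forall y, finite_pt y -> (0 <= f y)%E) -> 0 <= ord f x.
Proof.
move=> fN xf fx f0; rewrite -(ord_cst 0 x); apply: ord_mono => //.
exact: Rat_cst_neq.
Qed.

Lemma finite_ptP (P : curve_point Gamma -> Prop) :
  (forall e t, edge_dom e t -> P (edge_pt e t%:E)) ->
  (forall v, finite_pt (inl v : curve_point Gamma) -> P (inl v)) ->
  forall x, finite_pt x -> P x.
Proof.
move=> he hv [v|p] xf; first exact: hv.
have /andP[p0 pl] := valP p.
by rewrite inr_edge_pt; apply: he; split; exact: ltW.
Qed.

Lemma inr_edge_pt_val e t (p : inner_point Gamma) : val p = (e, t) -> inr p = edge_pt e t%:E.
Proof. by move=> pE; rewrite inr_edge_pt pE. Qed.

(** The function that moves one chip from the point at infinity of [e] to the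
finite point at distance [M]. *)
Lemma ramp_ex e (M : R) : len e = +oo%E -> 0 < M -> exists u : Rat_of Gamma,
  [/\ u <> ninfty,
      forall s, on_edge u e s = Num.max 0 (s - M),
      forall e' s, e' != e -> on_edge u e' s = 0,
      ord u (inl (tgt e)) = -1
    & forall x, x <> inl (tgt e) -> 0 <= ord u x].
Proof.
move=> le M0.
pose g e' s := if e' == e then Num.max 0 (s - M) else 0.
have gpl e' : pl_on (len e') (g e').
  rewrite /g; case: (e' == e); last exact: pl_cst.
  apply: pl_max; [exact: len_gt0|exact: pl_cst|].
  by apply: pl_add; [exact: pl_id|exact: pl_cst].
have [||u [uN uE uv]] := @rat_of_pl (fun=> 0) g gpl.
- by move=> e'; rewrite /g; case: (e' == e) => //; rewrite max_l//; lra.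
- by move=> e' l; rewrite /g; case: eqP => // ->; rewrite le.
have u_out e' s : ~ edge_dom e' s -> on_edge u e' s = 0.
  move=> nd; have [s0|s0] := leP s 0.
    by rewrite /on_edge edge_pt_src// uv// src_finite.
  have ls : (len e' <= s%:E)%E.
    by rewrite leNgt; apply/negP => sl; apply: nd; split; exact: ltW.
  rewrite /on_edge edge_pt_tgt// uv//; apply: tgt_finite.
  by apply/eqP => le'; move: ls; rewrite le'.
have uE1 s : on_edge u e s = Num.max 0 (s - M).
  have [sd|sd] := pselect (edge_dom e s); first by rewrite uE// /g eqxx.
  rewrite u_out// max_l//; rewrite leNgt; apply/negP => h; apply: sd.
  by split; [lra|rewrite le leey].
have uE2 e' s : e' != e -> on_edge u e' s = 0.
  move=> /negbTE ne; have [sd|sd] := pselect (edge_dom e' s); last exact: u_out.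
  by rewrite uE// /g ne.
have sl : germ_slope_on u e Inf = 1.
  apply: (@germ_slope_onE _ _ _ _ _ _ (- M)); apply/germ_nbhs_Inf; exists M => s sM.
  by rewrite uE1 max_r; lra.
have u0 y : finite_pt y -> (0 <= u y)%E.
  move: y; apply: finite_ptP => [e' t _|v vf]; last by rewrite uv.
  rewrite on_edgeE// lee_fin; have [->|ne] := eqVneq e' e; last by rewrite uE2.
  by rewrite uE1 le_max lexx.
exists u; split=> //; first by rewrite ord_infinity// sl.
move=> x xe; have [xf|] := boolP (finite_pt x); last first.
  rewrite negbK => /existsP[e' /andP[/eqP le' /eqP xe']].
  have ne : e' != e by apply/eqP => ee; apply: xe; rewrite xe' ee.
  rewrite xe' ord_infinity// (@germ_slope_onE _ _ _ _ _ 0 0)//.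
  by apply: nearW => s; rewrite uE2// mul0r addr0.
have [ux|ux] := pselect (u x = 0%E); first exact: ord_ge0_of_zero.
case: x xe xf ux => [v|p] xe xf ux; first by case: ux; rewrite uv.
have /andP[p0 pl] := valP p.
rewrite ord_inr//; case vp: (val p) ux => [e' t] ux /=.
have ee : e' = e.
  apply/eqP/negP => /negP ne; apply: ux.
  by rewrite (inr_edge_pt_val vp) on_edgeE// uE2.
have Mt : M < t.
  rewrite ltNge; apply/negP => tM; apply: ux.
  by rewrite (inr_edge_pt_val vp) on_edgeE// ee uE1 max_l//; lra.
rewrite ee (@germ_slope_onE _ _ _ _ _ 1 (- M)); last first.
  by apply/germ_nbhs_Fwd; exists 1 => // s ts _; rewrite uE1 max_r; lra.
rewrite (@germ_slope_onE _ _ _ _ _ 1 (- M)) ?subrr//.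
by apply/germ_nbhs_Bwd; exists (t - M); [lra|move=> s ts _; rewrite uE1 max_r; lra].
Qed.

Lemma on_edge_out0 f e' s : f <> ninfty ->
  (forall v, finite_pt (inl v : curve_point Gamma) -> f (inl v) = 0%E) ->
  ~ edge_dom e' s -> on_edge f e' s = 0.
Proof.
move=> fN fv nd; have [s0|s0] := leP s 0.
  by rewrite /on_edge edge_pt_src// fv// src_finite.
have ls : (len e' <= s%:E)%E.
  by rewrite leNgt; apply/negP => sl; apply: nd; split; exact: ltW.
rewrite /on_edge edge_pt_tgt// fv//; apply: tgt_finite.
by apply/eqP => le'; move: ls; rewrite le'.
Qed.

(** The function that moves two chips away from an inner point, one to each side. *)
Lemma bump_ex e (z r : R) : 0 < r -> 0 <= z - r -> ((z + r)%:E <= len e)%E ->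
  exists b : Rat_of Gamma,
  [/\ b <> ninfty,
      forall s, on_edge b e s = Num.max 0 (r - `|s - z|),
      forall x, x <> edge_pt e z%:E -> 0 <= ord b x
    & -2 <= ord b (edge_pt e z%:E)].
Proof.
move=> r0 zr0 zrl.
pose g e' s := if e' == e then Num.max 0 (r - `|s - z|) else 0.
have normE s : `|s - z| = Num.max (s + - z) (- s + z).
  by case: (ger0P (s - z)) => h; [rewrite max_l|rewrite max_r]; lra.
have gpl e' : pl_on (len e') (g e').
  rewrite /g; case: (e' == e); last exact: pl_cst.
  apply: pl_max; [exact: len_gt0|exact: pl_cst|].
  apply: pl_add; [exact: pl_cst|apply: pl_opp].
  rewrite (_ : (fun s => _) = fun s => Num.max (s + - z) (- s + z)); last first.
    by apply/funext => s; rewrite normE.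
  apply: pl_max; [exact: len_gt0| |].
    by apply: pl_add; [exact: pl_id|exact: pl_cst].
  by apply: pl_add; [exact: pl_opp_id|exact: pl_cst].
have [||b [bN bE bv]] := @rat_of_pl (fun=> 0) g gpl.
- move=> e'; rewrite /g; case: (e' == e) => //.
  by rewrite max_l// normE subr_le0 le_max; apply/orP; right; lra.
- move=> e' l; rewrite /g; case: eqP => // -> le; rewrite le lee_fin in zrl.
  by rewrite max_l// normE subr_le0 le_max; apply/orP; left; lra.
have bE1 s : on_edge b e s = Num.max 0 (r - `|s - z|).
  have [sd|sd] := pselect (edge_dom e s); first by rewrite bE// /g eqxx.
  rewrite on_edge_out0//; apply/esym/max_l; rewrite leNgt; apply/negP => h; apply: sd.
  move: h; rewrite normE subr_gt0 gt_max => /andP[h1 h2]; split; first by lra.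
  by apply: le_trans zrl; rewrite lee_fin; lra.
have bE2 e' s : e' != e -> on_edge b e' s = 0.
  move=> /negbTE ne; have [sd|sd] := pselect (edge_dom e' s); last exact: on_edge_out0.
  by rewrite bE// /g ne.
have b0 y : finite_pt y -> (0 <= b y)%E.
  move: y; apply: finite_ptP => [e' t _|v vf]; last by rewrite bv.
  rewrite on_edgeE// lee_fin; have [->|ne] := eqVneq e' e; last by rewrite bE2.
  by rewrite bE1 le_max lexx.
have ez : exists p : inner_point Gamma, val p = (e, z) /\ edge_pt e z%:E = inr p.
  apply: edge_pt_inr; first by lra.
  by apply: lt_le_trans zrl; rewrite lte_fin; lra.
exists b; split=> //.
  move=> x xz; have [xf|] := boolP (finite_pt x); last first.
    rewrite negbK => /existsP[e' /andP[/eqP le' /eqP xe']].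
    rewrite xe' ord_infinity// (@germ_slope_onE _ _ _ _ _ 0 0)//.
    have [->|ne] := eqVneq e' e; last by apply: nearW => s; rewrite bE2// mul0r addr0.
    apply/germ_nbhs_Inf; exists (z + r) => s sz; rewrite bE1 mul0r addr0 max_l//.
    by rewrite normE subr_le0 le_max; apply/orP; left; lra.
  have [bx|bx] := pselect (b x = 0%E); first exact: ord_ge0_of_zero.
  case: x xz xf bx => [v|p] xz xf bx; first by case: bx; rewrite bv.
  have /andP[p0 pl] := valP p.
  rewrite ord_inr//; case vp: (val p) bx => [e' t] bx /=.
  have ee : e' = e.
    apply/eqP/negP => /negP ne; apply: bx.
    by rewrite (inr_edge_pt_val vp) on_edgeE// bE2.
  subst e'.
  have tz : t <> z by move=> tz; apply: xz; rewrite (inr_edge_pt_val vp) tz.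
  have : 0 < r - `|t - z|.
    rewrite ltNge; apply/negP => le0; apply: bx.
    by rewrite (inr_edge_pt_val vp) on_edgeE// bE1 max_l.
  rewrite normE subr_gt0 gt_max => /andP[h1 h2].
  have [tz'|zt] := ltP t z.
    rewrite (@germ_slope_onE _ _ _ _ _ 1 (r - z)); last first.
      apply/germ_nbhs_Fwd; exists (z - t) => [|s st1 st2]; first by lra.
      by rewrite bE1 ltr0_norm ?max_r; lra.
    rewrite (@germ_slope_onE _ _ _ _ _ 1 (r - z)) ?subrr//.
    apply/germ_nbhs_Bwd; exists (r + t - z) => [|s st1 st2]; first by lra.
    by rewrite bE1 ltr0_norm ?max_r; lra.
  have {}zt : z < t by lra.
  rewrite (@germ_slope_onE _ _ _ _ _ (-1) (r + z)); last first.
    apply/germ_nbhs_Fwd; exists (z + r - t) => [|s st1 st2]; first by lra.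
    by rewrite bE1 gtr0_norm ?max_r; lra.
  rewrite (@germ_slope_onE _ _ _ _ _ (-1) (r + z)) ?subrr//.
  apply/germ_nbhs_Bwd; exists (t - z) => [|s st1 st2]; first by lra.
  by rewrite bE1 gtr0_norm ?max_r; lra.
have [p [vp ->]] := ez; rewrite ord_inr// vp/=.
rewrite (@germ_slope_onE _ _ _ _ _ (-1) (r + z)); last first.
  apply/germ_nbhs_Fwd; exists r => // s st1 st2.
  by rewrite bE1 ger0_norm ?max_r; lra.
rewrite (@germ_slope_onE _ _ _ _ _ 1 (r - z))//.
apply/germ_nbhs_Bwd; exists r => // s st1 st2.
by rewrite bE1 ler0_norm ?max_r; lra.
Qed.

End ElementaryFunctions.

(** * Tropical expressions in the generators *)

Section TropicalEvaluation.
Variable R : realType.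

Definition trop_ereal (a : trop R) : \bar R := if a is Some c then c%:E else -oo%E.

Lemma trop_erealD a b : trop_ereal (a + b) = maxe (trop_ereal a) (trop_ereal b).
Proof.
rewrite trop_addE; case: a => [a|]; case: b => [b|] /=.
- exact: EFin_max.
- by rewrite maxeNy.
- by rewrite maxNye.
- by rewrite maxNye.
Qed.

Lemma trop_erealM a b : trop_ereal (a * b) = (trop_ereal a + trop_ereal b)%E.
Proof. by rewrite trop_mulE; case: a => [a|]; case: b => [b|]. Qed.

Lemma trop_ereal_inj : injective trop_ereal.
Proof. by case=> [a|] [b|] //= [->]. Qed.

Lemma tpoly_eval_const n (x : 'I_n -> trop R) a : tpoly_eval x (tpoly_const R n a) = a.
Proof.
elim: n x => [|n IHn] x //=.
by rewrite /horner_eval map_polyC hornerC/= IHn.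
Qed.

Lemma tpoly_var_ex n (i : 'I_n) : exists p : tpoly R n, forall x, tpoly_eval x p = x i.
Proof.
elim: n i => [[]//|n IHn] i.
have [->|ni] := eqVneq i ord_max.
  by exists 'X => x /=; rewrite /horner_eval map_polyX hornerX.
have lt_in : (i < n)%N.
  by rewrite ltn_neqAle -ltnS ltn_ord andbT -(inj_eq val_inj) /= in ni *.
have [p hp] := IHn (Ordinal lt_in).
exists (polyC p) => x /=; rewrite /horner_eval map_polyC hornerC/= hp.
by congr x; apply: val_inj.
Qed.

Variable n : nat.

Lemma trop_inv1 : trop_inv (1 : trop R) = 1.
Proof. by rewrite trop1E /= oppr0. Qed.

Lemma trat_eval_frac_const (x : 'I_n -> R) (a : tpolyfun R n) :
  trat_eval x (frac_const (@tpolyfun_cancellative R n) a) = tpolyfun_eval (real_pt x) a.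
Proof.
rewrite /frac_const trat_evalE /fpair_eval.
have -> : fnum (fpair_const a) = a by [].
have -> : fden (fpair_const a) = 1 by [].
by rewrite rmorph1 trop_inv1 mulr1.
Qed.

Lemma trat_eval_const (x : 'I_n -> R) a : trat_eval x (trat_const R n a) = a.
Proof.
by rewrite /trat_const /= trat_eval_frac_const tpolyfun_evalE tpoly_eval_const.
Qed.

Lemma trat_var_ex (i : 'I_n) : exists p : trat R n, forall x, trat_eval x p = Some (x i).
Proof.
have [p hp] := tpoly_var_ex i.
exists (frac_const (@tpolyfun_cancellative R n) (tpolyfun_proj R n p)) => x.
by rewrite trat_eval_frac_const tpolyfun_evalE hp.
Qed.

Lemma trop_invM (a b : trop R) : trop_inv (a * b) = trop_inv a * trop_inv b.
Proof. by case: a => [a|]; case: b => [b|] //=; congr Some; rewrite opprD. Qed.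

Lemma trop_invK : involutive (@trop_inv R).
Proof. by case=> //= a; rewrite opprK. Qed.

Lemma trat_inv_ex (p : trat R n) : (exists x, trat_eval x p != 0) ->
  exists q : trat R n, forall x, trat_eval x q = trop_inv (trat_eval x p).
Proof.
have [f ->] := frac_surj p; move=> [x0].
rewrite trat_evalE /fpair_eval => h.
have num0 : fnum f != 0.
  by apply: contraNneq h => ->; rewrite rmorph0 mul0r.
exists (\pi_(Defs.frac (@tpolyfun_cancellative R n)) (mkfpair (fden f) num0)) => x.
by rewrite !trat_evalE /fpair_eval trop_invM trop_invK mulrC.
Qed.

End TropicalEvaluation.

Section Representable.
Variables (R : realType) (Gamma : tropical_curve R) (n : nat) (F : 'I_n -> Rat_of Gamma).
Hypothesis F_neq : forall i, F i <> Rat_ninfty Gamma.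
Implicit Types (f g : Rat_of Gamma) (h : curve_point Gamma -> R).
Local Notation ninfty := (Rat_ninfty Gamma).

(** The value -oo is allowed here; [tropical_expr] is the same notion for real-valued
functions, on which the lattice and group operations are the usual ones. *)
Definition represents (p : trat R n) f : Prop :=
  forall x : finite_points Gamma, f (val x) = trop_ereal (trat_eval (phi F x) p).

Definition tropical_expr h : Prop := exists p : trat R n,
  forall x : finite_points Gamma, trat_eval (phi F x) p = Some (h (val x)).

Definition fin_pt0 : finite_points Gamma :=
  let: exist x xf := cid (finite_pt_ex Gamma) in exist _ x xf.

Lemma tropical_expr_ext h h' : (forall x, finite_pt x -> h x = h' x) ->
  tropical_expr h -> tropical_expr h'.
Proof. by move=> hh [p hp]; exists p => x; rewrite hp hh//; exact: valP x. Qed.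

Lemma tropical_expr_cst (c : R) : tropical_expr (fun=> c).
Proof. by exists (trat_const R n (Some c)) => x; rewrite trat_eval_const. Qed.

Lemma tropical_expr_gen i : tropical_expr (fine \o F i).
Proof. by have [p hp] := trat_var_ex R i; exists p => x; rewrite hp. Qed.

Lemma tropical_expr_add h h' : tropical_expr h -> tropical_expr h' ->
  tropical_expr (fun x => h x + h' x).
Proof.
by move=> [p hp] [q hq]; exists (p * q) => x; rewrite rmorphM/= hp hq.
Qed.

Lemma tropical_expr_max h h' : tropical_expr h -> tropical_expr h' ->
  tropical_expr (fun x => Num.max (h x) (h' x)).
Proof.
by move=> [p hp] [q hq]; exists (p + q) => x; rewrite rmorphD/= hp hq.
Qed.

Lemma tropical_expr_opp h : tropical_expr h -> tropical_expr (fun x => - h x).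
Proof.
move=> [p hp]; have [|q hq] := @trat_inv_ex R n p.
  by exists (phi F fin_pt0); rewrite hp.
by exists q => x; rewrite hq hp.
Qed.

Lemma tropical_expr_min h h' : tropical_expr h -> tropical_expr h' ->
  tropical_expr (fun x => Num.min (h x) (h' x)).
Proof.
move=> hh hh'; apply: (@tropical_expr_ext (fun x => - Num.max (- h x) (- h' x))).
  by move=> x _; rewrite oppr_max !opprK.
by apply: tropical_expr_opp; apply: tropical_expr_max; exact: tropical_expr_opp.
Qed.

Lemma tropical_expr_mulz (k : int) h : tropical_expr h ->
  tropical_expr (fun x => k%:~R * h x).
Proof.
move=> hh.
have pos (m : nat) : tropical_expr (fun x => m%:R * h x).
  elim: m => [|m IHm].
    by apply: (@tropical_expr_ext (fun=> 0)) (tropical_expr_cst 0) => x _; rewrite mul0r.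
  apply: (tropical_expr_ext _ (tropical_expr_add hh IHm)) => x _.
  by rewrite -addn1 natrD; lra.
case: k => m; first exact: pos.
apply: (tropical_expr_ext _ (tropical_expr_opp (pos m.+1))) => x _.
by rewrite NegzE intrN mulNr.
Qed.

Lemma tropical_expr_sum (I : Type) (r : seq I) (H : I -> curve_point Gamma -> R) :
  (forall i, tropical_expr (H i)) -> tropical_expr (fun x => \sum_(i <- r) H i x).
Proof.
move=> hH; elim: r => [|i r IHr].
  by apply: (@tropical_expr_ext (fun=> 0)) (tropical_expr_cst 0) => x _; rewrite big_nil.
apply: (tropical_expr_ext _ (tropical_expr_add (hH i) IHr)) => x _.
by rewrite big_cons.
Qed.

Lemma tropical_expr_comb (l : 'I_n -> int) :
  tropical_expr (fun x => \sum_i (l i)%:~R * fine (F i x)).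
Proof.
by apply: tropical_expr_sum => i; apply: tropical_expr_mulz; exact: tropical_expr_gen.
Qed.

Lemma represents_cst a : represents (trat_const R n a) (Rat_cst Gamma a).
Proof. by move=> x; rewrite trat_eval_const; case: a. Qed.

Lemma representsD p q f g : represents p f -> represents q g -> represents (p + q) (f + g).
Proof.
move=> hf hg x; rewrite rmorphD/= trop_erealD -hf -hg Rat_addP//; exact: valP x.
Qed.

Lemma representsM p q f g : represents p f -> represents q g -> represents (p * q) (f * g).
Proof.
move=> hf hg x; rewrite rmorphM/= trop_erealM -hf -hg Rat_mulP//; exact: valP x.
Qed.

Lemma represents_expr f : f <> ninfty -> (exists p, represents p f) <-> tropical_expr (fine \o f).
Proof.
move=> fN; split=> -[p hp]; exists p => x.
  apply: trop_ereal_inj; rewrite -hp /= -Rat_finite//; exact: valP x.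
by rewrite hp /= -Rat_finite//; exact: valP x.
Qed.

Lemma represents_ninfty : represents 0 ninfty.
Proof. by move=> x; rewrite rmorph0. Qed.

Lemma span_tropical_expr (D : divisor Gamma) f : generates D F -> RD D f -> f <> ninfty ->
  tropical_expr (fine \o f).
Proof.
move=> [_ gen] /gen[t ->] _N; apply/(represents_expr _N).
elim/big_ind : _ => [|g h [p hp] [q hq]|i _].
- by exists 0; exact: represents_ninfty.
- by exists (p + q); exact: representsD.
- have [q hq] : exists q, represents q (F i).
    by apply/represents_expr => //; exact: tropical_expr_gen.
  by exists (trat_const R n (t i) * q); apply: representsM => //; exact: represents_cst.
Qed.

Lemma tpoly_Rat_ex m (y : 'I_m -> Rat_of Gamma) (p : tpoly R m) :
  (forall i, y i <> ninfty) -> exists f : Rat_of Gamma, forall x, finite_pt x ->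
  f x = trop_ereal (tpoly_eval (fun i => Some (fine (y i x))) p).
Proof.
elim: m y p => [|m IHm] y p yN.
  by exists (Rat_cst Gamma p) => x _ /=; case: p.
elim/poly_ind: p => [|p c [f hf]].
  by exists ninfty => x _; rewrite rmorph0.
have [g hg] := IHm (fun i => y (widen_ord (leqnSn m) i)) c (fun i => yN _).
exists (f * y ord_max + g) => x xf.
rewrite Rat_addP// Rat_mulP// hf// hg// /= /horner_eval.
rewrite [in RHS]rmorphD/=.
rewrite [in RHS]rmorphM/= map_polyX map_polyC/= hornerMXaddC trop_erealD trop_erealM/=.
by rewrite (Rat_finite (yN ord_max) xf).
Qed.

(** Conversely, a tropical rational function of the F_i is a rational function, since
the rational functions form a semifield. *)
Lemma trat_Rat_ex (p : trat R n) : exists f, represents p f.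
Proof.
have [q ->] := frac_surj p.
have ex (a : tpolyfun R n) : exists f : Rat_of Gamma, forall x : finite_points Gamma,
    f (val x) = trop_ereal (tpolyfun_eval (real_pt (phi F x)) a).
  have [b ->] := tpolyfun_projK a; have [f hf] := tpoly_Rat_ex b F_neq.
  by exists f => x; rewrite tpolyfun_evalE hf//; exact: valP x.
have [f hf] := ex (fnum q); have [g hg] := ex (fden q).
have gN : g <> ninfty.
  move=> g0; have := hg fin_pt0; rewrite g0 /=.
  by case: (tpolyfun_eval _ _) (tpolyfun_eval_den (phi F fin_pt0) q).
have [g' [_ hg']] := Rat_opp_ex gN.
exists (f * g') => x; have xf := valP x.
rewrite Rat_mulP// hf hg' // hg trat_evalE /fpair_eval trop_erealM.
congr (_ + _)%E; case: (tpolyfun_eval _ (fden q)) (tpolyfun_eval_den (phi F x) q) => //.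
Qed.

Theorem Rat_isomorphic : (forall f, f <> ninfty -> tropical_expr (fine \o f)) ->
  talg_isomorphic (Rat_talg Gamma) (trat_quot (range (phi F))).
Proof.
move=> all_expr.
have rep f : exists p, represents p f.
  have [->|fN] := pselect (f = ninfty); first by exists 0; exact: represents_ninfty.
  by apply/represents_expr => //; exact: all_expr.
pose E := Econg (range (phi F)).
pose P f : trat R n := projT1 (cid (rep f)).
have PP f : represents (P f) f by exact: projT2 (cid (rep f)).
pose psi f : cong_quot E := @cong_proj _ E (P f).
have psiE p f : represents p f -> psi f = @cong_proj _ E p.
  move=> hp; apply/cong_projP; suff: Econg_rel (range (phi F)) (P f) p by [].
  move=> _ [x _ <-]; apply: trop_ereal_inj.
  by rewrite -(PP f x) -(hp x).
have psiD : nmod_morphism psi.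
  split=> [|f g]; first by rewrite (psiE _ _ represents_ninfty) rmorph0.
  by rewrite (psiE _ _ (representsD (PP f) (PP g))) rmorphD.
have psiM : monoid_morphism psi.
  split=> [|f g]; last by rewrite (psiE _ _ (representsM (PP f) (PP g))) rmorphM.
  by rewrite (psiE _ _ (represents_cst 1)) !rmorph1.
pose psiN := GRing.isNmodMorphism.Build (Rat_of Gamma) (cong_quot E) psi psiD.
pose psiM' := GRing.isMonoidMorphism.Build (Rat_of Gamma) (cong_quot E) psi psiM.
pose Psi : {rmorphism Rat_of Gamma -> cong_quot E} := HB.pack psi psiN psiM'.
exists Psi; split; last by move=> a; rewrite /= -(psiE _ _ (represents_cst a)).
have inj : injective psi.
  move=> f g /cong_projP h; apply: Rat_eqP => x xf.
  rewrite (PP f (exist _ x xf)) (PP g (exist _ x xf)) h//.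
have surj y : exists f, psi f = y.
  have [p ->] := cong_proj_surj y; have [f hf] := trat_Rat_ex p.
  by exists f; exact: psiE.
exists (fun y => projT1 (cid (surj y))) => y /=.
  by apply: inj; exact: projT2 (cid (surj (psi y))).
exact: projT2 (cid (surj y)).
Qed.

End Representable.

(** * Compactness of the curve *)

Section Compactness.
Variables (R : realType) (Gamma : tropical_curve R).
Implicit Types (e : edge Gamma) (x : curve_point Gamma).

(** Compactness of a segment in the form used below: an ideal of sets that contains
a neighbourhood of each point contains the segment.  The covering property is
applied to the filter of the members of the ideal that are large enough. *)
Lemma segment_ideal (a b : R) (J : set R -> Prop) :
  J set0 -> (forall A B, J A -> J B -> J (A `|` B)) ->
  (forall A B, A `<=` B -> J B -> J A) ->
  (forall t, `[a, b]%classic t -> exists2 U, nbhs t U & J (`[a, b]%classic `&` U)) ->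
  J `[a, b]%classic.
Proof.
move=> J0 JU JS Jloc.
have /compact_near_coveringP cov := @segment_compact R a b.
(* the sections of the ideal, directed by inclusion *)
pose G : set_system (set R) := [set A | exists2 Z, J Z & forall Z', J Z' -> Z `<=` Z' -> A Z'].
have FG : Filter G.
  split.
  - by exists set0.
  - move=> A B [Z JZ hZ] [Y JY hY]; exists (Z `|` Y); first exact: JU.
    move=> Z' JZ' sub; split.
      by apply: hZ => // s Zs; apply: sub; left.
    by apply: hY => // s Ys; apply: sub; right.
  - by move=> A B AB [Z JZ hZ]; exists Z => // Z' JZ' sub; apply/AB/hZ.
have [t abt|Z JZ hZ] := cov _ G (fun Z s => `[a, b]%classic s -> Z s) FG.
  have [U tU JU'] := Jloc t abt.
  exists (U, [set Z | `[a, b]%classic `&` U `<=` Z]); first by split=> //=; exists (`[a, b]%classic `&` U).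
  by move=> [s Z] /= [Us h] abs; apply: h.
by apply: JS (JZ) => s abs; apply: (hZ Z).
Qed.

Variable I : set (curve_point Gamma) -> Prop.
Hypothesis IU : forall A B, I A -> I B -> I (A `|` B).
Hypothesis IS : forall A B, A `<=` B -> I B -> I A.
Hypothesis Iloc : forall e d, valid_germ e d ->
  exists2 U, germ_nbhs d U & I [set edge_pt e s%:E | s in U].

Let edge_segment e (a b : R) : 0 <= a -> (b%:E <= len e)%E ->
  I [set edge_pt e s%:E | s in `[a, b]%classic].
Proof.
move=> a0 bl.
have v0 : valid_germ e (Fwd 0) by rewrite /= len_gt0.
have I0 : I set0 by have [U _ IUU] := Iloc v0; apply: IS IUU.
apply: (@segment_ideal a b (fun A => I [set edge_pt e s%:E | s in A])).
- by apply: IS I0 => _ [s []].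
- move=> A B IA IB; apply: IS (IU IA IB) => _ [s [As|Bs] <-].
    by left; exists s.
  by right; exists s.
- by move=> A B AB; apply: IS => _ [s As <-]; exists s => //; exact: AB.
move=> t /=; rewrite in_itv/= => /andP[at_ tb].
have t0 : 0 <= t by lra.
have tl : (t%:E <= len e)%E by apply: le_trans bl; rewrite lee_fin.
have [r1 r10 hr1] : exists2 r : R, 0 < r & I [set edge_pt e s%:E | s in [set s | t <= s < t + r] `&` `[a, b]%classic].
  have [lt|nlt] := boolP (t%:E < len e)%E.
    have [U /germ_nbhs_Fwd[r r0 hr] IUU] := Iloc (conj t0 lt : valid_germ e (Fwd t)).
    exists r => //; apply: IS IUU => _ [s [/andP[h1 h2] _] <-]; exists s => //.
    exact: hr.
  have lt : len e = t%:E by apply/le_anti; rewrite tl leNgt nlt.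
  have bt : b = t by apply/le_anti; rewrite tb -lee_fin -lt bl.
  have t0' : 0 < t by rewrite -lte_fin -lt len_gt0.
  have [U /germ_nbhs_Bwd[r r0 hr] IUU] := Iloc (conj t0' tl : valid_germ e (Bwd t)).
  exists 1 => //; apply: IS IUU => y [s [/andP[h1 _] /=]]; rewrite in_itv/= bt.
  by move=> /andP[_ h2] <-; exists s => //; apply: hr => //; lra.
have [r2 r20 hr2] : exists2 r : R, 0 < r & I [set edge_pt e s%:E | s in [set s | t - r < s <= t] `&` `[a, b]%classic].
  have [t0'|t0'] := ltP 0 t.
    have [U /germ_nbhs_Bwd[r r0 hr] IUU] := Iloc (conj t0' tl : valid_germ e (Bwd t)).
    exists r => //; apply: IS IUU => _ [s [/andP[h1 h2] _] <-]; exists s => //.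
    exact: hr.
  have [U /germ_nbhs_Fwd[r r0 hr] IUU] := Iloc v0.
  exists 1 => //; apply: IS IUU => y [s [/andP[h1 h2] /=]]; rewrite in_itv/=.
  by move=> /andP[h3 _] <-; exists s => //; apply: hr => //; lra.
exists [set s | t - Num.min r1 r2 < s < t + Num.min r1 r2].
  apply/nbhs_ballP; exists (Num.min r1 r2) => /=; first by rewrite lt_min r10.
  by move=> s; rewrite /ball/= ltr_norml => /andP[h1 h2]; apply/andP; split; lra.
apply: IS (IU hr1 hr2) => _ [s [abs /= /andP[h1 h2]] <-].
have m1 : Num.min r1 r2 <= r1 by rewrite ge_min lexx.
have m2 : Num.min r1 r2 <= r2 by rewrite ge_min lexx orbT.
have [ts|st] := leP t s.
  by left; exists s => //; split=> //=; apply/andP; split; lra.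
by right; exists s => //; split=> //=; apply/andP; split; lra.
Qed.

Let edge_ideal e : I [set edge_pt e s%:E | s in edge_dom e].
Proof.
case le: (len e) (len_gt0 e) => [l||] // _.
  have := @edge_segment e 0 l (lexx 0); rewrite le => /(_ (lexx _)).
  apply: IS => _ [s [s0 sl] <-]; exists s => //=; rewrite in_itv/= s0/=.
  by rewrite -lee_fin -le.
have [U /germ_nbhs_Inf[M hM] IUU] := Iloc (le : valid_germ e Inf).
have := @edge_segment e 0 (Num.max 0 M) (lexx 0); rewrite le => /(_ (leey _)) I2.
apply: IS (IU IUU I2) => _ [s [s0 _] <-].
have [Ms|sM] := ltP M s; first by left; exists s => //; exact: hM.
by right; exists s => //=; rewrite in_itv/= s0 le_max sM orbT.
Qed.

Lemma finite_pt_edge e0 x : finite_pt x -> exists e t, edge_dom e t /\ x = edge_pt e t%:E.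
Proof.
case: x => [v|p] xf; last first.
  have /andP[p0 pl] := valP p.
  by exists (val p).1, (val p).2; split; [split; exact: ltW|exact: inr_edge_pt].
suff [e] : exists e, incident e v.
  move=> /orP[/eqP ev|/eqP ev].
    by exists e, 0; split; [split=> //; exact/ltW/len_gt0|rewrite edge_pt_src// ev].
  have [l el] : exists l : R, len e = l%:E by apply: tgt_len; rewrite ev.
  exists e, l; split; last by rewrite edge_pt_tgt ?el// ev.
  by split; rewrite ?el// -lee_fin -el; exact/ltW/len_gt0.
have [<-|ne] := eqVneq (src e0) v; first by exists e0; rewrite /incident eqxx.
have /connectP[[|w p] /= path_p last_p] := graph_connected v (src e0).
  by rewrite last_p eqxx in ne.
move: path_p => /andP[/existsP[e he] _]; exists e; rewrite /incident.
by move: he => /orP[] /andP[h1 h2]; rewrite ?h1 ?h2 ?orbT.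
Qed.

(** The same for the curve, where a neighbourhood of a point is replaced by its
one-sided pieces along the edges; the finite points form a compact set once
a neighbourhood of each point at infinity is removed. *)
Lemma curve_ideal (e0 : edge Gamma) : I [set x | finite_pt x].
Proof.
have v0 : valid_germ e0 (Fwd 0) by rewrite /= len_gt0.
have I0 : I set0 by have [U _ IUU] := Iloc v0; apply: IS IUU.
have key (r : seq (edge Gamma)) :
    I (\bigcup_(e in [set` r]) [set edge_pt e s%:E | s in edge_dom e]).
  elim: r => [|e r IHr]; first by apply: IS I0 => x [].
  apply: IS (IU (edge_ideal e) IHr) => x [e' /=]; rewrite inE => /orP[/eqP ->|e'r] xe'.
    by left.
  by right; exists e'.
apply: IS (key (enum {: edge Gamma})) => x xf.
have [e [t [te ->]]] := finite_pt_edge e0 xf.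
by exists e => /=; [rewrite mem_enum|exists t].
Qed.

End Compactness.

(** * Slopes realised by a linear system *)

Section Generators.
Variables (R : realType) (Gamma : tropical_curve R) (D : divisor Gamma).
Variables (n : nat) (F : 'I_n -> Rat_of Gamma).
Hypothesis effD : effective D.
Hypothesis genF : generates D F.
Hypothesis F_neq : forall i, F i <> Rat_ninfty Gamma.
Implicit Types (e : edge Gamma) (x y : curve_point Gamma) (f g : Rat_of Gamma).
Implicit Types (s t : R) (d : germ R).
Local Notation ninfty := (Rat_ninfty Gamma).

Lemma Rat_sumP (I : finType) (H : I -> Rat_of Gamma) x : finite_pt x ->
  (\sum_i H i : Rat_of Gamma) x = \big[maxe/-oo%E]_i (H i x).
Proof.
move=> xf; apply: (big_morph (fun f : Rat_of Gamma => f x)) => // f g.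
exact: Rat_addP.
Qed.

Lemma RD_mul f g : f <> ninfty -> g <> ninfty ->
  (forall x, 0 <= coeff x D + ord f x + ord g x) -> RD D (f * g).
Proof.
move=> fN gN h; apply/RDP => [|x]; first exact: Rat_mul_neq.
by rewrite ordM// addrA.
Qed.

Lemma RD_one : RD D (Rat_cst Gamma (Some 0)). Proof. exact: RD_cst. Qed.

Lemma generator_ex : exists i : 'I_n, True.
Proof.
have [t tE] := genF.2 _ RD_one.
have [n0|n0] := posnP n; last by exists (Ordinal n0).
case: (@Rat_cst_neq _ Gamma 0); rewrite tE big1// => -[i i_lt].
by exfalso; rewrite n0 in i_lt.
Qed.

(** D + div G is the reduced divisor at [x]: relative to their value at [x], all
elements of R(D) are below G, which amounts to having as many chips as possible
at [x].  Its existence follows from finite generation. *)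
Lemma peak_ex x : finite_pt x -> exists G : Rat_of Gamma,
  [/\ G <> ninfty, RD D G, G x = 0%E &
   forall f, RD D f -> f <> ninfty -> forall y, finite_pt y ->
     fine (f y) - fine (f x) <= fine (G y)].
Proof.
move=> xf.
pose G : Rat_of Gamma := \sum_i Rat_cst Gamma (Some (- fine (F i x))) * F i.
have termE i y : finite_pt y ->
    (Rat_cst Gamma (Some (- fine (F i x))) * F i : Rat_of Gamma) y
    = (fine (F i y) - fine (F i x))%:E.
  by move=> yf; rewrite Rat_mulP//= (Rat_finite (@F_neq i) yf) -EFinD addrC.
have GE y : finite_pt y -> G y = \big[maxe/-oo%E]_i (fine (F i y) - fine (F i x))%:E.
  by move=> yf; rewrite Rat_sumP//; apply: eq_bigr => i _; exact: termE.
have Gx : G x = 0%E.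
  rewrite GE//; apply/le_anti/andP; split.
    by apply: bigmax_le => [|i _]; rewrite ?leNye// subrr.
  have [i _] := generator_ex; apply: (bigmax_sup i) => //.
  by rewrite subrr.
have GN : G <> ninfty by apply: (Rat_neq_ninfty (x := x)); rewrite Gx.
have GD : RD D G by apply: RD_sum => i; apply: RD_scale; exact: genF.1.
exists G; split=> // f fD fN y yf.
have [t fE] := genF.2 _ fD.
have tE i z : finite_pt z -> (Rat_cst Gamma (t i) * F i : Rat_of Gamma) z
     = (trop_ereal (t i) + (fine (F i z))%:E)%E.
  move=> zf; rewrite Rat_mulP// (Rat_finite (@F_neq i) zf); case: (t i) => //.
suff : (f y <= f x + G y)%E.
  rewrite (Rat_finite fN yf) (Rat_finite fN xf) (Rat_finite GN yf) -EFinD lee_fin; lra.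
rewrite {1}fE Rat_sumP//; apply: bigmax_le => [|i _]; first exact: leNye.
rewrite tE//; have -> : (fine (F i y))%:E = ((fine (F i x))%:E + (fine (F i y) - fine (F i x))%:E)%E.
  by rewrite -EFinD; congr EFin; lra.
rewrite addeA; apply: leeD; last by rewrite GE//; exact: (le_bigmax _ _ i).
by rewrite -tE// fE Rat_sumP//; exact: (le_bigmax _ _ i).
Qed.

(** An element of R(D) is a maximum of translates of the generators. *)
Lemma RD_germ_slope f e d : RD D f -> f <> ninfty -> valid_germ e d ->
  exists i, germ_slope_on f e d = germ_slope_on (F i) e d.
Proof.
move=> fD fN ve; have [t fE] := genF.2 _ fD.
suff [//|//] : f = ninfty \/ exists i, germ_slope_on f e d = germ_slope_on (F i) e d.
rewrite fE; elim/big_ind : _ => [|g h Hg Hh|i _].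
- by left.
- have [->|gN] := pselect (g = ninfty); first by rewrite -Rat0E add0r.
  have [->|hN] := pselect (h = ninfty); first by rewrite -Rat0E addr0.
  case: Hg => // -[i gi]; case: Hh => // -[j hj]; right.
  by have [->|->] := germ_slope_on_max gN hN ve; [exists i|exists j].
- case: (t i) => [c|]; last by left; rewrite [Rat_cst _ _](_ : _ = 0)// mul0r.
  right; exists i; rewrite germ_slope_onM//; last exact: Rat_cst_neq.
  by rewrite germ_slope_on_cst add0r.
Qed.

(** With G = [peak_ex] at [z], the slopes of G at [z] are the largest slope [v a], on
the right, and the smallest slope [v b], on the left.  If they differ by at
least 2, then at least two chips lie at [z], and firing two of them gives an
element of R(D) of slope [v a - 1] to the right of [z]; hence two of the slopes differ by 1 in every case. *)
Lemma unimodular e (z r : R) (v : 'I_n -> int) (c : 'I_n -> R) :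
  0 < r -> 0 <= z - r -> ((z + r)%:E <= len e)%E ->
  (forall i s, z - r < s -> s < z + r -> on_edge (F i) e s = (v i)%:~R * s + c i) ->
  (exists i, v i <> 0) -> exists l : 'I_n -> int, \sum_i l i * v i = 1.
Proof.
move=> r0 zr0 zrl aff [i0 vi0].
have vF : valid_germ e (Fwd z).
  by split; [lra|apply: lt_le_trans zrl; rewrite lte_fin; lra].
have vB : valid_germ e (Bwd z).
  by split; [lra|apply: le_trans zrl; rewrite lee_fin; lra].
have slF i : germ_slope_on (F i) e (Fwd z) = v i.
  by apply: (@germ_slope_onE _ _ _ _ _ _ (c i)); apply/germ_nbhs_Fwd; exists r => // s h1 h2;
    apply: aff; lra.
have slB i : germ_slope_on (F i) e (Bwd z) = v i.
  by apply: (@germ_slope_onE _ _ _ _ _ _ (c i)); apply/germ_nbhs_Bwd; exists r => // s h1 h2;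
    apply: aff; lra.
have [G [GN GD Gx Gmax]] := peak_ex (edge_pt_finite e z).
have diff a b : v a - v b = 1 -> exists l : 'I_n -> int, \sum_i l i * v i = 1.
  move=> vab; exists (fun i => (i == a)%:R - (i == b)%:R).
  under eq_bigr do rewrite mulrBl.
  rewrite sumrB (bigD1 a)//= eqxx mul1r big1 ?addr0 => [|i /negbTE ->]; last by rewrite mul0r.
  by rewrite (bigD1 b)//= eqxx mul1r big1 ?addr0 => [|i /negbTE ->]; last by rewrite mul0r.
have [a slGF] := RD_germ_slope GD GN vF; rewrite slF in slGF.
have [b slGB] := RD_germ_slope GD GN vB; rewrite slB in slGB.
pose Fn i : Rat_of Gamma := Rat_cst Gamma (Some (- on_edge (F i) e z)) * F i.
have FnN i : Fn i <> ninfty by apply: Rat_mul_neq => //; exact: Rat_cst_neq.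
have FnE i s : on_edge (Fn i) e s = on_edge (F i) e s - on_edge (F i) e z.
  by rewrite on_edgeM// ?on_edge_cst; [lra|exact: Rat_cst_neq].
have Gz : on_edge G e z = 0 by rewrite /on_edge Gx.
have FnG i s : on_edge (Fn i) e s <= on_edge G e s.
  by rewrite FnE; apply: Gmax => //; [exact: genF.1|exact: edge_pt_finite].
have slFn i d : valid_germ e d -> germ_slope_on (Fn i) e d = germ_slope_on (F i) e d.
  move=> ve; rewrite germ_slope_onM//; last exact: Rat_cst_neq.
  by rewrite germ_slope_on_cst add0r.
have le_a i : v i <= v a.
  rewrite -slGF -slF -slFn//; apply: germ_slope_Fwd_mono => //.
  by rewrite Gz FnE subrr.
have ge_b i : v b <= v i.
  rewrite -slGB -slB -slFn//; apply: germ_slope_Bwd_mono => //.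
  by rewrite Gz FnE subrr.
have [j] := RD_germ_slope RD_one (@Rat_cst_neq _ _ 0) vF.
rewrite germ_slope_on_cst slF => vj.
have ab : v b < v a.
  have := le_a i0; have := ge_b i0; have := le_a j; have := ge_b j.
  by rewrite -vj; move: vi0; lia.
have [ab1|ab2] : v a - v b = 1 \/ 2 <= v a - v b by lia.
  exact: diff ab1.
have [B [BN BE Bx Bz]] := bump_ex r0 zr0 zrl.
have GBN := Rat_mul_neq GN BN.
have GBD : RD D (G * B).
  apply: RD_mul => // x; have [->|/eqP xz] := eqVneq x (edge_pt e z%:E).
    have [p [vp pE]] : exists p : inner_point Gamma, val p = (e, z) /\ edge_pt e z%:E = inr p.
      by apply: edge_pt_inr; [case: vB|case: vF].
    have oG : ord G (edge_pt e z%:E) = v a - v b.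
      by rewrite pE ord_inr// vp/= slGF slGB.
    by rewrite oG; have := effD (edge_pt e z%:E); move: Bz ab2; lia.
  by apply: addr_ge0; [move/(RDP D GN): GD|exact: Bx].
have [c' slGB'] := RD_germ_slope GBD GBN vF; rewrite slF in slGB'.
apply: (diff a c'); rewrite -slGB' germ_slope_onM// slGF.
suff -> : germ_slope_on B e (Fwd z) = -1 by lia.
apply: (@germ_slope_onE _ _ _ _ _ _ (r + z)); apply/germ_nbhs_Fwd; exists r => // s h1 h2.
by rewrite BE ger0_norm ?max_r; lra.
Qed.

(** If some generator goes to +oo on [e], then D has a chip at the point at infinity
and the ramp is itself in R(D).  If some generator has slope -k < 0 there, adding
the ramp at most k times stays in R(D), and the last two of these sums differ by
the ramp. *)
Lemma ramp_expr e (M : R) : len e = +oo%E -> 0 < M ->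
  (exists i, germ_slope_on (F i) e Inf <> 0) ->
  exists u : curve_point Gamma -> R, [/\ tropical_expr F u,
    forall s, u (edge_pt e s%:E) = Num.max 0 (s - M) &
    forall e' s, e' != e -> u (edge_pt e' s%:E) = 0].
Proof.
move=> le M0 [i ki].
have [u [uN uE uE' uinf uord]] := ramp_ex le M0.
exists (fine \o u); split; [|by []|by []].
have ord_i : ord (F i) (inl (tgt e)) = - germ_slope_on (F i) e Inf.
  exact: ord_infinity.
have FiD : RD D (F i) by exact: genF.1.
have [kpos|kneg] : 0 < germ_slope_on (F i) e Inf \/ germ_slope_on (F i) e Inf < 0 by lia.
  apply: (span_tropical_expr F_neq genF _ uN) => //; apply/(RDP D uN) => x.
  have [->|/eqP xe] := eqVneq x (inl (tgt e)); last by apply: addr_ge0; [exact: effD|exact: uord].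
  move/(RDP D (@F_neq i)): FiD => /(_ (inl (tgt e))); rewrite ord_i uinf.
  by move: kpos; lia.
have [m mE] : exists m : nat, germ_slope_on (F i) e Inf = - (m.+1)%:Z.
  by exists (`|germ_slope_on (F i) e Inf|.-1)%N; lia.
have pow j : (j <= m.+1)%N -> F i * u ^+ j <> ninfty /\ RD D (F i * u ^+ j) /\
   (forall x, ord (F i * u ^+ j) x = ord (F i) x + ord u x * j%:Z).
  elim: j => [|j IHj] jm.
    by rewrite expr0 mulr1; split=> //; split=> // x; rewrite mulr0 addr0.
  have [gN [gD gord]] := IHj (ltnW jm).
  have ordE x : ord (F i * u ^+ j.+1) x = ord (F i) x + ord u x * j.+1%:Z.
    by rewrite exprSr mulrA ordM// gord; lia.
  have N' : F i * u ^+ j.+1 <> ninfty by rewrite exprSr mulrA; exact: Rat_mul_neq.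
  split=> //; split=> //; apply/(RDP D N') => x; rewrite ordE.
  have [->|/eqP xe] := eqVneq x (inl (tgt e)).
    by rewrite ord_i uinf mE; have := effD (inl (tgt e)); move: jm; lia.
  have h1 := uord x xe; have h2 : 0 <= coeff x D + ord (F i) x by move/(RDP D (@F_neq i)): FiD.
  have : 0 <= ord u x * j.+1%:Z by apply: mulr_ge0.
  by move: h2; lia.
have [gN [gD _]] := pow m (leqnSn m).
have [hN [hD _]] := pow m.+1 (leqnn _).
have eg := span_tropical_expr F_neq genF gD gN.
have eh := span_tropical_expr F_neq genF hD hN.
apply: (tropical_expr_ext _ (tropical_expr_add eh (tropical_expr_opp eg))) => x xf.
rewrite /= exprSr mulrA Rat_mulP// (Rat_finite gN xf) (Rat_finite uN xf) -EFinD /=.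
by lra.
Qed.

End Generators.

(** * Integer vectors and rays *)

Section IntegerSeparation.
Variable n : nat.
Implicit Types w : 'I_n -> int.

Let sum_delta (a : int) i w : \sum_j ((j == i)%:R * a) * w j = a * w i.
Proof.
rewrite (bigD1 i)//= eqxx mul1r big1 ?addr0// => j /negbTE ->.
by rewrite !mul0r.
Qed.

(** If some 2 x 2 minor of the two vectors is nonzero, it gives a form that vanishes
on the first and is negative on the second.  Otherwise the vectors are opposite up
to positive factors, and a coordinate separates them. *)
Lemma integer_separation w w' : (exists i, w i <> 0) -> (exists i, w' i <> 0) ->
  (forall p q : int, 0 < p -> 0 < q -> ~ forall i, p * w i = q * w' i) ->
  exists l : 'I_n -> int, 0 <= \sum_i l i * w i /\ \sum_i l i * w' i < 0.
Proof.
move=> [i wi] [i' wi'] nonpar.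
have [par|/existsNP[a /existsNP[b nab]]] :=
  pselect (forall a b, w a * w' b = w b * w' a); last first.
  pose dlt := w b * w' a - w a * w' b.
  exists (fun j => (j == a)%:R * (- dlt * w b) + (j == b)%:R * (dlt * w a)).
  have E v : \sum_j ((j == a)%:R * (- dlt * w b) + (j == b)%:R * (dlt * w a)) * v j
     = dlt * (w a * v b - w b * v a).
    under eq_bigr do rewrite mulrDl.
    by rewrite big_split/= !sum_delta; ring.
  rewrite !E; split; first by rewrite (_ : _ - _ = 0) ?mulr0//; ring.
  have -> : w a * w' b - w b * w' a = - dlt by rewrite /dlt; ring.
  have dn0 : dlt != 0 by apply/eqP; rewrite /dlt; lia.
  by rewrite mulrN oppr_lt0 -expr2 exprn_even_gt0.
have w'i : w' i <> 0.
  by move=> w'0; have := par i i'; rewrite w'0 mulr0 => /eqP; rewrite mulf_eq0 => /orP[]/eqP.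
have [pos|neg] : 0 < w i * w' i \/ w i * w' i < 0.
  have : w i * w' i <> 0 by move/eqP; rewrite mulf_eq0 => /orP[]/eqP.
  lia.
  exfalso; apply: (nonpar `|w' i| `|w i|); rewrite ?normr_gt0; [exact/eqP|exact/eqP|].
  move=> j; have pj := par i j.
  have [w0|w0] := ltP 0 (w i).
    have w'0 : 0 < w' i by rewrite -(pmulr_rgt0 _ w0).
    by rewrite !gtr0_norm//; lia.
  have {}w0 : w i < 0 by rewrite lt_neqAle w0 andbT; apply/eqP.
  have w'0 : w' i < 0 by rewrite -(nmulr_rgt0 _ w0).
  by rewrite !ltr0_norm//; lia.
exists (fun j => (j == i)%:R * w i); rewrite !sum_delta.
by split=> //; rewrite -expr2 sqr_ge0.
Qed.

End IntegerSeparation.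

Section Rays.
Variable R : realType.

(** The two kinds of germs at a finite point, with the distance to it as parameter. *)
Definition ray (b : bool) (t : R) : germ R := if b then Fwd t else Bwd t.
Definition ray_pt (b : bool) (t rho : R) : R := if b then t + rho else t - rho.

Lemma germ_ray b t (P : set R) : germ_nbhs (ray b t) P <->
  exists2 r : R, 0 < r & forall rho, 0 <= rho -> rho < r -> P (ray_pt b t rho).
Proof.
case: b; split.
- by move=> /germ_nbhs_Fwd[r r0 hr]; exists r => // rho h1 h2; apply: hr => /=; lra.
- move=> [r r0 hr]; apply/germ_nbhs_Fwd; exists r => // s h1 h2.
  by rewrite (_ : s = ray_pt true t (s - t)); [apply: hr; lra|rewrite /=; lra].
- by move=> /germ_nbhs_Bwd[r r0 hr]; exists r => // rho h1 h2; apply: hr => /=; lra.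
- move=> [r r0 hr]; apply/germ_nbhs_Bwd; exists r => // s h1 h2.
  by rewrite (_ : s = ray_pt false t (t - s)); [apply: hr; lra|rewrite /=; lra].
Qed.

Lemma germ_cases (d : germ R) : d = Inf \/ exists b t, d = ray b t.
Proof. by case: d => [t|t|]; [right; exists true, t|right; exists false, t|left]. Qed.

Lemma near_ray b t (eps : R) : 0 < eps ->
  \forall s \near germ_nbhs (ray b t), `|s - t| < eps.
Proof.
move=> e0; apply/germ_ray; exists eps => // rho r0 re.
by rewrite /ray_pt; case: b; rewrite ltr_norml; apply/andP; split; lra.
Qed.

Lemma nat_above (x : R) : exists N : nat, x <= N%:R.
Proof.
have [x0|x0] := leP 0 x; last by exists 0; exact: ltW.
by exists (Num.bound x); apply/ltW/archi_boundP.
Qed.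

Lemma affine_bounded b t (k : int) (c : R) : exists N : nat,
  \forall s \near germ_nbhs (ray b t), k%:~R * s + c <= N%:R.
Proof.
have [N hN] := nat_above (k%:~R * t + c + `|k%:~R|); exists N.
apply: filterS (near_ray b t ltr01) => s st; apply: le_trans hN.
have : k%:~R * (s - t) <= `|k%:~R| :> R.
  apply: le_trans (ler_norm _) _; rewrite normrM ler_piMr//.
  exact: ltW.
by rewrite mulrBr; lra.
Qed.

End Rays.

(** * Every rational function is a tropical expression *)

Section Separation.
Variables (R : realType) (Gamma : tropical_curve R) (D : divisor Gamma).
Variables (n : nat) (F : 'I_n -> Rat_of Gamma).
Hypothesis effD : effective D.
Hypothesis genF : generates D F.
Hypothesis F_neq : forall i, F i <> Rat_ninfty Gamma.
Hypothesis phi_inj : injective (phi F).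
Implicit Types (e : edge Gamma) (x y : curve_point Gamma) (f g : Rat_of Gamma).
Implicit Types (s t : R) (d : germ R) (u : curve_point Gamma -> R).
Local Notation ninfty := (Rat_ninfty Gamma).

Lemma phi_inj_pt x y : finite_pt x -> finite_pt y ->
  (forall i, fine (F i x) = fine (F i y)) -> x = y.
Proof.
move=> xf yf E.
suff [] : exist _ x xf = exist _ y yf :> finite_points Gamma by [].
by apply: phi_inj; apply/funext => i; exact: E.
Qed.

Lemma edge_pt_interior_inj e e' s s' : 0 < s -> (s%:E < len e)%E ->
  0 < s' -> (s'%:E < len e')%E -> edge_pt e s%:E = edge_pt e' s'%:E -> e = e' /\ s = s'.
Proof.
move=> s0 sl s0' sl'; have [p [vp ->]] := edge_pt_inr s0 sl.
have [q [vq ->]] := edge_pt_inr s0' sl' => -[pq].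
by move: vp; rewrite pq vq => -[-> ->].
Qed.

Lemma germ_interior e d (P : set R) : valid_germ e d -> germ_nbhs d P ->
  exists a b : R, [/\ a < b, 0 <= a, (b%:E <= len e)%E & forall s, a < s -> s < b -> P s].
Proof.
move=> ve dP; have [a [b [ab h]]] := germ_nbhs_itv (filterI dP (valid_germ_dom ve)).
exists ((2 * a + b) / 3), ((a + 2 * b) / 3); split.
- by lra.
- by have [_ []] := h ((2 * a + b) / 3) ltac:(apply/andP; split; lra).
- by have [_ []] := h ((a + 2 * b) / 3) ltac:(apply/andP; split; lra).
- by move=> s s1 s2; have [] := h s ltac:(apply/andP; split; lra).
Qed.

Lemma generators_affine e d : valid_germ e d -> exists c : 'I_n -> R,
  \forall s \near germ_nbhs d, forall i,
    fine (F i (edge_pt e s%:E)) = (germ_slope_on (F i) e d)%:~R * s + c i.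
Proof.
move=> ve; have /choice[c hc] i := germ_slope_on_affine (@F_neq i) ve.
by exists c; apply: filter_forall.
Qed.

(** If all slopes vanished, phi would be constant on an interval. *)
Lemma germ_slope_neq0 e d : valid_germ e d -> exists i, germ_slope_on (F i) e d <> 0.
Proof.
move=> ve; apply/existsNP => v0; have [c hc] := generators_affine ve.
have [a [b [ab a0 bl h]]] := germ_interior ve hc.
have lt s : s < b -> (s%:E < len e)%E by move=> sb; apply: lt_le_trans bl; rewrite lte_fin.
have : edge_pt e ((2 * a + b) / 3)%:E = edge_pt e ((a + 2 * b) / 3)%:E.
  apply: phi_inj_pt; [exact: edge_pt_finite|exact: edge_pt_finite|] => i.
  by rewrite !h ?v0 ?mul0r//; lra.
move=> /edge_pt_interior_inj[]; [lra|apply: lt; lra|lra|apply: lt; lra|].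
by move=> _; lra.
Qed.

Lemma germ_unimodular e d : valid_germ e d ->
  exists l : 'I_n -> int, \sum_i l i * germ_slope_on (F i) e d = 1.
Proof.
move=> ve; have [c hc] := generators_affine ve.
have [a [b [ab a0 bl h]]] := germ_interior ve hc.
apply: (unimodular effD genF F_neq (e := e) (v := fun i => germ_slope_on (F i) e d) (z := (a + b) / 2) (r := (b - a) / 2) (c := c)).
- by lra.
- by lra.
- by have -> : (a + b) / 2 + (b - a) / 2 = b by lra.
- by move=> i s h1 h2; apply: h; lra.
- exact: germ_slope_neq0.
Qed.

Lemma comb_germ (l : 'I_n -> int) e d : valid_germ e d ->
  exists c, \forall s \near germ_nbhs d,
   \sum_i (l i)%:~R * fine (F i (edge_pt e s%:E))
   = (\sum_i l i * germ_slope_on (F i) e d)%:~R * s + c.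
Proof.
move=> ve; have [c hc] := generators_affine ve.
exists (\sum_i (l i)%:~R * c i); apply: filterS hc => s h.
rewrite rmorph_sum/= mulr_suml -big_split/=; apply: eq_bigr => i _.
by rewrite h intrM mulrDr mulrA.
Qed.

Definition germwise_affine u : Prop := forall e d, valid_germ e d ->
  exists (k : int) c, \forall s \near germ_nbhs d, u (edge_pt e s%:E) = k%:~R * s + c.

(** A combination of slope 1 exists by [germ_unimodular]; scale and translate it. *)
Lemma germ_realize e d (k : int) (c : R) : valid_germ e d ->
  exists u, [/\ tropical_expr F u, germwise_affine u &
    \forall s \near germ_nbhs d, u (edge_pt e s%:E) = k%:~R * s + c].
Proof.
move=> ve; have [l l1] := germ_unimodular ve.
pose kl i := k * l i.
have [c0 hc0] := comb_germ kl ve.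
exists (fun x => \sum_i (kl i)%:~R * fine (F i x) + (c - c0)); split.
- apply: tropical_expr_add; [exact: tropical_expr_comb|exact: tropical_expr_cst].
- move=> e' d' ve'; have [c1 hc1] := comb_germ kl ve'.
  exists (\sum_i kl i * germ_slope_on (F i) e' d'), (c1 + (c - c0)).
  by apply: filterS hc1 => s ->; rewrite -addrA.
- apply: filterS hc0 => s ->.
  have -> : \sum_i kl i * germ_slope_on (F i) e d = k.
    by rewrite /kl; under eq_bigr do rewrite -mulrA; rewrite -mulr_sumr l1 mulr1.
  by lra.
Qed.

Lemma ramp_tropical e (M : R) : len e = +oo%E -> 0 < M ->
  exists u, [/\ tropical_expr F u,
    forall s, u (edge_pt e s%:E) = Num.max 0 (s - M) &
    forall e' s, e' != e -> u (edge_pt e' s%:E) = 0].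
Proof.
move=> le M0; apply: (ramp_expr effD genF F_neq le M0).
exact: (@germ_slope_neq0 e Inf).
Qed.

Lemma ray_valid_dom e b t : valid_germ e (ray b t) ->
  0 <= t /\ (t%:E <= len e)%E.
Proof. by case: b => /= -[h1 h2]; split=> //; exact: ltW. Qed.

(** The bound on the second germ is the one needed to correct a function that exceeds
f by k s + c. *)
Definition separates e d e' d' (k : int) (c : R) : Prop :=
  exists z, [/\ tropical_expr F z,
    \forall s \near germ_nbhs d, z (edge_pt e s%:E) = 0 &
    \forall s \near germ_nbhs d', z (edge_pt e' s%:E) <= - (k%:~R * s + c)].

(** Minus a multiple of the ramp at the second germ, the multiple being chosen larger
than the slope k. *)
Lemma separates_Inf_r e d e' k c : valid_germ e d -> len e' = +oo%E ->
  ~ (e = e' /\ d = Inf) -> separates e d e' Inf k c.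
Proof.
move=> ve le' ne.
have [M M0 hM] : exists2 M : R, 0 < M & e = e' -> \forall s \near germ_nbhs d, s <= M.
  case: (germ_cases d) ve ne => [->|[b [t ->]]] ve ne.
    by exists 1 => // ee; case: ne.
  exists (`|t| + 1) => [|_]; first by have := normr_ge0 t; lra.
  apply: filterS (near_ray b t ltr01) => s; rewrite ltr_norml => /andP[_ h].
  by have := ler_norm t; lra.
have [u [uS uE uE']] := ramp_tropical le' M0.
pose N : int := `|k| + 1.
exists (fun x => (- N)%:~R * u x); split.
- exact: tropical_expr_mulz.
- have [ee|/eqP nee] := eqVneq e e'.
    by apply: filterS (hM ee) => s sM; rewrite ee uE max_l ?mulr0//; lra.
  by apply: nearW => s; rewrite uE' ?mulr0//; exact/eqP.
- apply/germ_nbhs_Inf; exists (Num.max M (`|c| + N%:~R * M)) => s.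
  rewrite gt_max => /andP[h1 h2]; rewrite uE max_r; last by lra.
  rewrite intrN mulNr lerN2.
  have kN : k%:~R <= N%:~R - 1 :> R.
    by rewrite /N intrD intr_norm addrK ler_norm.
  have h3 : k%:~R * s <= (N%:~R - 1) * s by rewrite ler_wpM2r//; lra.
  have := ler_norm c; lra.
Qed.

(** The ramp u at the first germ, truncated: min(0, u - 1) vanishes near infinity and
is -1 where the ramp vanishes. *)
Lemma separates_Inf_l e e' b t k c : len e = +oo%E -> valid_germ e' (ray b t) ->
  separates e Inf e' (ray b t) k c.
Proof.
move=> le ve'.
pose M : R := `|t| + 1.
have M0 : 0 < M by rewrite /M; have := normr_ge0 t; lra.
have [u [uS uE uE']] := ramp_tropical le M0.
have [N hN] := affine_bounded b t k c.
exists (fun x => (N%:Z)%:~R * Num.min 0 (u x - 1)); split.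
- apply: tropical_expr_mulz; apply: tropical_expr_min; first exact: tropical_expr_cst.
  by apply: tropical_expr_add => //; exact: tropical_expr_cst.
- apply/germ_nbhs_Inf; exists (M + 1) => s sM; rewrite uE max_r; last by lra.
  by rewrite min_l ?mulr0//; lra.
- apply: filterS2 hN (near_ray b t ltr01) => s h1; rewrite ltr_norml => /andP[_ h2].
  have -> : u (edge_pt e' s%:E) = 0.
    have [->|ne] := eqVneq e' e; last exact: uE'.
    by rewrite uE max_l// /M; have := ler_norm t; lra.
  by rewrite sub0r min_r ?mulrN1 ?lerN2//; lra.
Qed.

Definition out_slope e b t i : int :=
  if b then germ_slope_on (F i) e (ray b t) else - germ_slope_on (F i) e (ray b t).

Lemma generator_base e b t : valid_germ e (ray b t) ->
  exists2 r : R, 0 < r & forall rho, 0 <= rho -> rho < r -> forall i,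
    fine (F i (edge_pt e (ray_pt b t rho)%:E))
    = fine (F i (edge_pt e t%:E)) + (out_slope e b t i)%:~R * rho.
Proof.
move=> ve; have [c hc] := generators_affine ve.
move: hc => /germ_ray[r r0 hr]; exists r => // rho h1 h2 i.
have := hr rho h1 h2 i; have := hr 0 (lexx _) r0 i.
rewrite /out_slope /ray_pt addr0 subr0 if_same => -> ->.
by case: b {ve hr}; rewrite ?intrN; lra.
Qed.

Lemma generator_near i e b t (eps : R) : valid_germ e (ray b t) -> 0 < eps ->
  \forall s \near germ_nbhs (ray b t),
    `|fine (F i (edge_pt e s%:E)) - fine (F i (edge_pt e t%:E))| < eps.
Proof.
move=> ve e0; have [r r0 hr] := generator_base ve; set w := out_slope e b t i.
have w0 : 0 < `|w%:~R| + 1 :> R by have := normr_ge0 (w%:~R : R); lra.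
apply/germ_ray; exists (Num.min r (eps / (`|w%:~R| + 1))).
  by rewrite lt_min r0 divr_gt0.
move=> rho h1; rewrite lt_min => /andP[h2]; rewrite ltr_pdivlMr// => h3.
rewrite hr// -/w addrC addKr normrM (ger0_norm h1); apply: le_lt_trans h3.
by rewrite mulrC ler_wpM2l// lerDl.
Qed.

(** Some coordinate of phi differs at the two base points; truncate it between its
two values. *)
Lemma separates_far e b t e' b' t' k c : valid_germ e (ray b t) ->
  valid_germ e' (ray b' t') -> edge_pt e t%:E <> edge_pt e' t'%:E ->
  separates e (ray b t) e' (ray b' t') k c.
Proof.
move=> ve ve' ne.
have [i Fi] : exists i, fine (F i (edge_pt e t%:E)) <> fine (F i (edge_pt e' t'%:E)).
  apply/existsNP => E; apply: ne; apply: phi_inj_pt => //; exact: edge_pt_finite.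
set fx := fine (F i (edge_pt e t%:E)) in Fi *.
set fy := fine (F i (edge_pt e' t'%:E)) in Fi *.
(* eta is half the gap, so that 0 near x and at most - eta / 2 near y can both be met *)
pose eta := `|fx - fy| / 2.
have eta0 : 0 < eta by rewrite divr_gt0// normr_gt0 subr_eq0; apply/eqP.
have [sg sgE] : exists sg : int, sg%:~R * (fy - fx) = - (2 * eta) /\ (sg = 1 \/ sg = -1).
  have [h|h] := leP fx fy.
    exists (-1); split; last by right.
    by rewrite /eta ler0_norm ?subr_le0//; lra.
  exists 1; split; last by left.
  by rewrite /eta gtr0_norm ?subr_gt0//; lra.
have [sgE1 sg1] := sgE.
have sgle (v : R) : sg%:~R * v <= `|v| /\ - `|v| <= sg%:~R * v.
  have h1 := ler_norm v; have h2 := ler_norm (- v); rewrite normrN in h2.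
  by case: sg1 => ->; split; lra.
have [N0 hN0] := affine_bounded b' t' k c.
have [N hN] := nat_above (N0%:R / (eta / 2)).
exists (fun x => (N%:Z)%:~R * Num.min 0 (sg%:~R * (fine (F i x) - fx) + eta)); split.
- apply: tropical_expr_mulz; apply: tropical_expr_min; first exact: tropical_expr_cst.
  apply: tropical_expr_add; last exact: tropical_expr_cst.
  apply: tropical_expr_mulz; apply: tropical_expr_add; last exact: tropical_expr_cst.
  exact: tropical_expr_gen.
- apply: filterS (generator_near i ve eta0) => s; rewrite -/fx => h.
  rewrite min_l ?mulr0//.
  by have [_] := sgle (fine (F i (edge_pt e s%:E)) - fx); lra.
- have eta2 : 0 < eta / 2 by lra.
  apply: filterS2 hN0 (generator_near i ve' eta2) => s h1; rewrite -/fy => h2.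
  set v := fine _ in h2 *.
  have [h3 _] := sgle (v - fy).
  have h4 : sg%:~R * (v - fx) + eta <= - (eta / 2).
    have hE : sg%:~R * (v - fx) = sg%:~R * (v - fy) + sg%:~R * (fy - fx) by rewrite -mulrDr; congr (_ * _); lra.
    by rewrite hE sgE1; lra.
  apply: (@le_trans _ _ (N%:R * - (eta / 2))).
    by rewrite ler_wpM2l ?ler0n// ge_min h4 orbT.
  rewrite mulrN lerN2; apply: le_trans h1 _.
  by rewrite -ler_pdivrMr.
Qed.

(** At a common base point the correction has to vanish there, so only slopes matter.
Parallel slope vectors would give equal values of phi at two points of the germs
in a fixed ratio of distances. *)
Lemma separates_near e b t e' b' t' k c : valid_germ e (ray b t) ->
  valid_germ e' (ray b' t') -> edge_pt e t%:E = edge_pt e' t'%:E ->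
  ~ (e = e' /\ ray b t = ray b' t') -> k%:~R * t' + c = 0 ->
  separates e (ray b t) e' (ray b' t') k c.
Proof.
move=> ve ve' xy ne base0.
have [r r0 hr] := generator_base ve; have [r' r0' hr'] := generator_base ve'.
set w := out_slope e b t in hr; set w' := out_slope e' b' t' in hr'.
have wn : exists i, w i <> 0.
  have [i hi] := germ_slope_neq0 ve; exists i; rewrite /w /out_slope.
  by case: b ve hi {hr w ne} => /= ve hi; [|move=> /eqP; rewrite oppr_eq0 => /eqP].
have wn' : exists i, w' i <> 0.
  have [i hi] := germ_slope_neq0 ve'; exists i; rewrite /w' /out_slope.
  by case: b' ve' hi {hr' w' ne} => /= ve' hi; [|move=> /eqP; rewrite oppr_eq0 => /eqP].
have nonpar (p q : int) : 0 < p -> 0 < q -> ~ forall i, p * w i = q * w' i.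
  move=> p0 q0 par.
  have pR : 0 < p%:~R :> R by rewrite ltr0z.
  have qR : 0 < q%:~R :> R by rewrite ltr0z.
  (* points at distances p h and q h have the same image, hence coincide *)
  have [h0 h00 hh] : exists2 h0 : R, 0 < h0 & forall h, 0 < h -> h <= h0 ->
      e = e' /\ ray_pt b t (p%:~R * h) = ray_pt b' t' (q%:~R * h).
    have /germ_ray[r1 r10 hr1] := valid_germ_dom ve.
    have /germ_ray[r1' r10' hr1'] := valid_germ_dom ve'.
    pose m := Num.min (Num.min r r1) (Num.min r' r1').
    have m0 : 0 < m by rewrite !lt_min r0 r10 r0' r10'.
    have [mr mr1 mr' mr1'] : [/\ m <= r, m <= r1, m <= r' & m <= r1'].
      by rewrite /m !ge_min !lexx ?orbT.
    pose h0 := m / (2 * (p%:~R + q%:~R)).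
    have pq0 : 0 < 2 * (p%:~R + q%:~R) :> R by lra.
    exists h0; first by rewrite divr_gt0.
    move=> h hpos; rewrite /h0 ler_pdivlMr// => hm.
    have ph : 0 < p%:~R * h by exact: mulr_gt0.
    have qh : 0 < q%:~R * h by exact: mulr_gt0.
    have hle : 2 * (p%:~R * h) + 2 * (q%:~R * h) <= m by lra.
    have inside (e1 : edge Gamma) b1 t1 (r2 rho : R) : valid_germ e1 (ray b1 t1) ->
       (forall rho, 0 <= rho -> rho < r2 -> edge_dom e1 (ray_pt b1 t1 rho)) ->
       0 < rho -> 2 * rho < r2 ->
       0 < ray_pt b1 t1 rho /\ ((ray_pt b1 t1 rho)%:E < len e1)%E.
      move=> ve1 hd rho0 rho2; have [d0 d1] := hd (2 * rho) ltac:(lra) rho2.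
      have [v0 v1] := ray_valid_dom ve1.
      case: b1 {ve1 hd} d0 d1 => /= d0 d1; (split; first by lra).
        by apply: lt_le_trans d1; rewrite lte_fin; lra.
      by apply: lt_le_trans v1; rewrite lte_fin; lra.
    have [i1 i2] := inside e b t r1 (p%:~R * h) ve hr1 ph ltac:(lra).
    have [i3 i4] := inside e' b' t' r1' (q%:~R * h) ve' hr1' qh ltac:(lra).
    apply: edge_pt_interior_inj => //.
    apply: phi_inj_pt; [exact: edge_pt_finite|exact: edge_pt_finite|] => i.
    rewrite hr; [|lra|lra]; rewrite hr'; [|lra|lra]; rewrite xy; congr (_ + _).
    by rewrite !mulrA -!intrM [w i * p]mulrC par [q * _]mulrC.
  have [ee e1] := hh h0 h00 (lexx _).
  have [_ e2] := hh (h0 / 2) ltac:(lra) ltac:(lra).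
  apply: ne; split=> //.
  have P1 : 0 < p%:~R * h0 by exact: mulr_gt0.
  have Q1 : 0 < q%:~R * h0 by exact: mulr_gt0.
  rewrite !mulrA in e2; move: e1 e2; rewrite /ray_pt /ray.
  case: {+}b; case: {+}b' => e1 e2.
  - by congr Fwd; clear -P1 Q1 e1 e2; lra.
  - by exfalso; clear -P1 Q1 e1 e2; lra.
  - by exfalso; clear -P1 Q1 e1 e2; lra.
  - by congr Bwd; clear -P1 Q1 e1 e2; lra.
have [l [lw lw']] := integer_separation wn wn' nonpar.
pose x := edge_pt e t%:E.
pose kap : int := if b' then k else - k.
pose N := `|kap|.
pose L y := \sum_i (l i)%:~R * (fine (F i y) - fine (F i x)).
have L1 rho : 0 <= rho -> rho < r ->
    L (edge_pt e (ray_pt b t rho)%:E) = (\sum_i l i * w i)%:~R * rho.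
  move=> h1 h2; rewrite rmorph_sum/= mulr_suml; apply: eq_bigr => i _.
  by rewrite hr// [X in _ * X](_ : _ = (w i)%:~R * rho) ?intrM ?mulrA// /x; lra.
have L2 rho : 0 <= rho -> rho < r' ->
    L (edge_pt e' (ray_pt b' t' rho)%:E) = (\sum_i l i * w' i)%:~R * rho.
  move=> h1 h2; rewrite rmorph_sum/= mulr_suml; apply: eq_bigr => i _.
  by rewrite hr'// [X in _ * X](_ : _ = (w' i)%:~R * rho) ?intrM ?mulrA// /x xy; lra.
exists (fun y => N%:~R * Num.min 0 (L y)); split.
- apply: tropical_expr_mulz; apply: tropical_expr_min; first exact: tropical_expr_cst.
  apply: tropical_expr_sum => i; apply: tropical_expr_mulz.
  by apply: tropical_expr_add; [exact: tropical_expr_gen|exact: tropical_expr_cst].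
- apply/germ_ray; exists r => // rho h1 h2.
  by rewrite L1// min_l ?mulr0// mulr_ge0// ler0z.
- apply/germ_ray; exists r' => // rho h1 h2.
  rewrite L2//.
  have -> : k%:~R * ray_pt b' t' rho + c = kap%:~R * rho.
    by rewrite /kap /ray_pt; case: {+}b'; rewrite ?intrN; lra.
  have s1 : (\sum_i l i * w' i)%:~R * rho <= - rho.
    by rewrite -mulN1r ler_wpM2r// -[-1]/((-1)%:~R) ler_int; lia.
  have m1 : Num.min 0 ((\sum_i l i * w' i)%:~R * rho) <= - rho by rewrite ge_min s1 orbT.
  have N0 : 0 <= N%:~R :> R by rewrite ler0z normr_ge0.
  apply: le_trans (ler_wpM2l N0 m1) _; rewrite mulrN lerN2 ler_wpM2r//.
  by rewrite ler_int; exact: ler_norm.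
Qed.

(** Realise f on the first germ, then correct the excess on the second one by a
separating function. *)
Lemma germ_pair f e d e' d' : f <> ninfty -> valid_germ e d -> valid_germ e' d' ->
  exists u, [/\ tropical_expr F u,
    \forall s \near germ_nbhs d, u (edge_pt e s%:E) = on_edge f e s &
    \forall s \near germ_nbhs d', u (edge_pt e' s%:E) <= on_edge f e' s].
Proof.
move=> fN ve ve'.
have [k [c hf]] := rat_germ fN ve.
have [k' [c' hf']] := rat_germ fN ve'.
have [s [sS sA hs]] := germ_realize k c ve.
have sf : \forall r \near germ_nbhs d, s (edge_pt e r%:E) = on_edge f e r.
  by apply: filterS2 hs hf => r -> ->.
have [[ee dd]|ne] := pselect (e = e' /\ d = d').
  exists s; split=> //; rewrite -ee -dd; apply: filterS sf => r ->.
  exact: lexx.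
have [l [c2 hl]] := sA e' d' ve'.
suff [z [zS z0 zle]] : separates e d e' d' (l - k') (c2 - c').
  exists (fun x => s x + z x); split; first exact: tropical_expr_add.
    by apply: filterS2 sf z0 => r -> ->; rewrite addr0.
  apply: filterS3 hf' hl zle => r -> -> h.
  by move: h; rewrite intrB; lra.
case: (germ_cases d') ve' ne hl hf' => [->|[b' [t' ->]]] ve' ne hl hf'.
  exact: separates_Inf_r.
case: (germ_cases d) ve ne hs sf hf => [->|[b [t ->]]] ve ne hs sf hf.
  exact: separates_Inf_l.
have [xy|xy] := pselect (edge_pt e t%:E = edge_pt e' t'%:E); last exact: separates_far.
apply: separates_near => //.
have at_base b0 t0 (P : set R) : germ_nbhs (ray b0 t0) P -> P t0.
  move=> /germ_ray[r r0 /(_ 0 (lexx _) r0)].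
  by rewrite /ray_pt addr0 subr0 if_same.
have h1 := at_base _ _ _ sf; have h2 := at_base _ _ _ hl; have h3 := at_base _ _ _ hf'.
rewrite /= in h1 h2 h3; rewrite xy in h1; rewrite /on_edge xy in h1 h3.
by rewrite intrB; clear -h1 h2 h3; lra.
Qed.

(** Minima over a finite cover by germs. *)
Lemma germ_minorant f e d : f <> ninfty -> valid_germ e d ->
  exists u, [/\ tropical_expr F u,
    \forall s \near germ_nbhs d, u (edge_pt e s%:E) = on_edge f e s &
    forall x, finite_pt x -> u x <= fine (f x)].
Proof.
move=> fN ve.
pose I (Z : set (curve_point Gamma)) := exists u, [/\ tropical_expr F u,
    \forall s \near germ_nbhs d, u (edge_pt e s%:E) = on_edge f e s &
    forall x, Z x -> u x <= fine (f x)].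
suff [u [uS ue uZ]] : I [set x | finite_pt x] by exists u.
apply: (curve_ideal _ _ _ e) => [A B [u [uS ue uA]] [v [vS ve' vB]]|A B AB [u [uS ue uB]]|e' d' ved'].
- exists (fun x => Num.min (u x) (v x)); split; first exact: tropical_expr_min.
    by apply: filterS2 ue ve' => s -> ->; rewrite minxx.
  by move=> x [/uA h|/vB h]; rewrite ge_min h ?orbT.
- by exists u; split=> // x /AB /uB.
- have [u [uS ue uZ]] := germ_pair fN ve ved'.
  exists [set s | u (edge_pt e' s%:E) <= on_edge f e' s] => //.
  by exists u; split=> // _ [s h <-].
Qed.

Lemma no_edge_eq x y : (edge Gamma -> False) -> x = y.
Proof.
move=> ne; case: x => [v|p]; last by case: (ne (val p).1).
case: y => [v'|p]; last by case: (ne (val p).1).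
congr inl.
have /connectP[[|w q] /= path_p ->//] := graph_connected v v'.
by move: path_p => /andP[/existsP[e _]]; case: (ne e).
Qed.

(** Maxima over a finite cover by germs of the minorants of [germ_minorant]. *)
Theorem Rat_tropical_expr f : f <> ninfty -> tropical_expr F (fine \o f).
Proof.
move=> fN; have [[e0 _]|nex] := pselect (exists e : edge Gamma, True); last first.
  have [x0 _] := finite_pt_ex Gamma.
  apply: (tropical_expr_ext _ (tropical_expr_cst F (fine (f x0)))) => x _ /=.
  by rewrite (@no_edge_eq x x0)// => e; apply: nex; exists e.
pose I (Z : set (curve_point Gamma)) := exists u, [/\ tropical_expr F u,
    forall x, finite_pt x -> u x <= fine (f x) &
    forall x, finite_pt x -> Z x -> u x = fine (f x)].
suff [u [uS ue uZ]] : I [set x | finite_pt x].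
  by apply: tropical_expr_ext uS => x xf; exact: uZ.
apply: (curve_ideal _ _ _ e0) => [A B [u [uS ue uA]] [v [vS ve vB]]|A B AB [u [uS ue uB]]|e d ve].
- exists (fun x => Num.max (u x) (v x)); split; first exact: tropical_expr_max.
    by move=> x xf; rewrite ge_max ue// ve.
  move=> x xf [Ax|Bx]; first by rewrite uA// max_l// ve.
  by rewrite vB// max_r// ue.
- by exists u; split=> // x xf /AB; exact: uB.
- have [u [uS ue uZ]] := germ_minorant fN ve.
  exists [set s | u (edge_pt e s%:E) = on_edge f e s] => //.
  by exists u; split=> // _ _ [s h <-].
Qed.

End Separation.

(** * Burning, genus and subdivisions *)

Section Burning.
Variables (V S : finType) (a b : S -> V) (ch : V -> int).

(** The number of ends at [v] of segments that lead out of A, where the segments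
are the elements of S and [a], [b] give their ends; both ends of a loop count. *)
Definition outgoing (A : {set V}) (v : V) : nat :=
  (\sum_(x : S) ((a x == v) && (b x \notin A) + ((b x == v) && (a x \notin A))))%N.

Definition touching (A : {set V}) : nat :=
  (\sum_(x : S) ((a x \in A) || (b x \in A)))%N.

(** Remove from A a vertex with fewer chips than segments burning towards it, and
repeat: each segment that touches A burns once. *)
Lemma burning_bound (A : {set V}) :
  (forall B : {set V}, B \subset A -> B != finset.set0 ->
    exists2 v, v \in B & ch v < (outgoing B v)%:Z) ->
  \sum_(v in A) ch v <= (touching A)%:Z - #|A|%:Z.
Proof.
have [m] := ubnP #|A|; elim: m A => // m IHm A; rewrite ltnS => Am H.
have [->|A0] := eqVneq A finset.set0.
  rewrite big1 ?cards0 ?subr0// => v; by rewrite finset.inE.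
have [v vA chv] := H A (fintype.subxx _) A0.
have cA : #|A| = (#|A :\ v|).+1 by rewrite (cardsD1 v A) vA.
have {}IH : \sum_(u in A :\ v) ch u <= (touching (A :\ v))%:Z - #|A :\ v|%:Z.
  apply: IHm => [|B BA]; first by rewrite -ltnS -cA ltnS.
  by apply: H; exact: fintype.subset_trans BA (subsetDl _ _).
have T : (touching (A :\ v) + outgoing A v <= touching A)%N.
  rewrite /touching /outgoing -big_split/=; apply: leq_sum => x _.
  rewrite !finset.inE; case: (eqVneq (a x) v) => [->|_]; case: (eqVneq (b x) v) => [->|_];
    rewrite ?vA ?orbT ?orbF //=; by do 2?case: (_ \in A).
rewrite (big_setD1 v)//= cA; move: chv IH T. set x := \sum_(_ in _) _; set t0 := touching A; set t1 := touching _; set o := outgoing _ _; set y := #|pred_of_set _|; lia.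
Qed.

End Burning.

(** The rows of the boundary matrix have sum zero, so its rank is less than the number
of vertices. *)
Lemma genus_ge (G : graph) : (#|edge G|%:Z - #|vertex G|%:Z + 1 <= (genus G)%:Z)%R.
Proof.
have rk : (\rank (boundary G) + 1 <= #|vertex G|)%N.
  have one_rk : \rank (const_mx 1 : 'cV[rat]_#|vertex G|) = 1%N.
    apply/eqP; rewrite eqn_leq rank_leq_col lt0n mxrank_eq0.
    apply/eqP => /matrixP/(_ (Ordinal (graph_nonempty G)) ord0).
    by rewrite !mxE.
  rewrite -[1%N]one_rk; apply: mulmx0_rank_max; apply/matrixP => i j.
  rewrite !mxE; under eq_bigr do rewrite !mxE mulr1.
  rewrite sumrB; apply/eqP; rewrite subr_eq0; apply/eqP.
  have one (v : vertex G) : \sum_(k < #|vertex G|) ((v == enum_val k)%:R : rat) = 1.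
    rewrite (bigD1 (enum_rank v))//= enum_rankK eqxx big1 ?addr0// => k kv.
    case: (eqVneq v (enum_val k)) kv => [->|_ _]; last by rewrite mulr0n.
    by rewrite enum_valK eqxx.
  by rewrite !one.
rewrite /genus mxrank_ker; move: rk (rank_leq_row (boundary G)); lia.
Qed.

Section Segments.
Variables (R : realType) (Gamma : tropical_curve R) (s : seq (inner_point Gamma)).
Implicit Types (e : edge Gamma) (f : Rat_of Gamma).
Local Notation ninfty := (Rat_ninfty Gamma).

Local Notation P := (seq_sub s).
(** A finite set [s] of inner points cuts the edges into segments.  A segment is
named by the point where it starts, an edge standing for its first segment.  Ends
of segments are indexed by the same type, an edge standing for its own end, and
[nxt] sends the start of a segment to its end; being injective, it is a bijection,
which makes sums over starts and over ends interchangeable. *)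
Definition seg : finType := (edge Gamma + P)%type.
Definition node : finType := (vertex Gamma + P)%type.

Implicit Types x y : seg.

Definition node_pt (v : node) : curve_point Gamma :=
  match v with inl v => inl v | inr p => inr (val p) end.

Lemma node_pt_inj : injective node_pt.
Proof.
move=> [v|p] [w|q] //= []; first by move=> ->.
by move=> /val_inj ->.
Qed.

Definition pos (p : P) : edge Gamma * R := val (val p).
Definition seg_start (x : seg) : edge Gamma * R :=
  match x with inl e => (e, 0) | inr p => pos p end.
Definition seg_end (x : seg) : edge Gamma * \bar R :=
  match x with inl e => (e, len e) | inr p => ((pos p).1, (pos p).2%:E) end.
Definition start_node (x : seg) : node :=
  match x with inl e => inl (src e) | inr p => inr p end.
Definition end_node (x : seg) : node :=
  match x with inl e => inl (tgt e) | inr p => inr p end.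

Definition after (x : seg) : pred P :=
  fun p => ((pos p).1 == (seg_start x).1) && ((seg_start x).2 < (pos p).2).
Definition nxt (x : seg) : seg :=
  if [pick p | after x p] is Some p0 then inr [arg min_(p < p0 | after x p) (pos p).2]%O
  else inl (seg_start x).1.

Lemma pos_bounds (p : P) : 0 < (pos p).2 /\ ((pos p).2%:E < len (pos p).1)%E.
Proof. by have /andP := valP (val p). Qed.

Lemma seg_start_dom x : 0 <= (seg_start x).2 /\ ((seg_start x).2%:E < len (seg_start x).1)%E.
Proof.
case: x => [e|p] /=; first by rewrite len_gt0.
by have [p0 pl] := pos_bounds p; split=> //; exact: ltW.
Qed.

Lemma nxtP x : [/\ (seg_end (nxt x)).1 = (seg_start x).1,
  ((seg_start x).2%:E < (seg_end (nxt x)).2)%E &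
  forall p, (pos p).1 = (seg_start x).1 -> (seg_start x).2 < (pos p).2 ->
    ((seg_end (nxt x)).2 <= (pos p).2%:E)%E].
Proof.
rewrite /nxt; case: pickP => [p0 p0x|none] /=.
  case: arg_minP => // p /andP[/eqP pe px] pmin; split=> // q qe qx.
  by rewrite lee_fin; apply: pmin; rewrite /after qe eqxx.
split=> //; first by have [] := seg_start_dom x.
by move=> p pe px; have := none p; rewrite /after pe eqxx px.
Qed.

Lemma seg_end_len x : ((seg_end x).2 <= len (seg_end x).1)%E.
Proof. by case: x => [e|p] //=; have [_ /ltW] := pos_bounds p. Qed.

Lemma seg_start_inj : injective seg_start.
Proof.
move=> [e|p] [e'|q] //=.
- by move=> [->].
- by move=> E; have [] := pos_bounds q; rewrite -E ltxx.
- by move=> E; have [] := pos_bounds p; rewrite E ltxx.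
- by move=> /val_inj/val_inj ->.
Qed.

Let nxt_inj_lt x y : nxt x = nxt y -> (seg_start x).2 < (seg_start y).2 -> False.
Proof.
move=> xy lt; have [ex tx nx] := nxtP x; have [ey ty ny] := nxtP y.
case: y xy lt ey ty ny => [e|p] xy lt ey ty ny.
  by have [x0 _] := seg_start_dom x; move: lt; rewrite /= ltNge x0.
have := nx p; rewrite -ex xy ey => /(_ erefl lt).
by rewrite leNgt ty.
Qed.

(** Two segments of an edge with the same end have the same start, as otherwise the
later start would cut the other segment. *)
Lemma nxt_inj : injective nxt.
Proof.
move=> x y xy; apply: seg_start_inj.
have [ex _ _] := nxtP x; have [ey _ _] := nxtP y.
have e1 : (seg_start x).1 = (seg_start y).1 by rewrite -ex xy ey.
have e2 : (seg_start x).2 = (seg_start y).2.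
  have [lt|lt|//] := ltgtP (seg_start x).2 (seg_start y).2.
    by case: (nxt_inj_lt xy lt).
  by case: (nxt_inj_lt (esym xy) lt).
by move: e1 e2; case: (seg_start x); case: (seg_start y) => ? ? ? ? /= -> ->.
Qed.

Definition prv : seg -> seg := invF nxt_inj.
Lemma nxtK x : prv (nxt x) = x. Proof. exact: invF_f. Qed.
Lemma prvK x : nxt (prv x) = x. Proof. exact: f_invF. Qed.

Lemma card_node_seg : (#|seg| + #|vertex Gamma| = #|node| + #|edge Gamma|)%N.
Proof. by rewrite !card_sum; lia. Qed.

Definition seg_end_germ (x : seg) : germ R :=
  match x with inl e => end_germ e | inr p => Bwd (pos p).2 end.

Lemma seg_end_germ_valid x : valid_germ (seg_end x).1 (seg_end_germ x).
Proof.
case: x => [e|p] /=; first exact: end_germ_valid.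
by have [p0 /ltW] := pos_bounds p.
Qed.

Lemma sum_ord_node f : f <> ninfty ->
  \sum_v ord f (node_pt v)
  = \sum_x germ_slope_on f (seg_start x).1 (Fwd (seg_start x).2)
  - \sum_x germ_slope_on f (seg_end x).1 (seg_end_germ x).
Proof.
move=> fN; rewrite !big_sumType.
have -> : \sum_(v : vertex Gamma) ord f (node_pt (inl v)) =
    \sum_e germ_slope_on f e (Fwd 0) - \sum_e germ_slope_on f e (end_germ e).
  rewrite (partition_big src xpredT)// [X in _ = _ - X](partition_big tgt xpredT)//.
  by rewrite -sumrB; apply: eq_bigr => v _; rewrite -ord_inl.
have -> : \sum_(p : P) ord f (node_pt (inr p)) =
    \sum_p germ_slope_on f (pos p).1 (Fwd (pos p).2)
    - \sum_p germ_slope_on f (pos p).1 (Bwd (pos p).2).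
  by rewrite -sumrB; apply: eq_bigr => p _; rewrite -ord_inr.
by rewrite opprD addrACA.
Qed.

End Segments.

(** * The degree of a principal divisor *)

Section Degree.
Variables (R : realType) (Gamma : tropical_curve R).
Implicit Types (e : edge Gamma) (f : Rat_of Gamma).
Local Notation ninfty := (Rat_ninfty Gamma).

Lemma deg_nodes (s : seq (inner_point Gamma)) (D : divisor Gamma) :
  (forall p, coeff (inr p) D != 0 -> p \in s) ->
  deg D = \sum_(v : node s) coeff (node_pt v) D.
Proof.
move=> hs.
have DE : D = \sum_(v : node s) << coeff (node_pt v) D *g node_pt v >>.
  apply/eqP/freeg_eqP => x; rewrite raddf_sum/=.
  under eq_bigr do rewrite coeffU.
  have [x0|x0] := eqVneq (coeff x D) 0.
    rewrite x0 big1// => v _; have [->|_] := eqVneq (node_pt v) x; last by rewrite mulr0.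
    by rewrite x0 mul0r.
  have [v vx] : exists v : node s, node_pt v = x.
    case: x x0 => [v _|p /hs ps]; first by exists (inl v).
    by exists (inr (SeqSub ps)).
  rewrite (bigD1 v)//= vx eqxx mulr1 big1 ?addr0// => w wv.
  by rewrite -vx (inj_eq (@node_pt_inj _ _ s)) (negbTE wv) mulr0.
by rewrite {1}DE raddf_sum/=; apply: eq_bigr => v _; rewrite degU.
Qed.

(** The subdivisions used: they contain the inner support of a divisor, and given
points and break points. *)
Lemma inner_points_ex (D : divisor Gamma) (u : edge Gamma -> seq R) (q : seq (curve_point Gamma)) :
  exists s : seq (inner_point Gamma), [/\ forall p, coeff (inr p) D != 0 -> p \in s,
  (forall p, inr p \in q -> p \in s) &
  forall p, (val p).2 \in u (val p).1 -> p \in s].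
Proof.
pose inner (x : curve_point Gamma) : option (inner_point Gamma) :=
  match x with inr p => Some p | _ => None end.
exists (pmap inner (q ++ dom D) ++
  flatten [seq pmap insub [seq (e, t) | t <- u e] | e <- enum {: edge Gamma}]).
split=> [p pD|p qp|p pu]; rewrite mem_cat.
- by apply/orP; left; rewrite mem_pmap; apply/mapP; exists (inr p) => //; rewrite mem_cat mem_dom pD orbT.
- by apply/orP; left; rewrite mem_pmap; apply/mapP; exists (inr p) => //; rewrite mem_cat qp.
- apply/orP; right; apply/flatten_mapP; exists (val p).1; first by rewrite mem_enum.
  rewrite mem_pmap_sub; apply/mapP; exists (val p).2 => //.
  by case: (val p).
Qed.

(** The formula on the open interval between [a] and [b] determines the slope along
a germ that lies in the closed interval. *)
Lemma germ_slope_on_open f e d (a : R) (b : \bar R) (k : int) (c : R) :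
  f <> ninfty -> valid_germ e d ->
  germ_nbhs d [set s : R | a <= s /\ (s%:E <= b)%E] ->
  (forall s : R, a < s -> (s%:E < b)%E -> on_edge f e s = k%:~R * s + c) ->
  germ_slope_on f e d = k.
Proof.
move=> fN ve dab hk; have [c' hc'] := germ_slope_on_affine fN ve.
have [x [y [xy h]]] := germ_nbhs_itv (filterI hc' dab).
have inside s : (3 * x + y) / 4 < s < (x + 3 * y) / 4 -> 
    (germ_slope_on f e d)%:~R * s + c' = k%:~R * s + c.
  move=> /andP[s1 s2].
  have [<- _] := h s ltac:(apply/andP; split; lra).
  have [_ [ax _]] := h ((3 * x + y) / 4) ltac:(apply/andP; split; lra).
  have [_ [_ yb]] := h ((x + 3 * y) / 4) ltac:(apply/andP; split; lra).
  by apply: hk; [exact: le_lt_trans ax s1|apply: lt_le_trans yb; rewrite lte_fin].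
have := @affine_unique R (Fwd ((x + y) / 2)) (germ_slope_on f e d) k c' c.
case=> //; apply/germ_nbhs_Fwd; exists ((y - x) / 4) => [|s s1 s2]; first by lra.
by apply: inside; apply/andP; split; lra.
Qed.

(** Subdivide at the break points: on each segment the slopes at both ends cancel. *)
Lemma principal_divisor_deg f : f <> ninfty -> deg (div f) = 0.
Proof.
move=> fN.
have /choice[u hu] e := on_edge_piecewise e fN.
have [s [hs _ us]] := inner_points_ex (div f) u [::].
rewrite (deg_nodes hs).
under eq_bigr do rewrite coeff_div.
rewrite sum_ord_node//; apply/eqP; rewrite subr_eq0; apply/eqP.
rewrite [RHS](reindex_inj (@nxt_inj _ _ s)); apply: eq_bigr => x _.
have [x0 xl] := seg_start_dom x; have [ex tx nx] := nxtP x.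
have xlen : ((seg_end (nxt x)).2 <= len (seg_start x).1)%E by rewrite -ex; exact: seg_end_len.
set e := (seg_start x).1 in ex nx xl xlen *; set a := (seg_start x).2 in x0 xl tx nx *.
have [k [c hk]] : affine_on a (seg_end (nxt x)).2 (EFin \o on_edge f e).
  apply: (hu e) => // t tu [at_ tb].
  have t0 : 0 < t by exact: le_lt_trans at_.
  have [p [vp _]] := edge_pt_inr t0 (lt_le_trans tb xlen).
  have ps : p \in s by apply: us; rewrite vp.
  have := nx (SeqSub ps); rewrite /pos /= vp => /(_ erefl at_).
  by rewrite leNgt tb.
have {}hk t : a < t -> (t%:E < (seg_end (nxt x)).2)%E -> on_edge f e t = k%:~R * t + c.
  by move=> h1 h2; have [] := hk t h1 h2.
have ve := seg_end_germ_valid (nxt x).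
rewrite (@germ_slope_on_open f e (Fwd a) a (seg_end (nxt x)).2 k c)//; last first.
  apply/germ_nbhs_Fwd; case: (seg_end _).2 tx => [r||] // tx.
    rewrite lte_fin in tx; exists (r - a) => [|t t1 t2]; first by lra.
    by rewrite /= lee_fin; split; lra.
  by exists 1 => // t t1 _; rewrite /= leey.
rewrite ex; rewrite ex in ve; apply/esym.
apply: (@germ_slope_on_open f e _ a (seg_end (nxt x)).2 k c) => //.
have gE : seg_end_germ (nxt x) = if (seg_end (nxt x)).2 is r%:E then Bwd r else Inf.
  by case: (nxt x).
rewrite gE; case: (seg_end _).2 tx => [r||] // tx.
  rewrite lte_fin in tx; apply/germ_nbhs_Bwd; exists (r - a) => [|t t1 t2]; first by lra.
  by rewrite /= lee_fin; split; lra.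
by apply/germ_nbhs_Inf; exists a => t t1; rewrite /= leey; split=> //; exact: ltW.
Qed.

End Degree.

(** * Firing functions *)

Section Firing.
Variables (R : realType) (Gamma : tropical_curve R) (s : seq (inner_point Gamma)).
Variable A : {set node s}.
Implicit Types (e : edge Gamma) (f : Rat_of Gamma) (x y : seg s) (v : node s) (t r : R).
Local Notation ninfty := (Rat_ninfty Gamma).

Lemma gap_ex (L : seq R) : exists2 eps : R, 0 < eps &
  forall t r, t \in L -> r \in L -> t != r -> eps <= `|t - r|.
Proof.
elim: L => [|z L [eps e0 hL]]; first by exists 1.
have [d d0 hd] := fin_sep L z.
exists (Num.min eps d); first by rewrite lt_min e0.
move=> t r; rewrite !inE ge_min => /predU1P[->|tL] /predU1P[->|rL] tr.
- by rewrite eqxx in tr.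
- by rewrite distrC (hd r rL) ?orbT// eq_sym.
- by rewrite (hd t tL) ?orbT.
- by rewrite hL.
Qed.

Definition node_param e t : Prop :=
  t = 0 \/ len e = t%:E \/ exists p : seq_sub s, pos p = (e, t).

(** Firing by at most this amount does not reach from one node to another along an
edge. *)
Lemma node_gap : exists2 eps : R, 0 < eps &
  forall e t r, node_param e t -> node_param e r -> t <> r -> eps <= `|t - r|.
Proof.
pose L := 0 :: [seq fine (len e) | e <- enum {: edge Gamma}]
            ++ [seq (pos p).2 | p <- enum {: seq_sub s}].
have [eps e0 hL] := gap_ex L; exists eps => // e t r.
suff inL u : node_param e u -> u \in L.
  by move=> /inL tL /inL rL /eqP; exact: hL.
rewrite /L inE mem_cat => -[->|[eu|[p pE]]]; first by rewrite eqxx.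
  apply/orP; right; apply/orP; left; apply/mapP; exists e; first by rewrite mem_enum.
  by rewrite eu.
apply/orP; right; apply/orP; right; apply/mapP; exists p; first by rewrite mem_enum.
by rewrite pE.
Qed.

Definition fired_at e t : Prop := exists2 v, v \in A & node_pt v = edge_pt e t%:E.

Lemma start_node_pt x : node_pt (start_node x) = edge_pt (seg_start x).1 (seg_start x).2%:E.
Proof. by case: x => [e|p] /=; [rewrite edge_pt_src|rewrite inr_edge_pt]. Qed.

Lemma end_node_pt x r : (seg_end x).2 = r%:E ->
  node_pt (end_node x) = edge_pt (seg_end x).1 r%:E.
Proof.
case: x => [e|p] /= E; first by rewrite edge_pt_tgt// E.
by rewrite -E inr_edge_pt.
Qed.

Lemma start_node_param x : node_param (seg_start x).1 (seg_start x).2.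
Proof. by case: x => [e|p] /=; [left|right; right; exists p; case: (pos p)]. Qed.

Lemma end_node_param x r : (seg_end x).2 = r%:E -> node_param (seg_end x).1 r.
Proof.
case: x => [e|p] /= E; first by right; left.
by right; right; exists p; case: (pos p) E => a b /= [->].
Qed.

Lemma node_param_dom e t : node_param e t -> edge_dom e t.
Proof.
move=> [->|[et|[p pE]]].
- by split=> //; exact/ltW/len_gt0.
- by split; rewrite ?et// -lee_fin -et; exact/ltW/len_gt0.
- have [] := pos_bounds p; rewrite pE /= => h1 h2; split; exact: ltW.
Qed.

(** The firing function of A is eps minus the distance to A, cut off at 0, where the
segments with both ends in A belong to A.  An unbounded segment counts as
contained in A as soon as it starts in A; a segment with one end in A
contributes that end only. *)
Definition fired_part x : option (R * \bar R) :=
  let t := (seg_start x).2 in let t' := (seg_end (nxt x)).2 in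
  if start_node x \in A then
    Some (t, if (end_node (nxt x) \in A) || (t' == +oo%E) then t' else t%:E)
  else if end_node (nxt x) \in A then
    if t' is r%:E then Some (r, r%:E) else None
  else None.

Lemma fired_partP x (a : R) (b : \bar R) : fired_part x = Some (a, b) ->
  [/\ (seg_start x).2 <= a, (b <= (seg_end (nxt x)).2)%E, (a%:E <= b)%E,
      node_param (seg_start x).1 a /\ fired_at (seg_start x).1 a &
      forall r, b = r%:E -> node_param (seg_start x).1 r /\ fired_at (seg_start x).1 r].
Proof.
have [ex tx _] := nxtP x; rewrite /fired_part.
have fs : start_node x \in A -> node_param (seg_start x).1 (seg_start x).2 /\
     fired_at (seg_start x).1 (seg_start x).2.
  by move=> sA; split; [exact: start_node_param|exists (start_node x) => //; exact: start_node_pt].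
have fe r : end_node (nxt x) \in A -> (seg_end (nxt x)).2 = r%:E ->
     node_param (seg_start x).1 r /\ fired_at (seg_start x).1 r.
  move=> eA E; rewrite -ex; split; first exact: end_node_param.
  by exists (end_node (nxt x)) => //; exact: end_node_pt.
case: ifPn => [sA [<- <-]|sA].
  case: ifPn => [|_]; last first.
    split=> //; [exact: ltW|exact: fs|by move=> r [<-]; exact: fs].
  move=> /orP[eA|/eqP oo]; split=> //; try exact: ltW; try exact: fs.
    by move=> r E; exact: fe.
  by move=> r E; move: oo; rewrite E.
case: ifPn => // eA; case E: (seg_end (nxt x)).2 => [r||]// -[<- <-].
rewrite E in tx; split=> //; [by rewrite -lee_fin ltW|exact: fe|].
by move=> _ [<-]; exact: fe.
Qed.

Variable eps : R.
Hypothesis eps0 : 0 < eps.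
Hypothesis eps_gap : forall e t r, node_param e t -> node_param e r -> t <> r -> eps <= `|t - r|.

(** eps minus the distance to the interval from [a] to [b]; the interval may be
unbounded. *)
Definition plateau (a : R) (b : \bar R) (t : R) : R :=
  eps + (- Num.max 0 (a + - t) + - (if b is r%:E then Num.max 0 (t + - r) else 0)).

Definition seg_fire x (t : R) : R :=
  if fired_part x is Some ab then plateau ab.1 ab.2 t else 0.

Definition edge_fire e (t : R) : R :=
  \big[Num.max/0]_(x : seg s) (if (seg_start x).1 == e then seg_fire x t else 0).

Lemma plateau_le a b t : plateau a b t <= eps.
Proof.
rewrite /plateau; have m1 : 0 <= Num.max 0 (a + - t) by rewrite le_max lexx.
case: b => [r||]; try lra.
have m2 : 0 <= Num.max 0 (t + - r) by rewrite le_max lexx.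
lra.
Qed.

Lemma plateau_in a b t : a <= t -> (t%:E <= b)%E -> plateau a b t = eps.
Proof.
move=> at_ tb; rewrite /plateau max_l; last by lra.
case: b tb => [r||]; try lra.
by rewrite lee_fin => tr; rewrite max_l; lra.
Qed.

Lemma plateau_left a b t : t <= a -> (a%:E <= b)%E -> plateau a b t = eps - (a - t).
Proof.
move=> ta ab; rewrite /plateau max_r; last by lra.
case: b ab => [r||]; try lra.
by rewrite lee_fin => ar; rewrite max_l; lra.
Qed.

Lemma plateau_right a r t : a <= r -> r <= t -> plateau a r%:E t = eps - (t - r).
Proof. by move=> ar rt; rewrite /plateau max_l ?max_r; lra. Qed.

Lemma edge_fire_ge0 e t : 0 <= edge_fire e t. Proof. exact: bigmax_ge_id. Qed.

Lemma edge_fire_le e t : edge_fire e t <= eps.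
Proof.
apply: bigmax_le => [|x _]; first exact: ltW.
case: ifP => _; last exact: ltW.
rewrite /seg_fire; case: (fired_part x) => [ab|]; [exact: plateau_le|exact: ltW].
Qed.

Lemma edge_fire_ge x t : seg_fire x t <= edge_fire (seg_start x).1 t.
Proof.
apply: le_trans (le_bigmax _ _ x).
by rewrite eqxx.
Qed.

Lemma edge_fire_attained e t : 0 < edge_fire e t ->
  exists2 x, (seg_start x).1 = e & seg_fire x t = edge_fire e t.
Proof.
suff [->|[x E]] : edge_fire e t = 0 \/ exists x, edge_fire e t =
    if (seg_start x).1 == e then seg_fire x t else 0.
- by rewrite ltxx.
- by rewrite {1}E; case: eqP E => [xe E _|]; [exists x|rewrite ltxx].
rewrite /edge_fire; elim/big_ind : _ => [|a b Ha Hb|x _]; first by left.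
  by case: (leP a b).
by right; exists x.
Qed.

Lemma node_param_seg x t : node_param (seg_start x).1 t ->
  t <= (seg_start x).2 \/ ((seg_end (nxt x)).2 <= t%:E)%E.
Proof.
have [x0 _] := seg_start_dom x; have [ex tx nx] := nxtP x.
move=> [->|[et|[p pE]]]; first by left.
  by right; rewrite -et -ex; exact: seg_end_len.
have [tp|tp] := leP t (seg_start x).2; first by left.
by right; have := nx p; rewrite pE; apply.
Qed.

(** A node outside A is separated from A along the edge by a distance of at least eps. *)
Lemma edge_fire_out e t : node_param e t -> ~ fired_at e t -> edge_fire e t = 0.
Proof.
move=> nt nA; apply/le_anti; rewrite edge_fire_ge0 andbT.
apply: bigmax_le => // x _; case: eqP => // xe; subst e.
rewrite /seg_fire; case fE: (fired_part x) => [[a b]|] //=.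
have [sa bt ab [na fa] fb] := fired_partP fE.
have [tx|tx] := node_param_seg nt.
  have ta : t <= a by lra.
  rewrite plateau_left//.
  have tna : t <> a by move=> ta'; apply: nA; rewrite ta'.
  by have := eps_gap nt na tna; rewrite ler0_norm; lra.
case: b bt ab fb {fE} => [r||] bt ab fb //.
  have [nr fr] := fb r erefl.
  have tnr : t <> r by move=> tr; apply: nA; rewrite tr.
  have rt : r <= t by rewrite -lee_fin; exact: le_trans bt tx.
  rewrite lee_fin in ab; rewrite plateau_right//.
  by have := eps_gap nt nr tnr; rewrite ger0_norm; lra.
by have := le_trans bt tx.
Qed.

Lemma edge_fire_plateau x a b t : fired_part x = Some (a, b) -> a <= t -> (t%:E <= b)%E ->
  edge_fire (seg_start x).1 t = eps.
Proof.
move=> fE at_ tb; apply/le_anti; rewrite edge_fire_le/=.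
by apply: le_trans (edge_fire_ge x t); rewrite /seg_fire fE /= plateau_in.
Qed.

Lemma fired_part_start x : start_node x \in A -> exists2 b, fired_part x = Some ((seg_start x).2, b) &
  ((seg_start x).2%:E <= b)%E.
Proof.
rewrite /fired_part => ->; set b := (if _ then _ else _); exists b => //.
by rewrite /b; case: ifP => // _; have [_ /ltW] := nxtP x.
Qed.

Lemma edge_fire_in e t : node_param e t -> fired_at e t -> edge_fire e t = eps.
Proof.
move=> nt [v vA vE].
have start x : seg_start x = (e, t) -> edge_fire e t = eps.
  move=> xE; have sA : start_node x \in A.
    suff -> : start_node x = v by [].
    by apply: (@node_pt_inj _ _ s); rewrite start_node_pt xE vE.
  have [b fE tb] := fired_part_start sA.
  by have := edge_fire_plateau fE (lexx _) tb; rewrite xE.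
case: nt => [t0|[et|[p pE]]]; [|move: start => _|].
- by apply: (start (inl e)); rewrite t0.
- pose x := prv (inl e : seg s).
  have nx : nxt x = inl e by rewrite prvK.
  have eA : end_node (nxt x) \in A.
    suff -> : end_node (nxt x) = v by [].
    by apply: (@node_pt_inj _ _ s); rewrite (@end_node_pt _ t) nx//= et.
  have [ex tx _] := nxtP x; rewrite nx/= in ex tx; rewrite et lte_fin in tx.
  have [a fE] : exists2 a, fired_part x = Some (a, t%:E) & a <= t.
    rewrite /fired_part eA nx /= et; case: ifP => _; last by exists t.
    by exists (seg_start x).2 => //; exact: ltW.
  by move=> ta; have := edge_fire_plateau fE ta (lexx _); rewrite -ex.
- exact: (start (inr p)).
Qed.

Lemma pl_edge_fire e : pl_on (len e) (edge_fire e).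
Proof.
apply: pl_bigmax; first exact: len_gt0.
move=> x; case: eqP => _; last exact: pl_cst.
rewrite /seg_fire; case: (fired_part x) => [[a b]|]; last exact: pl_cst.
apply: pl_add; first exact: pl_cst.
apply: pl_add; apply: pl_opp.
  apply: pl_max; [exact: len_gt0|exact: pl_cst|].
  by apply: pl_add; [exact: pl_cst|exact: pl_opp_id].
case: b => [r||]; [|exact: pl_cst|exact: pl_cst].
apply: pl_max; [exact: len_gt0|exact: pl_cst|].
by apply: pl_add; [exact: pl_id|exact: pl_cst].
Qed.

Lemma fired_at_node e t v : node_pt v = edge_pt e t%:E ->
  fired_at e t <-> v \in A.
Proof.
move=> vE; split=> [[w wA]|vA]; last by exists v.
by rewrite -vE => /(@node_pt_inj _ _ s) <-.
Qed.

Definition is_firing f : Prop := [/\ f <> ninfty,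
  forall e t, edge_dom e t -> on_edge f e t = edge_fire e t &
  forall w : vertex Gamma, finite_pt (inl w : curve_point Gamma) ->
    f (inl w) = (if (inl w : node s) \in A then eps else 0)%:E].

Lemma is_firing_ex : exists f, is_firing f.
Proof.
apply: rat_of_pl.
- exact: pl_edge_fire.
- move=> e; have n0 : node_param e 0 by left.
  have vE : node_pt (inl (src e) : node s) = edge_pt e 0%:E by rewrite edge_pt_src.
  have := fired_at_node vE.
  case: ifP => [vA|vA] [_ h2]; first by apply: edge_fire_in => //; exact: h2.
  by apply: edge_fire_out => // /(fired_at_node vE); rewrite vA.
- move=> e l el; have nl : node_param e l by right; left.
  have vE : node_pt (inl (tgt e) : node s) = edge_pt e l%:E by rewrite edge_pt_tgt// el.
  have := fired_at_node vE.
  case: ifP => [vA|vA] [_ h2]; first by apply: edge_fire_in => //; exact: h2.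
  by apply: edge_fire_out => // /(fired_at_node vE); rewrite vA.
Qed.

Section Properties.
Variable f : Rat_of Gamma.
Hypothesis firing_f : is_firing f.

Let fN : f <> ninfty. Proof. by case: firing_f. Qed.
Let fE e t : edge_dom e t -> on_edge f e t = edge_fire e t.
Proof. by case: firing_f => _ + _; apply. Qed.

Lemma firing_node v : finite_pt (node_pt v) ->
  f (node_pt v) = (if v \in A then eps else 0)%:E.
Proof.
case: v => [w|p] vf; first by case: firing_f => _ _; apply.
have np : node_param (pos p).1 (pos p).2 by right; right; exists p; case: (pos p).
have vE : node_pt (inr p : node s) = edge_pt (pos p).1 (pos p).2%:E by rewrite -inr_edge_pt.
have fa := fired_at_node vE.
rewrite vE on_edgeE// fE; last exact: node_param_dom.
case: ifP => pA; first by rewrite edge_fire_in//; exact/fa.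
by rewrite edge_fire_out// => /fa; rewrite pA.
Qed.

Lemma firing_ge0 z : finite_pt z -> (0 <= f z)%E.
Proof.
move: z; apply: finite_ptP => [e t te|w wf].
  by rewrite on_edgeE// fE// lee_fin edge_fire_ge0.
by rewrite (@firing_node (inl w))// lee_fin; case: ifP => // _; exact: ltW.
Qed.

(** Slope 0 if the segment stays in A, and slope -1 at worst otherwise. *)
Lemma firing_slope_start x : start_node x \in A ->
  - (end_node (nxt x) \notin A)%:Z <= germ_slope_on f (seg_start x).1 (Fwd (seg_start x).2).
Proof.
move=> sA; have [x0 xl] := seg_start_dom x; have [ex tx _] := nxtP x.
have vF : valid_germ (seg_start x).1 (Fwd (seg_start x).2) by [].
have base : on_edge f (seg_start x).1 (seg_start x).2 = eps.
  rewrite fE; last by split=> //; exact: ltW.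
  have [b fp tb] := fired_part_start sA.
  exact: edge_fire_plateau fp (lexx _) tb.
apply: germ_slope_Fwd_ge => //; rewrite base.
have near_seg : \forall t \near germ_nbhs (Fwd (seg_start x).2),
    [/\ (seg_start x).2 <= t, (t%:E <= (seg_end (nxt x)).2)%E & edge_dom (seg_start x).1 t].
  have h : germ_nbhs (Fwd (seg_start x).2) [set t | (seg_start x).2 <= t /\ (t%:E <= (seg_end (nxt x)).2)%E].
    apply/germ_nbhs_Fwd; case: (seg_end _).2 tx => [r||] // tx.
      rewrite lte_fin in tx; exists (r - (seg_start x).2) => [|t t1 t2]; first by lra.
      by rewrite /= lee_fin; split; lra.
    by exists 1 => // t t1 _; rewrite /= leey.
  by apply: filterS2 h (valid_germ_dom vF) => t [h1 h2] h3.
apply: filterS near_seg => t [t1 t2 td]; rewrite fE//.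
case eA: (end_node (nxt x) \in A) => /=.
  by rewrite oppr0 mul0r addr0 (@edge_fire_plateau x (seg_start x).2 (seg_end (nxt x)).2 t)//
    /fired_part sA eA.
apply: le_trans (edge_fire_ge x t); rewrite /seg_fire.
have [b fp tb] := fired_part_start sA; rewrite fp/=.
rewrite /plateau max_l; last by lra.
case: b tb {fp} => [r||]; rewrite ?intrN; [|lra|lra].
rewrite lee_fin => rx; have : Num.max 0 (t + - r) <= t - (seg_start x).2.
  by rewrite ge_max; apply/andP; split; lra.
lra.
Qed.

Lemma firing_slope_end x : end_node (nxt x) \in A -> (seg_end (nxt x)).2 != +oo%E ->
  germ_slope_on f (seg_end (nxt x)).1 (seg_end_germ (nxt x)) <= (start_node x \notin A)%:Z.
Proof.
move=> eA foo; have [x0 xl] := seg_start_dom x; have [ex tx _] := nxtP x.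
have [r rE] : exists r, (seg_end (nxt x)).2 = r%:E.
  by case: (seg_end _).2 foo tx => [r||] // _ _; exists r.
have gE : seg_end_germ (nxt x) = Bwd r.
  by move: rE; case: (nxt x) => [e|p] /=; [rewrite /end_germ => ->|move=> [->]].
have vB := seg_end_germ_valid (nxt x); rewrite gE in vB *; rewrite ex in vB *.
rewrite rE lte_fin in tx.
have [a fp ar] : exists2 a, fired_part x = Some (a, r%:E) & a <= r.
  rewrite /fired_part eA rE; case: ifP => _; last by exists r.
  by exists (seg_start x).2 => //; exact: ltW.
have base : on_edge f (seg_start x).1 r = eps.
  rewrite fE; last by split; [lra|case: vB].
  exact: edge_fire_plateau fp ar (lexx _).
apply: germ_slope_Bwd_le => //; rewrite base.
have near_seg : \forall t \near germ_nbhs (Bwd r),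
    [/\ (seg_start x).2 <= t, t <= r & edge_dom (seg_start x).1 t].
  have h : germ_nbhs (Bwd r) [set t | (seg_start x).2 <= t /\ t <= r].
    by apply/germ_nbhs_Bwd; exists (r - (seg_start x).2) => [|t t1 t2]; [lra|split; lra].
  by apply: filterS2 h (valid_germ_dom vB) => t [h1 h2] h3.
apply: filterS near_seg => t [t1 t2 td]; rewrite fE//.
case sA: (start_node x \in A) => /=.
  by rewrite mul0r addr0 (@edge_fire_plateau x (seg_start x).2 r%:E t)// /fired_part sA eA rE.
apply: le_trans (edge_fire_ge x t); rewrite /seg_fire.
have -> : fired_part x = Some (r, r%:E) by rewrite /fired_part sA eA rE.
by rewrite /= plateau_left//; lra.
Qed.

Definition out_count v : nat :=
  outgoing (fun x => start_node x) (fun x => end_node (nxt x)) A v.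

Lemma out_countE v : out_count v =
  (\sum_(x : seg s) ((start_node x == v) && (end_node (nxt x) \notin A))
   + \sum_(x : seg s) ((end_node x == v) && (start_node (prv x) \notin A)))%N.
Proof.
rewrite /out_count /outgoing big_split/=; congr (_ + _)%N.
rewrite [RHS](reindex_inj (@nxt_inj _ _ s)); apply: eq_bigr => x _.
by rewrite nxtK.
Qed.

Let slope_end_prv x : end_node x \in A -> (seg_end x).2 != +oo%E ->
  germ_slope_on f (seg_end x).1 (seg_end_germ x) <= (start_node (prv x) \notin A)%:Z.
Proof. by move=> h1 h2; have := @firing_slope_end (prv x); rewrite prvK; apply. Qed.

Let sum_node (node_of : seg s -> node s) (vert : edge Gamma -> vertex Gamma)
    (G : pred (seg s)) w :
  (forall e, node_of (inl e) = inl (vert e)) -> (forall p, node_of (inr p) = inr p) ->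
  (\sum_(x : seg s) ((node_of x == inl w) && G x))%N%:Z
  = \sum_(e | vert e == w) (G (inl e))%:Z.
Proof.
move=> nl nr; rewrite (big_morph Posz PoszD (erefl _)) big_sumType/=.
rewrite [X in _ + X]big1 ?addr0 => [|p _]; last by rewrite nr.
rewrite [RHS]big_mkcond; apply: eq_bigr => e _; rewrite nl.
by rewrite (inj_eq inl_inj); case: eqP.
Qed.

Let sum_node_inner (node_of : seg s -> node s) (vert : edge Gamma -> vertex Gamma)
    (G : pred (seg s)) (p : seq_sub s) :
  (forall e, node_of (inl e) = inl (vert e)) -> (forall p, node_of (inr p) = inr p) ->
  (\sum_(x : seg s) ((node_of x == inr p) && G x))%N%:Z = (G (inr p))%:Z.
Proof.
move=> nl nr; rewrite (big_morph Posz PoszD (erefl _)) big_sumType/=.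
rewrite [X in X + _]big1 ?add0r => [|e _]; last by rewrite nl.
rewrite (bigD1 p)//= nr eqxx big1 ?addr0// => q /negbTE qp.
by rewrite nr (inj_eq inr_inj) qp.
Qed.

(** Only the directions out of A contribute, by -1 each. *)
Lemma firing_ord_fired v : v \in A -> finite_pt (node_pt v) ->
  - (out_count v)%:Z <= ord f (node_pt v).
Proof.
move=> vA vf; rewrite out_countE PoszD opprD.
case: v vA vf => [w|p] vA vf.
  rewrite (@sum_node (@start_node _ _ s) src)// (@sum_node (@end_node _ _ s) tgt)//.
  have -> : ord f (node_pt (inl w : node s)) = _ := ord_inl w fN.
  rewrite lerB//; last first.
    apply: ler_sum => e /eqP ew; apply: (@slope_end_prv (inl e)); first by rewrite /= ew.
    have [l el] : exists l : R, len e = l%:E by apply: tgt_len; rewrite ew.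
    by rewrite /= el.
  rewrite -sumrN; apply: ler_sum => e /eqP ew.
  by apply: (@firing_slope_start (inl e)); rewrite /= ew.
rewrite (@sum_node_inner (@start_node _ _ s) src)// (@sum_node_inner (@end_node _ _ s) tgt)//.
have -> : ord f (node_pt (inr p : node s)) = _ := ord_inr (val p) fN.
apply: lerB; first exact: (@firing_slope_start (inr p)).
exact: (@slope_end_prv (inr p)).
Qed.

(** A bounded function has slope 0 near infinity. *)
Lemma firing_ord_infinity e : len e = +oo%E -> 0 <= ord f (inl (tgt e)).
Proof.
move=> le; rewrite ord_infinity//.
have ve : valid_germ e Inf by [].
have [c hc] := germ_slope_on_affine fN ve.
suff -> : germ_slope_on f e Inf = 0 by [].
set k := germ_slope_on f e Inf in hc *.
have [M hM] := (germ_nbhs_Inf _).1 (filterI hc (valid_germ_dom ve)).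
have bnd t : M < t -> 0 <= k%:~R * t + c <= eps.
  by move=> /hM[<- td]; rewrite fE// edge_fire_ge0 edge_fire_le.
apply/eqP; rewrite -(intr_eq0 R); apply/negP => /negP k0.
have k1 : 0 < `|k%:~R| :> R by rewrite normr_gt0.
pose w : R := (eps + 1) / k%:~R.
have kw : k%:~R * w = eps + 1 by rewrite /w mulrC divfK.
have /andP[b1 b2] := bnd (M + 1 + `|w|) ltac:(have := normr_ge0 w; lra).
have /andP[b3 b4] := bnd (M + 1 + `|w| + w) ltac:(have := ler_norm (- w); rewrite normrN; lra).
by rewrite mulrDr kw in b3 b4; clear le ve; lra.
Qed.

(** Where the firing function vanishes it has a minimum.  Elsewhere outside A it is
locally a maximum of functions among which one is affine and attains the maximum. *)
Lemma firing_ord_other z : finite_pt z -> (forall v, v \in A -> node_pt v <> z) ->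
  0 <= ord f z.
Proof.
move=> zf zA; have [fz|fz] := pselect (f z = 0%E).
  by apply: ord_ge0_of_zero => // y; exact: firing_ge0.
have not_node v : node_pt v <> z.
  move=> vz; have := @firing_node v; rewrite vz => /(_ zf).
  by case: ifP => [/zA|_ /fz].
case: z zf zA fz not_node => [w|q] zf zA fz not_node; first by case: (not_node (inl w)).
have /andP[q0 ql] := valP q.
rewrite ord_inr//; case qE: (val q) q0 ql => [e t] /= t0 tl.
have td : edge_dom e t by split; exact: ltW.
have zE : inr q = edge_pt e t%:E by rewrite inr_edge_pt qE.
have Ht : 0 < edge_fire e t.
  rewrite lt_neqAle edge_fire_ge0 andbT eq_sym; apply/eqP => H0; apply: fz.
  by rewrite zE on_edgeE// fE// H0.
have [x xe xt] := edge_fire_attained Ht.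
case fp: (fired_part x) => [[a b]|]; last by move: Ht; rewrite -xt /seg_fire fp ltxx.
have [xa bx ab [_ [va vaA vaE]] fb] := fired_partP fp.
rewrite xe in vaE fb.
have ta : t <> a by move=> ta; apply: (not_node va); rewrite vaE zE ta.
have tb r : b = r%:E -> t <> r.
  by move=> br tr; have [_ [vb vbA vbE]] := fb r br; apply: (not_node vb); rewrite vbE zE tr.
suff [k [dl dl0 hk]] : exists k : int, exists2 dl : R, 0 < dl & forall r, `|r - t| < dl ->
    plateau a b r = plateau a b t + k%:~R * (r - t).
  have minor r : `|r - t| < dl -> edge_dom e r ->
      on_edge f e t + k%:~R * (r - t) <= on_edge f e r.
    move=> rt rd; rewrite !fE// -xt /seg_fire fp/= -hk//.
    by rewrite -xe; apply: le_trans (edge_fire_ge x r); rewrite /seg_fire fp.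
  have vF : valid_germ e (Fwd t) by split => //; exact: ltW.
  have vB : valid_germ e (Bwd t) by split => //; exact: ltW.
  have h1 : k <= germ_slope_on f e (Fwd t).
    apply: germ_slope_Fwd_ge => //.
    apply: filterS2 (@near_ray R true t dl dl0) (valid_germ_dom vF) => r; exact: minor.
  have h2 : germ_slope_on f e (Bwd t) <= k.
    apply: germ_slope_Bwd_le => //.
    apply: filterS2 (@near_ray R false t dl dl0) (valid_germ_dom vB) => r; exact: minor.
  by rewrite subr_ge0; exact: le_trans h2 h1.
have [ta'|at_] := ltP t a.
  exists 1; exists (a - t) => [|r]; first by lra.
  rewrite ltr_norml => /andP[r1 r2]; rewrite !plateau_left//; lra.
have {}at_ : a < t by lra.
case: b ab fb tb {bx fp xt} => [r0||] ab fb tb //.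
  have trn := tb r0 erefl; rewrite lee_fin in ab.
  have [tr|rt] := ltP t r0.
    exists 0; exists (Num.min (t - a) (r0 - t)) => [|r]; first by rewrite lt_min; apply/andP; split; lra.
    rewrite lt_min !ltr_norml => /andP[/andP[r1 r2] /andP[r3 r4]].
    by rewrite !plateau_in ?lee_fin; lra.
  exists (-1); exists (t - r0) => [|r]; first by lra.
  by rewrite ltr_norml => /andP[r1 r2]; rewrite !plateau_right//; lra.
clear fb tb; exists 0; exists (t - a) => [|r]; first by lra.
rewrite ltr_norml => /andP[r1 r2].
by rewrite (@plateau_in a +oo%E r) ?leey//; [rewrite plateau_in ?leey//; lra|lra].
Qed.

End Properties.

End Firing.

(** * Injectivity in large degree *)

Section LargeDegree.
Variables (R : realType) (Gamma : tropical_curve R).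
Implicit Types (e : edge Gamma) (f h : Rat_of Gamma) (x y z q : curve_point Gamma).
Local Notation ninfty := (Rat_ninfty Gamma).

(** If no such h existed, no set of nodes avoiding q could be fired, so every such
set would contain a node with fewer chips than outgoing segments.  By
[burning_bound], the coefficients away from q would have sum at most the number
of segments minus the number of nodes plus 1, that is at most the genus. *)
Lemma firing_fraction (E : divisor Gamma) q : effective E -> finite_pt q ->
  (forall e, len e = +oo%E -> coeff (inl (tgt e)) E = 0) ->
  (genus Gamma)%:Z < deg E - coeff q E ->
  exists h, [/\ h <> ninfty, forall x, 0 <= coeff x E + ord h x, h q = 0%E &
    exists2 z, finite_pt z & (0 < h z)%E].
Proof.
move=> effE qf Einf gE; apply: contrapT => noh.
have [s [sE sq _]] := inner_points_ex E (fun=> [::]) [:: q].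
have [vq vqE] : exists v : node s, node_pt v = q.
  case: q qf gE noh sq => [w|p] qf gE noh sq; first by exists (inl w).
  by have ps : p \in s by [apply: sq; rewrite inE]; exists (inr (SeqSub ps)).
pose ch (v : node s) : int := coeff (node_pt v) E.
have [eps eps0 gap] := node_gap s.
have burn (B : {set node s}) : B \subset [set~ vq]%SET -> B != finset.set0 ->
    exists2 v, v \in B & ch v < (outgoing (fun x : seg s => start_node x) (fun x : seg s => end_node (nxt x)) B v)%:Z.
  move=> BA /finset.set0Pn[v0 v0B]; apply: contrapT => nov.
  have out v : v \in B -> (out_count B v)%:Z <= ch v.
    by move=> vB; rewrite leNgt; apply/negP => lt; apply: nov; exists v.
  have [h hB] := is_firing_ex B eps0 gap.
  apply: noh; exists h; have hN : h <> ninfty by case: hB.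
  split=> //.
  - move=> x; have [xf|] := boolP (finite_pt x); last first.
      rewrite negbK => /existsP[e /andP[/eqP le /eqP ->]].
      by rewrite addr_ge0 ?effE//; exact: (firing_ord_infinity eps0 hB).
    have [[v vB vx]|nv] := pselect (exists2 v, v \in B & node_pt v = x).
      have := firing_ord_fired eps0 hB vB; rewrite vx => /(_ xf).
      by have := out v vB; rewrite /ch vx; lia.
    rewrite addr_ge0 ?effE//; apply: (firing_ord_other eps0 gap hB) => // v vB vx.
    by apply: nv; exists v.
  - rewrite -vqE (firing_node eps0 gap hB) ?vqE//.
    case: ifP => // vqB; move/fintype.subsetP: BA => /(_ vq vqB).
    by rewrite !finset.inE eqxx.
  - suff [v vB vf] : exists2 v, v \in B & finite_pt (node_pt v).
      by exists (node_pt v) => //; rewrite (firing_node eps0 gap hB)// vB lte_fin.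
    (* A point at infinity carries no chip, so its segment starts in B. *)
    have [vf|] := boolP (finite_pt (node_pt v0)); first by exists v0.
    rewrite negbK => /existsP[e /andP[/eqP le /eqP v0E]].
    have v0E' : v0 = inl (tgt e) by apply: (@node_pt_inj _ _ s); rewrite v0E.
    pose x : seg s := prv (inl e).
    exists (start_node x); last by rewrite start_node_pt edge_pt_finite.
    apply: contraT => xB; have := out v0 v0B.
    rewrite /ch v0E Einf// /out_count /outgoing (bigD1 x)//=.
    by rewrite prvK /= v0E' eqxx xB /= addn1 addSn.
have bound := @burning_bound _ _ _ _ ch [set~ vq]%SET burn.
have tch : (touching (fun x : seg s => start_node x) (fun x : seg s => end_node (nxt x)) [set~ vq]%SET <= #|seg s|)%N.
  by rewrite -sum1_card; apply: leq_sum => x _; case: (_ || _).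
have cA : #|node s| = (#|[set~ vq]%SET|).+1 by rewrite cardsC1 prednK//; apply/card_gt0P; exists vq.
have dE : deg E = coeff q E + \sum_(v in [set~ vq]%SET) ch v.
  rewrite (deg_nodes sE) (bigD1 vq)//= vqE; congr (_ + _).
  by apply: eq_bigl => v; rewrite !finset.inE.
have := card_node_seg s; have := genus_ge Gamma; move: gE bound tch cA dE.
set S := \sum_(_ in _) _; set t := touching _ _ _; set a := #|pred_of_set _|.
lia.
Qed.

Lemma coeff2_le_deg (E : divisor Gamma) x y : effective E -> x <> y ->
  coeff x E + coeff y E <= deg E.
Proof.
move=> effE xy; have [s [sE sq _]] := inner_points_ex E (fun=> [::]) [:: x; y].
have nod z : z \in [:: x; y] -> exists v : node s, node_pt v = z.
  case: z => [w|p] zq; first by exists (inl w).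
  by exists (inr (SeqSub (sq p zq))).
have [v vE] := nod x ltac:(by rewrite inE eqxx).
have [w wE] := nod y ltac:(by rewrite !inE eqxx orbT).
have vw : w != v by apply/eqP => wv; apply: xy; rewrite -vE -wE wv.
rewrite (deg_nodes sE) (bigD1 v)//= (bigD1 w)//= vE wE addrA lerDl.
by apply: sumr_ge0 => u _; exact: effE.
Qed.

Variables (D : divisor Gamma) (n : nat) (F : 'I_n -> Rat_of Gamma).
Hypothesis effD : effective D.
Hypothesis genF : generates D F.
Hypothesis F_neq : forall i, F i <> ninfty.

Theorem phi_injective : ((2 * genus Gamma + 1)%N%:Z <= deg D)%R -> injective (phi F).
Proof.
move=> degD [x xf] [y yf] phixy; apply: val_inj => /=; apply: contrapT => xy.
have Fxy i : F i x = F i y.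
  have := congr1 (fun g => g i) phixy; rewrite /phi /= => E.
  by rewrite (Rat_finite (@F_neq i) xf) (Rat_finite (@F_neq i) yf) E.
have RDxy f : RD D f -> f x = f y.
  move=> fD; have [t ->] := genF.2 _ fD; rewrite !Rat_sumP//.
  by apply: eq_bigr => i _; rewrite !Rat_mulP// Fxy; case: (t i).
have [G [GN GD Gx Gmax]] := peak_ex effD genF F_neq xf.
pose E : divisor Gamma := D + div G.
have EE z : coeff z E = coeff z D + ord G z by rewrite coeffD coeff_div.
have effE : effective E by move=> z; rewrite EE; move/(RDP D GN): GD; apply.
have degE : deg E = deg D by rewrite [deg _]raddfD/= principal_divisor_deg// addr0.
have inE h : h <> ninfty -> (forall z, 0 <= coeff z E + ord h z) -> RD D (G * h).
  by move=> hN hE; apply: RD_mul => // z; rewrite -EE.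
have maxx h z : h <> ninfty -> (forall z, 0 <= coeff z E + ord h z) -> finite_pt z ->
    fine (h z) <= fine (h x).
  move=> hN hE zf; have GhN := Rat_mul_neq GN hN.
  have := Gmax _ (inE h hN hE) GhN z zf.
  rewrite !Rat_mulP// (Rat_finite GN zf) (Rat_finite GN xf) (Rat_finite hN zf) (Rat_finite hN xf).
  by rewrite Gx -!EFinD /=; lra.
have Einf e : len e = +oo%E -> coeff (inl (tgt e)) E = 0.
  move=> le; apply/le_anti; rewrite effE andbT leNgt; apply/negP => Epos.
  have [e' [t [td xE]]] := finite_pt_edge e xf.
  have M0 : 0 < `|t| + 1 by have := normr_ge0 t; lra.
  have [u [uN uE uE' uinf uord]] := ramp_ex le M0.
  have ux : fine (u x) = 0.
    rewrite xE -[fine _]/(on_edge u e' t); have [->|ne] := eqVneq e' e; last exact: uE'.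
    by rewrite uE max_l//; have := ler_norm t; lra.
  have uz : fine (u (edge_pt e (`|t| + 1 + 1)%:E)) = 1.
    by rewrite -[fine _]/(on_edge u e _) uE max_r; lra.
  have := @maxx u (edge_pt e (`|t| + 1 + 1)%:E) uN; rewrite ux uz.
  suff H : forall z, 0 <= coeff z E + ord u z.
    by move=> /(_ H (edge_pt_finite _ _)); rewrite ler10.
  move=> z; have [->|/eqP ze] := eqVneq z (inl (tgt e)).
    by rewrite uinf subr_ge0 -gtz0_ge1.
  by rewrite addr_ge0 ?effE ?uord.
have Ex : (genus Gamma)%:Z + 1 <= coeff x E.
  rewrite leNgt; apply/negP => lt.
  have [|h [hN hE hx [z zf hz]]] := firing_fraction effE xf Einf.
    by rewrite degE; move: lt degD; lia.
  have := maxx h z hN hE zf; rewrite hx /=.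
  by move: hz; rewrite (Rat_finite hN zf) lte_fin ltNge => /negP h0 /h0.
have [|h [hN hE hy [z zf hz]]] := firing_fraction effE yf Einf.
  by have := coeff2_le_deg effE xy; move: Ex; lia.
have hz' := maxx h z hN hE zf.
have := RDxy _ (inE h hN hE); rewrite !Rat_mulP// -(RDxy _ GD) Gx hy !add0e => hx0.
by move: hz hz'; rewrite (Rat_finite hN zf) hx0 /= lte_fin ltNge => /negP h0 /h0.
Qed.

End LargeDegree.

(** * The theorem *)

Theorem corollary3p21 (R : realType) (Gamma : tropical_curve R)
    (D : divisor Gamma) (n : nat) (F : 'I_n -> Rat_of Gamma) :
  effective D ->
  generates D F ->
  (forall i, F i <> Rat_ninfty Gamma) ->
  (injective (phi F) ->
     talg_isomorphic (Rat_talg Gamma) (trat_quot (range (phi F))))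
  /\ (((2 * genus Gamma + 1)%N%:Z <= deg D)%R -> injective (phi F)).
Proof.
move=> effD genF F_neq; split=> [phi_inj|]; last exact: phi_injective.
apply: Rat_isomorphic => // f fN.
exact: (Rat_tropical_expr effD genF F_neq phi_inj fN).
Qed.
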